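(* Let $s,R>0$ and let $(\varphi_j)_{j\ge1}$ be any orthonormal basis of $\mathbb L^2([0,1])$. There is an absolute constant $c>0$ such that every classifier $\hat\Phi$ built from $n$ i.i.d. observations of the model satisfies, for every $n\ge\max\{R^{1/s},(32\log 2+2)^{2s+1}/(3R^2/4)\}$ and every $\Delta\in(0,R/2]$, \[ \sup_{\substack{f,g\in\mathcal H_s(R)\\ \|f-g\|\ge\Delta}}\Big\{\mathcal R_{f,g}(\hat\Phi)-\inf_\Phi\mathcal R_{f,g}(\Phi)\Big\}\ge \begin{cases} c\,e^{-2R^{2/(2s+1)}}R^{1/(2s+1)}n^{-s/(2s+1)} & \text{if }\Delta<R^{1/(2s+1)}n^{-s/(2s+1)},\\[0.3em] \dfrac{c\,e^{-2\Delta^2}}{\Delta}R^{2/(2s+1)}n^{-2s/(2s+1)} & \text{if }\Delta\ge R^{1/(2s+1)}n^{-s/(2s+1)}.\end{cases} \]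
   Context: Model: for $f,g\in\mathbb L^2([0,1])$, a pair $(X,Y)$ is generated by $Y\sim\mathrm{Bernoulli}(1/2)$ independent of a standard Brownian motion $W$ on $[0,1]$, and $dX(t)=Yf(t)\,dt+(1-Y)g(t)\,dt+dW(t)$, $t\in[0,1]$. The learner observes $n$ i.i.d. copies $(X_i,Y_i)_{1\le i\le n}$. A classifier is a measurable map (possibly depending on the sample) from continuous trajectories on $[0,1]$ to $\{0,1\}$; its risk is $\mathcal R_{f,g}(\Phi)=\mathbb P(\Phi(X)\ne Y)$, with probability over the sample and an independent new pair $(X,Y)$; the infimum is over all classifiers. $\|\cdot\|$ is the $\mathbb L^2([0,1])$ norm. With $c_j(h)=\int_0^1 h\varphi_j$, $\mathcal H_s(R)=\{h\in\mathbb L^2([0,1]):\sum_{j\ge1}c_j(h)^2j^{2s}\le R^2\}$. *)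

(* Defs.v *)
From HB Require Import structures.
From mathcomp Require Import all_boot all_order all_algebra.
From mathcomp Require Import all_classical all_reals all_analysis.
Set Implicit Arguments. Unset Strict Implicit. Unset Printing Implicit Defensive.
Import Order.TTheory GRing.Theory Num.Theory.
Import numFieldNormedType.Exports.
Local Open Scope classical_set_scope.
Local Open Scope ring_scope.

Section Defs.
Context {R : realType}.
Local Notation I01 := (`[(0:R), (1:R)]%classic : set R).

Definition L2 (h : R -> R) : Prop :=
  measurable_fun I01 h /\
  (\int[lebesgue_measure]_(x in I01) ((h x) ^+ 2)%:E < +oo)%E.

Definition ip (h k : R -> R) : R :=
  Rintegral lebesgue_measure I01 (fun x => h x * k x).

Definition L2norm (h : R -> R) : R := Num.sqrt (ip h h).

(* (phi_j)_{j>=1} is an orthonormal basis of L^2([0,1]) (phi 0 is unused) *)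
Definition ONB (phi : nat -> R -> R) : Prop :=
  (forall j, (0 < j)%N -> L2 (phi j)) /\
  (forall i j, (0 < i)%N -> (0 < j)%N -> ip (phi i) (phi j) = (i == j)%:R) /\
  (forall h, L2 h -> (forall j, (0 < j)%N -> ip h (phi j) = 0) -> ip h h = 0).

Definition Hs (phi : nat -> R -> R) (s Rad : R) (h : R -> R) : Prop :=
  L2 h /\
  (\sum_(1 <= j <oo) (((ip h (phi j)) ^+ 2 * (j%:R `^ (2 * s)))%:E)
     <= (Rad ^+ 2)%:E)%E.

Section Prob.
Context {d : measure_display} {Omega : measurableType d}.

Definition gen_sigma (F : set (Omega -> R)) : set (set Omega) :=
  <<s [set A | exists X B, F X /\ measurable B /\ A = X @^-1` B] >>.

Definition mutually_independent (P : probability Omega R) (I : eqType)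
    (F : I -> set (set Omega)) : Prop :=
  forall (J : seq I), uniq J -> forall A : I -> set Omega,
    (forall i, i \in J -> F i (A i)) ->
    P (\big[setI/setT]_(i <- J) A i) = (\prod_(i <- J) P (A i))%E.

Definition std_BM (P : probability Omega R) (W : Omega -> R -> R) : Prop :=
  (forall t, measurable_fun setT (fun w => W w t)) /\
  (forall w, W w 0 = 0 /\ {within I01, continuous (W w)}) /\
  (forall (k : nat) (t : nat -> R) (B : nat -> set R),
     0 <= t 0 -> (forall j, (j < k)%N -> t j < t j.+1) -> t k <= 1 ->
     (forall j, measurable (B j)) ->
     P (\big[setI/setT]_(j < k) [set w | B j (W w (t j.+1) - W w (t j))]) =
     (\prod_(j < k) normal_prob 0 (Num.sqrt (t j.+1 - t j)) (B j))%E).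

(* the n+1 i.i.d. copies (index ord_max = the new pair) of (W, Y):
   W_i standard BMs, Y_i ~ Bernoulli(1/2), all mutually independent *)
Definition model (n : nat) (P : probability Omega R)
    (W : 'I_n.+1 -> Omega -> R -> R) (Y : 'I_n.+1 -> Omega -> bool) : Prop :=
  (forall i, std_BM P (W i)) /\
  (forall i, measurable [set w | Y i w] /\ P [set w | Y i w] = (1 / 2)%:E) /\
  mutually_independent P
    (fun k : 'I_n.+1 + 'I_n.+1 => match k with
     | inl i => gen_sigma [set (fun w => W i w t) | t in I01]
     | inr i => gen_sigma [set (fun w => (Y i w)%:R)]
     end).

End Prob.

Definition path_of (f g : R -> R) (y : bool) (w : R -> R) : R -> R :=
  fun t => Rintegral lebesgue_measure (`[(0:R), t]%classic : set R) (if y then f else g) + w t.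

(* data = (sample of n labelled trajectories, new trajectory) *)
Definition Data (n : nat) : Type := ('I_n -> (R -> R) * bool) * (R -> R).

Definition data_gen (n : nat) : set (set (Data n)) :=
  fun A =>
    (exists (i : 'I_n) t B, 0 <= t <= 1 /\ measurable B /\
       A = [set x : Data n | B ((x.1 i).1 t)]) \/
    (exists (i : 'I_n), A = [set x : Data n | (x.1 i).2]) \/
    (exists t B, 0 <= t <= 1 /\ measurable B /\ A = [set x : Data n | B (x.2 t)]).

Definition is_classifier (n : nat) (Phi : Data n -> bool) : Prop :=
  forall b : bool, smallest (sigma_algebra setT) (@data_gen n) (Phi @^-1` [set b]).

Definition data_of {d : measure_display} {Omega : measurableType d} (n : nat)
    (W : 'I_n.+1 -> Omega -> R -> R) (Y : 'I_n.+1 -> Omega -> bool)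
    (f g : R -> R) (w : Omega) : Data n :=
  (fun i : 'I_n =>
     let k := widen_ord (leqnSn n) i in (path_of f g (Y k w) (W k w), Y k w),
   path_of f g (Y ord_max w) (W ord_max w)).

Definition risk {d : measure_display} {Omega : measurableType d} (n : nat)
    (P : probability Omega R)
    (W : 'I_n.+1 -> Omega -> R -> R) (Y : 'I_n.+1 -> Omega -> bool)
    (f g : R -> R) (Phi : Data n -> bool) : \bar R :=
  P [set w | Phi (data_of W Y f g w) != Y ord_max w].

End Defs.

(* Main.v *)
(* Bayes reduction over the hypercube f_t = (Delta/2) phi_1 + n^(-1/2) sum_j t_j phi_(j+1),
   t in {-1,1}^N, with g_t = - f_t.  Averaging over t, the risk of a classifier is
   bounded below as if, given the sample, it were told an unordered pair {t, t'} of
   independent draws from the posterior: it then classifies between the symmetric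
   mixtures of N(f_t), N(f_t') and of N(-f_t), N(-f_t'), for which the linear rule based
   on f_t + f_t' is optimal.  Its error is the Gaussian tail at |f_t + f_t'| / 2, to be
   compared with the Bayes error, the tail at |f_t|; the gap is of order
   pdf(|f_t|) |f_t - f_t'|^2 / |f_t|.  Two posterior draws disagree on a positive fraction
   of the coordinates because flipping one coordinate moves the sample law by a bounded
   chi-square divergence.

   No stochastic integral is needed: the classifier is approximated by a set depending
   on finitely many dyadic times, where the model is a finite array of independent
   Gaussian increments, and the grid norms converge to the L2 norms by Lebesgue
   differentiation and Fatou. *)

Require Import Defs.
From HB Require Import structures.
From mathcomp Require Import all_boot all_order all_algebra.
From mathcomp Require Import all_classical all_reals all_analysis.
From mathcomp Require Import measurable_realfun ring lra.
Set Implicit Arguments. Unset Strict Implicit. Unset Printing Implicit Defensive.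
Import Order.TTheory GRing.Theory Num.Theory.
Import numFieldNormedType.Exports.
Local Open Scope classical_set_scope.
Local Open Scope ring_scope.

(** * Densities and Gaussian shifts *)

(** The full posterior mixture has no explicit optimal rule; two hypotheses do, because
    [expR x + expR x'] and [expR (- x) + expR (- x')] have ratio [expR (x + x')]. This is why a pair
    is revealed and why its order stays hidden. The identity needs equal norms, which the hypercube
    has in L2 but only up to [eta] on the grid; hence the normalising factors and one-sided errors
    below.

    The Bayes risk is never computed. It is bounded above by the risk of a linear rule on the grid,
    and the same grid tail occurs in the lower bound for an arbitrary classifier, so the two cancel.
    The cube being finite, one mesh and one [eta], chosen once the gap is known, serve all
    parameters.

    The amplitude [n^(-1/2)] makes one flip cost [n * 4 / n = 4] in squared distance over the
    sample, whence [expR 4] in the constant. The coordinate [Delta / 2] separates [f] from [- f] and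
    keeps [f_t + f_t'] away from zero. With [r] the rate and [N / n] of order [r^2], the gap is of
    order [r^2 / rho] times a Gaussian density at [rho], where [rho] is comparable to the larger of
    [r] and [Delta]: these are the two regimes. *)

Section density_measure.
Context d (T : measurableType d) (R : realType).
Variables (mu : {measure set T -> \bar R}) (g : T -> R).
Hypotheses (mg : measurable_fun setT g) (g0 : forall x, 0 <= g x).

(** The two proofs are arguments of the definition so that the measure instance declared below
    attaches to the term itself. *)
Definition density_measure of measurable_fun setT g & (forall x, 0 <= g x) :=
  fun A => (\int[mu]_(x in A) (g x)%:E)%E.

Local Notation nu := (density_measure mg g0).

Let nu0 : nu set0 = 0%E. Proof. exact: integral_set0. Qed.
Let nu_ge0 A : (0 <= nu A)%E.
Proof. by apply: integral_ge0 => x _; rewrite lee_fin. Qed.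
Let nu_sigma_additive : semi_sigma_additive nu.
Proof.
move=> F mF tF mUF; rewrite /density_measure ge0_integral_bigcup//=; last 2 first.
- by apply/measurable_EFinP; exact: measurable_funTS.
- by move=> x _; rewrite lee_fin.
by apply: is_cvg_nneseries => n _ _; apply: integral_ge0 => x _; rewrite lee_fin.
Qed.

HB.instance Definition _ := isMeasure.Build _ _ _ nu nu0 nu_ge0 nu_sigma_additive.

Import HBNNSimple.

(** Both sides pass to the limit along increasing simple functions, so only indicators remain, where
    the identity is the definition of the density. *)
Lemma ge0_integral_density (f : T -> \bar R) :
  measurable_fun setT f -> (forall x, 0 <= f x)%E ->
  (\int[nu]_x f x = \int[mu]_x (f x * (g x)%:E))%E.
Proof.
move=> mf f0.
pose f_ := nnsfun_approx measurableT mf.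
have fl x : limn (fun n => (f_ n x)%:E) = f x.
  by apply/cvg_lim => //; exact: cvg_nnsfun_approx.
transitivity (limn (fun n => \int[nu]_x (f_ n x)%:E)%E).
  rewrite -monotone_convergence//.
  - by apply: eq_integral => x _; rewrite fl.
  - by move=> n; exact/measurable_EFinP/measurable_funP.
  - by move=> n x _; rewrite lee_fin.
  - by move=> x _ m n mn; rewrite lee_fin; exact/lefP/nd_nnsfun_approx.
transitivity (limn (fun n => \int[mu]_x ((f_ n x)%:E * (g x)%:E))%E); last first.
  rewrite -monotone_convergence//.
  - apply: eq_integral => x _; apply/cvg_lim => //.
    by apply: cvgeZr => //; exact: cvg_nnsfun_approx.
  - move=> n; apply: emeasurable_funM; exact/measurable_EFinP.
  - by move=> n x _; rewrite mule_ge0// lee_fin.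
  - by move=> x _ m n mn; rewrite lee_wpmul2r ?lee_fin//; exact/lefP/nd_nnsfun_approx.
congr (limn _); apply/funext => n.
under [LHS]eq_integral do rewrite fimfunE -fsumEFin//.
rewrite ge0_integral_fsum//; last 2 first.
- by move=> r; exact/measurable_EFinP/measurable_funM.
- by move=> r x _; rewrite nnfun_muleindic_ge0.
under [RHS]eq_integral.
  move=> x _; rewrite fimfunE -fsumEFin// ge0_mule_fsuml; last first.
    by move=> r; rewrite nnfun_muleindic_ge0.
  over.
rewrite ge0_integral_fsum//; last 2 first.
- move=> r; apply: emeasurable_funM; last exact/measurable_EFinP.
  exact/measurable_EFinP/measurable_funM.
- by move=> r x _; rewrite mule_ge0 ?lee_fin// -lee_fin nnfun_muleindic_ge0.
apply: eq_fsbigr => r _.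
rewrite integralZl_indic_nnsfun// integral_indic// setIT.
transitivity (r%:E * \int[mu]_(x in f_ n @^-1` [set r]) (g x)%:E)%E; first by [].
have [r0|r0] := leP 0 r; last first.
  rewrite preimage_nnfun0// integral_set0 mule0.
  by rewrite integral0_eq// => x _; rewrite indicE in_set0/= mulr0 mul0e.
rewrite -ge0_integralZl//; last 2 first.
- exact/measurable_EFinP/measurable_funTS.
- by move=> x _; rewrite lee_fin.
rewrite integral_mkcond; apply: eq_integral => x _.
rewrite patchE indicE; case: ifPn => xr; first by rewrite mulr1.
by rewrite mulr0 mul0e.
Qed.

End density_measure.

Section lebesgue_translation.
Context (R : realType).
Local Notation mu := (@lebesgue_measure R).

(** The image of Lebesgue measure under a translation has the right value on half-open intervals,
    hence is Lebesgue measure. *)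
Lemma ge0_integral_translation (f : R -> \bar R) (a : R) :
  measurable_fun setT f -> (forall x, 0 <= f x)%E ->
  (\int[mu]_x f (x + a)%R = \int[mu]_x f x)%E.
Proof.
move=> mf f0.
have ms : measurable_fun setT (fun x : R => x + a).
  by apply: measurable_funD.
rewrite -[LHS](@ge0_integral_pushforward _ _ (measurableTypeR R) (measurableTypeR R)
  R _ ms mu setT f)//.
apply: eq_measure_integral => A mA _; apply/esym/lebesgue_measure_unique => //.
move=> _ [[b c]] _ <-; rewrite /pushforward/=.
transitivity (mu `]b - a, c - a]%classic); last first.
  congr (mu _); apply/seteqP; split=> x /=; rewrite !in_itv/= ltrBlDr lerBrDr//.
by rewrite !lebesgue_measure_itv/= !lte_fin ltrD2r -!EFinB opprB addrA subrK.
Qed.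

End lebesgue_translation.

Section normal_shift.
Context (R : realType).
Variables (s : R).
Hypothesis s0 : s != 0.

Lemma integral_normal_prob (f : R -> \bar R) m :
  measurable_fun setT f -> (forall x, 0 <= f x)%E ->
  (\int[normal_prob m s]_x f x
   = \int[lebesgue_measure]_x (f x * (normal_pdf m s x)%:E))%E.
Proof.
move=> mf f0.
apply: etrans (@ge0_integral_density _ (measurableTypeR R) R lebesgue_measure _
  (measurable_normal_pdf m s) (fun x => normal_pdf_ge0 m s x) f mf f0).
exact: eq_measure_integral.
Qed.

Lemma normal_pdf_shift t x :
  normal_pdf 0 s (x - t) = normal_pdf 0 s x * expR ((t * x - t ^+ 2 / 2) / s ^+ 2).
Proof.
rewrite !normal_pdfE// /normal_fun -mulrA -expRD; congr (_ * expR _).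
by field.
Qed.

(** The Cameron-Martin formula in dimension one: translate the variable and read the ratio of
    densities off [normal_pdf_shift]. *)
Lemma normal_prob_shift t (B : set R) : measurable B ->
  (normal_prob 0 s [set x | B (x + t)%R] =
   \int[normal_prob 0 s]_(x in B) (expR ((t * x - t ^+ 2 / 2) / s ^+ 2))%:E)%E.
Proof.
move=> mB.
have mS : measurable [set x : R | B (x + t)].
  rewrite -[X in measurable X]setTI.
  have mf : measurable_fun setT (fun x : R => x + t) by apply: measurable_funD.
  exact: mf.
have mE : measurable_fun setT (fun x : R => expR ((t * x - t ^+ 2 / 2) / s ^+ 2)).
  apply: measurableT_comp => //; apply: measurable_funM => //.
  by apply: measurable_funB => //; apply: measurable_funM.
rewrite [RHS]integral_mkcond integral_normal_prob; last 2 first.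
- apply/(measurable_restrictT _ mB)/measurable_funTS.
  exact/measurable_EFinP.
- by move=> x; apply: erestrict_ge0 => y _; rewrite lee_fin expR_ge0.
rewrite -[RHS](ge0_integral_translation t); last 2 first.
- apply: emeasurable_funM.
    apply/(measurable_restrictT _ mB)/measurable_funTS; exact/measurable_EFinP.
  by apply/measurable_EFinP; exact: measurable_normal_pdf.
- move=> x; rewrite mule_ge0 ?lee_fin ?normal_pdf_ge0//.
  by apply: erestrict_ge0 => y _; rewrite lee_fin expR_ge0.
rewrite /normal_prob integral_mkcond; apply: eq_integral => x _.
have e : (x + t \in B) = (x \in [set x | B (x + t)]).
  by apply/idP/idP; rewrite !inE.
rewrite !patchE e; case: ifPn => _; last by rewrite mul0e.
rewrite -EFinM mulrC -normal_pdf_shift addrK//.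
Qed.

End normal_shift.

(** * Arrays of independent Gaussian variables *)

Section real_arrays.
Context (R : realType) (I : finType).

Definition boxes : set (set (I -> R)) :=
  [set A | exists B : I -> set R,
     (forall i, measurable (B i)) /\ A = [set z | forall i, B i (z i)]].

(** The product sigma-algebra on [I -> R]. Its generators are stable under intersection, so a finite
    measure is determined by its values on boxes. *)
Definition array := g_sigma_algebraType boxes.
HB.instance Definition _ := Measurable.on array.

Lemma boxes_setI : setI_closed boxes.
Proof.
move=> _ _ [B [mB ->]] [C [mC ->]]; exists (fun i => B i `&` C i); split.
  by move=> i; exact: measurableI.
by apply/seteqP; split=> z /=; [case=> zB zC i; split|move=> z1; split=> i; case: (z1 i)].
Qed.

Lemma measurable_box (B : I -> set R) : (forall i, measurable (B i)) ->
  measurable ([set z | forall i, B i (z i)] : set array).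
Proof. by move=> mB; apply: sub_sigma_algebra; exists B. Qed.

Lemma measurable_coord i : measurable_fun [set: array] (fun z : array => z i : R).
Proof.
move=> _ B mB; rewrite setTI.
have := @measurable_box (fun j => if j == i then B else setT).
have -> : [set z : array | forall j, (if j == i then B else setT) (z j)] =
  (fun z : array => z i) @^-1` B.
  apply/seteqP; split=> z /=; first by move=> /(_ i); rewrite eqxx.
  by move=> zB j; case: eqP => [->|].
by apply=> j; case: ifP.
Qed.

Lemma measurable_fun_array d (T : measurableType d) (f : T -> array) :
  (forall i, measurable_fun setT (fun x => f x i : R)) -> measurable_fun setT f.
Proof.
move=> mf; apply: (@measurability _ _ T array setT f boxes) => //.
move=> _ [_ [B [mB ->]] <-]; rewrite setTI.
have -> : f @^-1` [set z | forall i, B i (z i)] =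
          \bigcap_(i in [set: I]) ((fun x => f x i) @^-1` B i).
  by apply/seteqP; split=> x H i; [move=> _; exact: H|exact: (H i Logic.I)].
apply: fin_bigcap_measurable => // i _.
by rewrite -[X in measurable X]setTI; exact: mf.
Qed.

Lemma array_measure_unique (m1 m2 : {measure set array -> \bar R}) :
  (m1 setT < +oo)%E ->
  (forall B : I -> set R, (forall i, measurable (B i)) ->
    m1 [set z | forall i, B i (z i)] = m2 [set z | forall i, B i (z i)]) ->
  forall A, measurable A -> m1 A = m2 A.
Proof.
move=> m1T m12; apply: (@measure_unique _ R array boxes (fun=> setT)) => //.
- exact: boxes_setI.
- by move=> _; exists (fun=> setT); split=> //; apply/seteqP; split.
- by rewrite bigcup_const.
- by move=> _ [B [mB ->]]; exact: m12.
Qed.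

End real_arrays.

Section gaussian_array.
Context (R : realType) (I : finType) (s : R) (gamma : probability (array R I) R).
Local Notation array := (array R I).

(** A property of an abstract law rather than the construction of a product measure: it is
    established later for the image of [P] under the Brownian increments. *)
Definition gaussian_array := forall B : I -> set R, (forall i, measurable (B i)) ->
  gamma [set z : array | forall i, B i (z i)] = (\prod_i normal_prob 0 s (B i))%E.

Hypotheses (s0 : s != 0) (gammaP : gaussian_array).

Definition shift1 (l : I) (t : R) (z : array) : array :=
  fun i => z i + (if i == l then t else 0).

Lemma measurable_shift1 l t : measurable_fun setT (shift1 l t).
Proof.
apply: measurable_fun_array => i; apply: measurable_funD => //.
exact: measurable_coord.
Qed.

Definition tilt1 (l : I) (t : R) (z : array) : R :=
  expR ((t * z l - t ^+ 2 / 2) / s ^+ 2).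

Lemma measurable_tilt1 l t : measurable_fun setT (tilt1 l t).
Proof.
apply: measurableT_comp => //; apply: measurable_funM => //.
apply: measurable_funB => //; apply: measurable_funM => //.
exact: measurable_coord.
Qed.

Lemma tilt1_ge0 l t z : 0 <= tilt1 l t z. Proof. exact: expR_ge0. Qed.

(** Restrict [gamma] to the constraints on the other coordinates and push it forward by coordinate
    [l]: by independence the image is a multiple of the normal law, the factor being the mass of the
    other sides. *)
Lemma integral_box_coord (l : I) (g : R -> R) (B : I -> set R) :
  (forall i, measurable (B i)) -> measurable_fun setT g -> (forall x, 0 <= g x) ->
  (\int[gamma]_(z in [set z : array | forall i, B i (z i)]) (g (z l))%:E =
   (\int[normal_prob 0 s]_(x in B l) (g x)%:E) *
     \prod_(i | i != l) normal_prob 0 s (B i))%E.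
Proof.
move=> mB mg g0.
pose C : set array := [set z | forall i, i != l -> B i (z i)].
have boxE : [set z : array | forall i, B i (z i)] = C `&` (fun z => z l) @^-1` B l.
  apply/seteqP; split=> z /=; first by move=> H; split => // i _; exact: H.
  by move=> [H Hl] i; have [->//|] := eqVneq i l; exact: H.
have mC : measurable C.
  have -> : C = [set z : array | forall i, (if i == l then setT else B i) (z i)].
    apply/seteqP; split=> z /= H i; first by case: eqVneq => // /H.
    by move=> il; have := H i; rewrite (negPf il).
  by apply: (@measurable_box R I (fun i => if i == l then setT else B i)) => i; case: ifP.
have m1 : measurable_fun setT (\1_C : array -> R) by exact: measurable_indic.
have h1 (z : array) : 0 <= (\1_C z : R) by [].
pose pr : array -> measurableTypeR R := fun z => z l.
have ml : measurable_fun setT pr by exact: measurable_coord.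
pose nu := pushforward (density_measure gamma m1 h1) pr.
pose c := fine (\prod_(i | i != l) normal_prob 0 s (B i))%E.
have cE : (c%:E = \prod_(i | i != l) normal_prob 0 s (B i))%E.
  by rewrite fineK//; apply: prode_fin_num => i _; apply: (@fin_num_measure _ _ _ (normal_prob 0 s)); exact: mB.
have c0 : 0 <= c by rewrite fine_ge0// prode_ge0.
have nuE A : measurable A -> nu A = (c%:E * normal_prob 0 s A)%E.
  move=> mA; rewrite /nu /pushforward /density_measure integral_indic//; last first.
    by rewrite -[X in measurable X]setTI; exact: ml.
  pose D i : set R := if i == l then A else B i.
  have -> : C `&` (fun z => z l) @^-1` A = [set z : array | forall i, D i (z i)].
    apply/seteqP; split=> z /=; rewrite /D.
      by move=> [H Hl] i; case: eqVneq => [->//|]; exact: H.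
    move=> H; split; last by have := H l; rewrite eqxx.
    by move=> i il; have := H i; rewrite (negPf il).
  have mD i : measurable (D i) by rewrite /D; case: ifP => _; [exact: mA|exact: mB].
  rewrite [LHS](gammaP mD).
  rewrite (bigD1 l)//= {1}/D eqxx cE muleC; congr (_ * _)%E.
  by apply: eq_bigr => i /negPf il; rewrite /D il.
transitivity (\int[nu]_(x in B l) (g x)%:E)%E.
  rewrite /nu ge0_integral_pushforward//=; last first.
  - by move=> y _; rewrite lee_fin.
  - exact/measurable_EFinP/measurable_funTS.
  - exact: mB.
  rewrite integral_mkcond [RHS]integral_mkcond ge0_integral_density; last 2 first.
  - have mBl : measurable (pr @^-1` B l).
      by rewrite -[X in measurable X]setTI; apply: ml => //; exact: mB.
    apply/(measurable_restrictT _ mBl)/measurable_funTS.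
    apply/measurable_EFinP; apply: (@measurableT_comp _ _ _ _ _ _ g) => //.
  - by move=> z; apply: erestrict_ge0 => y _; rewrite lee_fin.
  apply: eq_integral => z _; rewrite boxE patch_setI !patchE indicE.
  by do 2 case: ifP; rewrite ?(mul0e, mule1, mule0).
rewrite -cE.
transitivity (\int[mscale (NngNum c0) (normal_prob 0 s)]_(x in B l) (g x)%:E)%E.
  by apply: eq_measure_integral => A mA _; rewrite [LHS]nuE.
rewrite ge0_integral_mscale; first by rewrite muleC.
- exact: mB.
- exact/measurable_EFinP/measurable_funTS.
- by move=> x _; rewrite lee_fin.
Qed.

(** Both sides are integrals of [F] against measures, which agree on boxes by the one-dimensional
    shift formula. *)
Lemma ge0_integral_shift1 l t (F : array -> \bar R) :
  measurable_fun setT F -> (forall z, 0 <= F z)%E ->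
  (\int[gamma]_z F (shift1 l t z) = \int[gamma]_z (F z * (tilt1 l t z)%:E))%E.
Proof.
move=> mF F0.
rewrite -(ge0_integral_density _ (measurable_tilt1 l t) (tilt1_ge0 l t))//.
rewrite -(@ge0_integral_pushforward _ _ _ _ _ _ (measurable_shift1 l t) gamma setT)//.
apply: eq_measure_integral; first exact: measurable_shift1.
move=> msh A mA _.
apply: (@array_measure_unique R I (pushforward gamma (shift1 l t))
  (density_measure gamma (measurable_tilt1 l t) (tilt1_ge0 l t))) => //.
  by rewrite /= /pushforward preimage_setT probability_setT ltry.
move=> B mB; rewrite /= /density_measure /pushforward.
rewrite (@integral_box_coord l (fun x => expR ((t * x - t ^+ 2 / 2) / s ^+ 2)))//;
  last first.
- apply: measurableT_comp => //; apply: measurable_funM => //.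
  by apply: measurable_funB => //; apply: measurable_funM.
rewrite -normal_prob_shift//.
pose B' i := if i == l then [set x | B i (x + t)] else B i.
have -> : shift1 l t @^-1` [set z | forall i, B i (z i)] =
          [set z : array | forall i, B' i (z i)].
  apply/seteqP; split=> z /= H i; have := H i; rewrite /shift1 /B';
    by case: eqVneq => //=; rewrite addr0.
have mB' i : measurable (B' i).
  rewrite /B'; case: ifP => // _.
  have mf : measurable_fun setT (fun x : R => x + t) by apply: measurable_funD.
  by rewrite -[X in measurable X]setTI; exact: mf.
rewrite [LHS](gammaP mB').
rewrite (bigD1 l)//= {1}/B' eqxx; congr (_ * _)%E.
by apply: eq_bigr => i /negPf il; rewrite /B' il.
Qed.

(** The weight [s^-2] makes this the Cameron-Martin inner product of the noise; for increments over
    a mesh of step [s^2] it approximates the L2 inner product of the drifts. *)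
Definition dot (x y : I -> R) : R := (\sum_i x i * y i) / s ^+ 2.

Lemma dotC x y : dot x y = dot y x.
Proof. by rewrite /dot; congr (_ / _); apply: eq_bigr => i _; rewrite mulrC. Qed.

Lemma dotZl t x y : dot (fun i => t * x i) y = t * dot x y.
Proof.
by rewrite /dot mulrA; congr (_ / _); rewrite big_distrr/=; apply: eq_bigr => i _; ring.
Qed.

Lemma dotZr t x y : dot x (fun i => t * y i) = t * dot x y.
Proof. by rewrite dotC dotZl dotC. Qed.

Lemma dotDl x y z : dot (fun i => x i + y i) z = dot x z + dot y z.
Proof. by rewrite /dot -mulrDl -big_split/=; congr (_ / _); apply: eq_bigr => i _; ring. Qed.

Lemma dotDr x y z : dot z (fun i => x i + y i) = dot z x + dot z y.
Proof. by rewrite dotC dotDl !(dotC z). Qed.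

Lemma dot_ge0 x : 0 <= dot x x.
Proof.
rewrite /dot mulr_ge0 ?invr_ge0 ?sqr_ge0// sumr_ge0// => i _.
by rewrite -expr2 sqr_ge0.
Qed.

(** The Cameron-Martin density of the law translated by [v]. *)
Definition tilt (v : I -> R) (z : array) : R := expR (dot v z - dot v v / 2).

Lemma measurable_dot v : measurable_fun setT (fun z : array => dot v z).
Proof.
apply: measurable_funM => //; apply: measurable_sum => i.
by apply: measurable_funM => //; exact: measurable_coord.
Qed.

Lemma measurable_tilt v : measurable_fun setT (tilt v).
Proof.
by apply: measurableT_comp => //; apply: measurable_funB => //; exact: measurable_dot.
Qed.

(* The shift is performed one coordinate at a time. *)
Lemma ge0_integral_shift (v : I -> R) (F : array -> \bar R) :
  measurable_fun setT F -> (forall z, 0 <= F z)%E ->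
  (\int[gamma]_z F (fun i => z i + v i)%R = \int[gamma]_z (F z * (tilt v z)%:E))%E.
Proof.
pose sh (r : seq I) (z : array) : array := fun i => z i + (if i \in r then v i else 0).
pose tl (r : seq I) (z : array) :=
  expR ((\sum_(i <- r) (v i * z i - v i ^+ 2 / 2)) / s ^+ 2).
have main (r : seq I) G : uniq r -> measurable_fun setT G -> (forall z, 0 <= G z)%E ->
    (\int[gamma]_z G (sh r z) = \int[gamma]_z (G z * (tl r z)%:E))%E.
  elim: r G => [|l r IH] G /=.
    move=> _ mG G0; apply: eq_integral => z _.
    rewrite /sh /tl big_nil mul0r expR0 mule1; congr G.
    by apply/funext => i; rewrite in_nil addr0.
  move=> /andP[lr ur] mG G0.
  have shE z : sh (l :: r) z = sh r (shift1 l (v l) z).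
    apply/funext => i; rewrite /sh /shift1 in_cons.
    by have [->|] /= := eqVneq i l; rewrite ?(negPf lr) ?addr0.
  under eq_integral do rewrite shE.
  have msh : measurable_fun setT (sh r).
    apply: measurable_fun_array => i; apply: measurable_funD => //.
    exact: measurable_coord.
  have mGs : measurable_fun setT (fun z => G (sh r z)) by exact: measurableT_comp.
  apply: etrans (ge0_integral_shift1 l (v l) mGs (fun z => G0 (sh r z))) _.
  pose G' z := (G z * (tilt1 l (v l) z)%:E)%E.
  transitivity (\int[gamma]_z G' (sh r z))%E.
    apply: eq_integral => z _; rewrite /G' /tilt1.
    have -> : sh r z l = z l by rewrite /sh (negPf lr) addr0.
    by [].
  rewrite IH//; last 2 first.
  - by apply: emeasurable_funM => //; apply/measurable_EFinP; exact: measurable_tilt1.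
  - by move=> z; rewrite mule_ge0// lee_fin tilt1_ge0.
  apply: eq_integral => z _; rewrite /G' -muleA -EFinM; congr (_ * _%:E)%E.
  by rewrite /tilt1 /tl -expRD -mulrDl big_cons.
move=> mF F0; have := main (enum I) F (enum_uniq _) mF F0.
have -> : (fun z => F (sh (enum I) z)) = (fun z => F (fun i => z i + v i)%R).
  by apply/funext => z; congr F; apply/funext => i; rewrite /sh mem_enum.
move=> ->; apply: eq_integral => z _; congr (_ * _%:E)%E.
rewrite /tl /tilt /dot; congr expR.
rewrite big_enum/= big_split/= sumrN mulrDl; congr (_ + _).
by rewrite mulNr -mulr_suml; congr (- _); rewrite mulrAC; congr (_ * _ * _).
Qed.

End gaussian_array.

(** * Linear functionals of a Gaussian array *)

Section linear_functional_law.
Context (R : realType) (I : finType) (s : R) (gamma : probability (array R I) R).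
Hypotheses (s0 : s != 0) (gammaP : gaussian_array s gamma).
Local Notation array := (array R I).
Local Notation dot := (dot s).
Local Notation mu := (@lebesgue_measure R).
Variables (a : I -> R) (U : array -> R).
Hypotheses (a0 : 0 < dot a a) (mU : measurable_fun setT U) (U0 : forall z, 0 <= U z).
Hypothesis Ua : forall z t, U (fun i => z i + t * a i) = U z.

Let S (z : array) : R := dot a z / Num.sqrt (dot a a).
Let mS : measurable_fun setT S.
Proof. by apply: measurable_funM => //; exact: measurable_dot. Qed.

Let sa : Num.sqrt (dot a a) != 0. Proof. by rewrite gt_eqF// sqrtr_gt0. Qed.
Let sa2 : Num.sqrt (dot a a) ^+ 2 = dot a a. Proof. by rewrite sqr_sqrtr// ltW. Qed.

Let v (t : R) : I -> R := fun i => t / Num.sqrt (dot a a) * a i.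

Let S_shift t z : S (fun i => z i + v t i) = S z + t.
Proof.
rewrite /S.
rewrite dotDr (dotC _ _ (v t)) dotZl mulrDl; congr (_ + _).
by move: sa sa2; set q := Num.sqrt _ => q0 <-; field.
Qed.

Let tiltE t z : tilt s (v t) z = expR (t * S z - t ^+ 2 / 2).
Proof.
rewrite /tilt !dotZl (dotC _ a (v t)) dotZl /S; congr expR.
by move: sa sa2; set q := Num.sqrt _ => q0 q2; rewrite -[in X in _ - X]q2; field.
Qed.

(** [U] does not vary along [a], so [S] is standard normal and independent of it. Instead of
    rotating the array, an auxiliary normal variable [x] of density [p] is integrated in, [z] is
    shifted by [x] units along [a], and [x] is translated by [S z]: this exchanges the roles of [S]
    and [x]. *)
Lemma ge0_integral_linear_functional (B : set R) : measurable B ->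
  (\int[gamma]_z (U z * \1_B (S z))%:E =
   \int[gamma]_z (U z)%:E * normal_prob 0 1 B)%E.
Proof.
move=> mB.
pose p := normal_pdf 0 (1 : R).
have p0 x : 0 <= p x by exact: normal_pdf_ge0.
have mp : measurable_fun setT p by exact: measurable_normal_pdf.
have m1 : measurable_fun setT (\1_B : R -> R) by exact: measurable_indic.
have mfst : measurable_fun setT (fst : array * R -> array) by exact: measurable_fst.
have msnd : measurable_fun setT (snd : array * R -> R) by exact: measurable_snd.
have mU1 := measurableT_comp mU mfst.
have mS1 := measurableT_comp mS mfst.
have mp2 := measurableT_comp mp msnd.
(* [K1], [K2], [K3] are the integrand before the shift of [z], after it, and after the translation
   of [x]. *)
pose K1 (y : array * R) := U y.1 * \1_B (S y.1) * p y.2.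
have mK1 : measurable_fun setT K1.
  apply: measurable_funM; first apply: measurable_funM.
  - exact: mU1.
  - exact: (measurableT_comp m1 mS1).
  - exact: mp2.
pose K2 (y : array * R) :=
  U y.1 * \1_B (S y.1 + y.2) * (p y.2 * expR (- y.2 * S y.1 - y.2 ^+ 2 / 2)).
have mK2 : measurable_fun setT K2.
  apply: measurable_funM; first apply: measurable_funM.
  - exact: mU1.
  - apply: (measurableT_comp m1); exact: (measurable_funD mS1 msnd).
  apply: measurable_funM; first exact: mp2.
  apply: measurableT_comp => //; apply: measurable_funB.
    by apply: measurable_funM; [exact: measurableT_comp|exact: mS1].
  by apply: measurable_funM => //; apply: measurable_funX; exact: msnd.
pose K3 (y : array * R) :=
  U y.1 * \1_B y.2 * (p y.2 * expR (y.2 * S y.1 - y.2 ^+ 2 / 2)).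
have mK3 : measurable_fun setT K3.
  apply: measurable_funM; first apply: measurable_funM.
  - exact: mU1.
  - exact: (measurableT_comp m1 msnd).
  apply: measurable_funM; first exact: mp2.
  apply: measurableT_comp => //; apply: measurable_funB.
    by apply: measurable_funM; [exact: msnd|exact: mS1].
  by apply: measurable_funM => //; apply: measurable_funX; exact: msnd.
have K10 y : (0 <= (K1 y)%:E)%E by rewrite lee_fin !mulr_ge0.
have K20 y : (0 <= (K2 y)%:E)%E by rewrite lee_fin !mulr_ge0// expR_ge0.
have K30 y : (0 <= (K3 y)%:E)%E by rewrite lee_fin !mulr_ge0// expR_ge0.
have step1 : (\int[gamma]_z (U z * \1_B (S z))%:E =
    \int[gamma]_z \int[mu]_x (K1 (z, x))%:E)%E.
  apply: eq_integral => z _; rewrite /K1/=.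
  under eq_integral do rewrite EFinM.
  rewrite ge0_integralZl//=; last 3 first.
  - exact/measurable_EFinP.
  - by move=> x _; rewrite lee_fin.
  - by rewrite lee_fin mulr_ge0.
  by rewrite integral_normal_pdf mule1.
have step2 (x : R) : (\int[gamma]_z (K1 (z, x))%:E = \int[gamma]_z (K2 (z, x))%:E)%E.
  pose F (z : array) :=
    (U z * \1_B (S z) * (p x * expR (- x * S z + x ^+ 2 / 2)))%:E.
  have mF : measurable_fun setT F.
    apply/measurable_EFinP; apply: measurable_funM; first apply: measurable_funM => //.
      exact: (measurableT_comp m1 mS).
    apply: measurable_funM => //; apply: measurableT_comp => //.
    by apply: measurable_funD => //; apply: measurable_funM.
  have F0 z : (0 <= F z)%E by rewrite lee_fin !mulr_ge0// expR_ge0.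
  have := ge0_integral_shift s0 gammaP (v x) mF F0.
  move=> e; apply: etrans (etrans (esym e) _).
    apply: eq_integral => z _; rewrite tiltE /F /K1 -EFinM/=; congr (_%:E).
    have e1 : expR (- x * S z + x ^+ 2 / 2) * expR (x * S z - x ^+ 2 / 2) = 1.
      by rewrite -expRD -[RHS]expR0; congr expR; ring.
    transitivity (U z * \1_B (S z) * p x *
        (expR (- x * S z + x ^+ 2 / 2) * expR (x * S z - x ^+ 2 / 2))).
      by rewrite e1 mulr1.
    ring.
  apply: eq_integral => z _; rewrite /F /K2/= S_shift.
  have -> : U (fun i => z i + v x i) = U z by exact: Ua.
  by congr ((_ * (_ * expR _))%:E); field.
have step3 (z : array) : (\int[mu]_x (K2 (z, x))%:E = \int[mu]_x (K3 (z, x))%:E)%E.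
  pose F (x : R) := (K2 (z, x - S z))%:E.
  have mF : measurable_fun setT F.
    apply/measurable_EFinP; apply: (measurableT_comp mK2).
    apply/measurable_fun_pairP; split => /=; first exact: measurable_cst.
    exact: measurable_funB.
  have := ge0_integral_translation (S z) mF (fun x => K20 _).
  move=> e; apply: etrans (etrans e _).
    by apply: eq_integral => x _; rewrite /F addrK.
  apply: eq_integral => x _; rewrite /F /K2 /K3/= addrC subrK.
  congr ((_ * _)%:E); rewrite /p normal_pdf_shift ?oner_eq0// -mulrA -expRD.
  by congr (_ * expR _); field.
have step4 (x : R) : (\int[gamma]_z (K3 (z, x))%:E =
    (\1_B x * p x)%:E * \int[gamma]_z (U z)%:E)%E.
  have mU' : measurable_fun setT (fun z => (U z)%:E) by exact/measurable_EFinP.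
  have U0' z : (0 <= (U z)%:E)%E by rewrite lee_fin.
  have e := ge0_integral_shift s0 gammaP (v x) mU' U0'.
  rewrite [in RHS](_ : \int[gamma]_z (U z)%:E =
    \int[gamma]_z ((U z)%:E * (tilt s (v x) z)%:E))%E; last first.
    by rewrite -e; apply: eq_integral => z _; congr (_%:E); rewrite -[in LHS](Ua _ (x / Num.sqrt (dot a a))).
  rewrite -[RHS]ge0_integralZl; last 4 first.
  - exact: measurableT.
  - apply: emeasurable_funM => //; apply/measurable_EFinP; exact: measurable_tilt.
  - by move=> z _; rewrite mule_ge0// lee_fin expR_ge0.
  - by rewrite lee_fin mulr_ge0.
  apply: eq_integral => z _; rewrite /K3/= tiltE -!EFinM; congr (_%:E); ring.
rewrite step1 (@fubini_tonelli _ _ _ _ _ gamma mu (EFin \o K1))//; last first.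
  exact/measurable_EFinP.
under eq_integral do rewrite /= step2.
rewrite -(@fubini_tonelli _ _ _ _ _ gamma mu (EFin \o K2))//; last first.
  exact/measurable_EFinP.
under eq_integral do rewrite /= step3.
rewrite (@fubini_tonelli _ _ _ _ _ gamma mu (EFin \o K3))//; last first.
  exact/measurable_EFinP.
under eq_integral do rewrite /= step4.
rewrite ge0_integralZr//=; last 3 first.
- by apply/measurable_EFinP; exact: measurable_funM.
- by move=> x _; rewrite lee_fin mulr_ge0.
- by apply: integral_ge0 => z _; rewrite lee_fin.
rewrite muleC; congr (_ * _)%E; rewrite /normal_prob [RHS]integral_mkcond.
apply: eq_integral => x _; rewrite patchE indicE.
by case: ifP => _; rewrite ?mul1r ?mul0r.
Qed.

End linear_functional_law.

(** * Gaussian tails *)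

Section normal_tail.
Context (R : realType).
Local Notation mu := (@lebesgue_measure R).

Lemma normal_pdf1_le1 (x : R) : normal_pdf 0 1 x <= 1.
Proof.
apply: le_trans (normal_pdf_ub 0 x (oner_neq0 _)) _.
rewrite /normal_peak invf_le1; last first.
  by rewrite sqrtr_gt0 expr1n mul1r pmulrn_lgt0// pi_gt0.
rewrite -[leLHS]sqrtr1 ler_sqrt ?expr1n ?mul1r; last first.
  by rewrite pmulrn_lge0// pi_ge0.
by have := pi_ge2 R; rewrite mulr2n; lra.
Qed.

(** The upper tail at [c], written as the mass below [- c]: the error of a linear rule with a margin
    of [c] standard deviations. *)
Definition normal_tail (c : R) : R := fine (normal_prob 0 1 `]-oo, - c]).

Lemma normal_tailE c : (normal_prob 0 1 `]-oo, (- c)%R] = (normal_tail c)%:E)%E.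
Proof. by rewrite fineK//; exact: (@fin_num_measure _ _ _ (normal_prob 0 1)). Qed.

Lemma normal_tail_open c : (normal_prob 0 1 `]-oo, (- c)%R[ = (normal_tail c)%:E)%E.
Proof.
rewrite -normal_tailE /normal_prob.
rewrite -(@integral_itv_bndo_bndc _ -oo%O)//.
by apply: measurable_funTS; apply/measurable_EFinP; exact: measurable_normal_pdf.
Qed.

Lemma normal_tail_ge0 c : 0 <= normal_tail c.
Proof. by rewrite fine_ge0//; exact: (@measure_ge0 _ _ _ (normal_prob 0 1)). Qed.

Lemma normal_tail_le1 c : normal_tail c <= 1.
Proof. by rewrite -lee_fin -normal_tailE; exact: (@probability_le1 _ _ _ (normal_prob 0 1)). Qed.

Lemma normal_tailB c c' : c <= c' ->
  ((normal_tail c - normal_tail c')%:E =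
   \int[mu]_(x in `](- c')%R, (- c)%R]) (normal_pdf 0 1 x)%:E)%E.
Proof.
move=> cc'.
have e : `]-oo, - c]%classic = `]-oo, - c']%classic `|` `]- c', - c]%classic :> set R.
  by rewrite -itv_bndbnd_setU// bnd_simp lerN2.
rewrite EFinB -!normal_tailE {1}e measureU//=; last first.
  apply/seteqP; split=> x //=; rewrite !in_itv/= => -[xc /andP[cx _]].
  by move: (le_lt_trans xc cx); rewrite ltxx.
by rewrite addrAC subee ?add0e// normal_tailE.
Qed.

Lemma normal_tail_nincr c c' : c <= c' -> normal_tail c' <= normal_tail c.
Proof.
move=> cc'; rewrite -subr_ge0 -lee_fin normal_tailB//.
by apply: integral_ge0 => x _; rewrite lee_fin normal_pdf_ge0.
Qed.

(** The density is at most 1. This turns discretisation errors on norms into errors on tails. *)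
Lemma normal_tail_lip c c' : c <= c' -> normal_tail c - normal_tail c' <= c' - c.
Proof.
move=> cc'; rewrite -lee_fin normal_tailB//.
have -> : ((c' - c)%:E = \int[mu]_(x in `](- c')%R, (- c)%R]) 1%:E)%E.
  rewrite integral_cst//= mul1e lebesgue_measure_itv/= lte_fin ltrN2.
  case: ltP => [_|h]; first by rewrite -EFinB opprK addrC.
  have -> : c = c' by apply/eqP; rewrite eq_le cc' h.
  by rewrite subrr.
apply: ge0_le_integral => //.
- by move=> x _; rewrite lee_fin normal_pdf_ge0.
- apply/measurable_EFinP/measurable_funTS; exact: measurable_normal_pdf.
- by move=> x _; rewrite lee_fin normal_pdf1_le1.
Qed.

(** For [c >= 0] the density on the interval is smallest at the end [- c']. The excess risk comes
    from this inequality. *)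
Lemma normal_tail_gap c c' : 0 <= c -> c <= c' ->
  normal_pdf 0 1 c' * (c' - c) <= normal_tail c - normal_tail c'.
Proof.
move=> c0 cc'; rewrite -lee_fin normal_tailB//.
have -> : ((normal_pdf 0 1 c' * (c' - c))%:E =
    \int[mu]_(x in `](- c')%R, (- c)%R]) (normal_pdf 0 1 c')%:E)%E.
  rewrite integral_cst//= lebesgue_measure_itv/= lte_fin ltrN2.
  case: ltP => [_|h]; first by rewrite -EFinB -EFinM opprK [- c + _]addrC.
  have -> : c = c' by apply/eqP; rewrite eq_le cc' h.
  by rewrite subrr mulr0 mule0.
apply: ge0_le_integral => //.
- by move=> x _; rewrite lee_fin normal_pdf_ge0.
- apply/measurable_EFinP/measurable_funTS; exact: measurable_normal_pdf.
- move=> x /=; rewrite in_itv/= => /andP[x1 x2]; rewrite lee_fin.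
  rewrite !normal_pdfE ?oner_neq0// ler_wpM2l ?normal_peak_ge0// /normal_fun ler_expR.
  by rewrite !subr0 !mulNr lerN2 ler_pM2r ?invr_gt0 ?expr1n//; nra.
Qed.

End normal_tail.

(** * Rows of the sample and row of the new observation *)

Section sample_and_new.
Context (R : realType) (n K : nat) (s : R).
Implicit Types (v w : 'I_K -> R) (e : 'I_n.+1 -> R).
Local Notation I := ('I_n.+1 * 'I_K)%type.

(** Row [ord_max] is the new observation, the other rows are the sample. With [g = - f] every row
    has the same mean up to a sign, and [e] holds the signs of the sample labels. *)
Definition new_part v : I -> R := fun p => if p.1 == ord_max then v p.2 else 0.
Definition sample_part e v : I -> R :=
  fun p => if p.1 == ord_max then 0 else e p.1 * v p.2.

Lemma dot_newl v (z : I -> R) : dot s (new_part v) z = dot s v (fun k => z (ord_max, k)).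
Proof.
rewrite /dot; congr (_ / _).
transitivity (\sum_(p : I) new_part v (p.1, p.2) * z (p.1, p.2)).
  by apply: eq_bigr => -[].
rewrite -(pair_bigA _ (fun i k => new_part v (i, k) * z (i, k)))/=.
rewrite (bigD1 ord_max)//= [X in _ + X]big1 ?addr0.
  by apply: eq_bigr => k _; rewrite /new_part/= eqxx.
by move=> i /negPf il; apply: big1 => k _; rewrite /new_part/= il mul0r.
Qed.

Lemma dot_new v w : dot s (new_part v) (new_part w) = dot s v w.
Proof. by rewrite dot_newl; congr dot; apply/funext => k; rewrite /new_part/= eqxx. Qed.

(** This orthogonality is how independence of the sample and the new observation enters: tilts
    multiply by [tilt_orthoD], and sample likelihoods ignore shifts of the new row by
    [tilt_ortho_shift]. *)
Lemma dot_sample_new e v w : dot s (sample_part e v) (new_part w) = 0.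
Proof.
rewrite /dot big1 ?mul0r// => p _; rewrite /sample_part /new_part.
by case: eqP; rewrite ?mul0r ?mulr0.
Qed.

Lemma dot_sample e v w : (forall i, e i ^+ 2 = 1) ->
  dot s (sample_part e v) (sample_part e w) = n%:R * dot s v w.
Proof.
move=> e2; rewrite /dot mulrA; congr (_ / _).
rewrite -(pair_bigA _ (fun i k => sample_part e v (i, k) * sample_part e w (i, k)))/=.
rewrite (bigD1 ord_max)//= big1 ?add0r; last first.
  by move=> k _; rewrite /sample_part/= eqxx mul0r.
rewrite (eq_bigr (fun=> \sum_k v k * w k)); last first.
  move=> i /negPf il; apply: eq_bigr => k _; rewrite /sample_part/= il.
  by rewrite mulrACA -expr2 e2 mul1r.
by rewrite sumr_const cardC1 card_ord/= mulr_natl.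
Qed.

Lemma new_partD v w : new_part (fun k => v k + w k) =
  fun p => new_part v p + new_part w p.
Proof. by apply/funext => p; rewrite /new_part; case: ifP; rewrite ?addr0. Qed.

Lemma new_partZ t v : new_part (fun k => t * v k) = fun p => t * new_part v p.
Proof. by apply/funext => p; rewrite /new_part; case: ifP; rewrite ?mulr0. Qed.

End sample_and_new.

Section tilt_lemmas.
Context (R : realType) (I : finType) (s : R).

Lemma tilt_ge0 (v : I -> R) z : 0 <= tilt s v z. Proof. exact: expR_ge0. Qed.

Lemma tilt_gt0 (v : I -> R) z : 0 < tilt s v z. Proof. exact: expR_gt0. Qed.

Lemma tilt_orthoD (v w : I -> R) z : dot s v w = 0 ->
  tilt s (fun i => v i + w i) z = tilt s v z * tilt s w z.
Proof.
move=> vw; rewrite /tilt -expRD; congr expR.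
by rewrite !dotDl !dotDr (dotC _ w v) vw; field.
Qed.

Lemma tilt_ortho_shift (v w : I -> R) z : dot s v w = 0 ->
  tilt s v (fun i => z i + w i) = tilt s v z.
Proof. by move=> vw; rewrite /tilt dotDr vw addr0. Qed.

(** Under [gamma] the second factor on the right has mass 1, so the second moment of a likelihood
    ratio is [expR] of the squared distance, that is one plus the chi-square divergence. *)
Lemma tilt_sq_div (v w : I -> R) z :
  tilt s v z ^+ 2 / tilt s w z =
  expR (dot s (fun i => v i - w i) (fun i => v i - w i)) *
  tilt s (fun i => 2 * v i + (-1) * w i) z.
Proof.
have -> : (fun i => v i - w i) = (fun i => v i + (-1) * w i).
  by apply/funext => i; rewrite mulN1r.
rewrite /tilt -expRM_natl -expRN -!expRD; congr expR.
by rewrite !dotDl !dotDr !dotZl !dotZr (dotC _ w v); field.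
Qed.

Variable (gamma : probability (array R I) R).
Hypotheses (s0 : s != 0) (gammaP : gaussian_array s gamma).

Lemma integral_tilt (v : I -> R) : (\int[gamma]_z (tilt s v z)%:E = 1)%E.
Proof.
have := @ge0_integral_shift R I s gamma s0 gammaP v (cst 1%E) (measurable_cst _) (fun=> lee01).
rewrite /= integral_cst//= probability_setT mule1 => h.
by rewrite [RHS]h; apply: eq_integral => z _; rewrite mul1e.
Qed.

Lemma measurable_shift (v : I -> R) :
  measurable_fun setT (fun z : array R I => (fun i => z i + v i) : array R I).
Proof.
apply: measurable_fun_array => i; apply: measurable_funD => //.
exact: measurable_coord.
Qed.

Lemma measure_shift (v : I -> R) (A : set (array R I)) : measurable A ->
  (gamma [set z | A (fun i => z i + v i)%R] =
   \int[gamma]_z (\1_A z * tilt s v z)%:E)%E.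
Proof.
move=> mA.
have m1 : measurable_fun setT (fun z : array R I => (\1_A z : R)%:E).
  by apply/measurable_EFinP; exact: measurable_indic.
have h0 (z : array R I) : (0 <= (\1_A z : R)%:E)%E by rewrite lee_fin.
have e := ge0_integral_shift s0 gammaP v m1 h0.
have mB : measurable [set z : array R I | A (fun i => z i + v i)].
  by have := measurable_shift v measurableT mA; rewrite setTI.
transitivity (\int[gamma]_z (\1_[set z : array R I | A (fun i => z i + v i)] z : R)%:E)%E.
  by rewrite integral_indic// setIT.
apply: etrans e _.
by apply: eq_integral => z _; rewrite EFinM.
Qed.

End tilt_lemmas.

Section halfspace.
Context (R : realType) (n K : nat) (s : R).
Local Notation array := (array R ('I_n.+1 * 'I_K)%type).
Variable gamma : probability array R.
Hypotheses (s0 : s != 0) (gammaP : gaussian_array s gamma).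
Variable U : array -> R.
Hypotheses (mU : measurable_fun setT U) (U0 : forall z, 0 <= U z).
Hypothesis Uinv : forall z v, U (fun p => z p + new_part v p) = U z.

(** The tilt moves the mean of the normalised functional along [a] to [dot s a b / |a|], while [U]
    sees only the sample. Both kinds of endpoint are covered because a rule and its complement give
    one closed and one open half space. *)
Lemma integral_halfspace (a b : 'I_K -> R) (strict : bool) : 0 < dot s a a ->
  (\int[gamma]_z (U z *
      \1_[set` Interval -oo%O (BSide strict (0 : R))] (dot s (new_part a) z) *
      tilt s (new_part b) z)%:E =
   \int[gamma]_z (U z)%:E * (normal_tail (dot s a b / Num.sqrt (dot s a a)))%:E)%E.
Proof.
move=> a0; set B := [set` _].
set q := Num.sqrt (dot s a a).
have q0 : 0 < q by rewrite sqrtr_gt0.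
pose F (z : array) := (U z * \1_B (dot s (new_part a) z))%:E.
have mF : measurable_fun setT F.
  apply/measurable_EFinP; apply: measurable_funM => //.
  apply: measurableT_comp; last exact: measurable_dot.
  by apply: measurable_indic; exact: measurable_itv.
have F0 z : (0 <= F z)%E by rewrite lee_fin mulr_ge0.
have e := ge0_integral_shift s0 gammaP (new_part b) mF F0.
transitivity (\int[gamma]_z (F z * (tilt s (new_part b) z)%:E))%E.
  by apply: eq_integral => z _; rewrite /F -EFinM.
rewrite -e.
pose C : set R := [set` Interval -oo%O (BSide strict (- (dot s a b / q)))].
have na0 : 0 < dot s (@new_part R n K a) (new_part a) by rewrite dot_new.
have Ua z t : U (fun p => z p + t * new_part a p) = U z.
  by rewrite -[RHS](Uinv z (fun k => t * a k)) new_partZ.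
have := @ge0_integral_linear_functional R _ s gamma s0 gammaP _ U na0 mU U0 Ua C.
have -> : normal_prob 0 1 C = (normal_tail (dot s a b / q))%:E.
  by rewrite /C; case: (strict) => //; rewrite ?normal_tail_open// normal_tailE.
move=> <-; last exact: measurable_itv.
apply: eq_integral => z _; rewrite /F Uinv dotDr !dot_new; congr ((_ * _)%:E).
rewrite !indicE; congr ((_ : bool)%:R).
apply/idP/idP; rewrite !inE /B /C /= !in_itv/=; case: (strict) => /=.
- by rewrite ltrNr -mulNr ltr_pM2r ?invr_gt0//; lra.
- by rewrite lerNr -mulNr ler_pM2r ?invr_gt0//; lra.
- by rewrite ltrNr -mulNr ltr_pM2r ?invr_gt0//; lra.
- by rewrite lerNr -mulNr ler_pM2r ?invr_gt0//; lra.
Qed.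

End halfspace.

(** * Posterior pairs *)

Lemma ge0_integral_sumR d (T : measurableType d) (R : realType)
    (mu : {measure set T -> \bar R}) (J : finType) (D : pred J) (f : J -> T -> R) :
  (forall j, measurable_fun setT (f j)) -> (forall j x, 0 <= f j x) ->
  (\int[mu]_x (\sum_(j | D j) f j x)%:E = \sum_(j | D j) \int[mu]_x (f j x)%:E)%E.
Proof.
move=> mf f0; rewrite -big_filter -ge0_integral_sum//.
- by apply: eq_integral => x _; rewrite -big_filter sumEFin.
- by move=> j; exact/measurable_EFinP.
- by move=> j x _; rewrite lee_fin.
Qed.

Lemma measurable_sumP d (T : measurableType d) (R : realType) (J : finType)
    (D : pred J) (f : J -> T -> R) :
  (forall j, measurable_fun setT (f j)) ->
  measurable_fun setT (fun x => \sum_(j | D j) f j x).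
Proof.
move=> mf; under eq_fun do rewrite -big_filter.
exact: measurable_sum.
Qed.

Section posterior.
Context (R : realType) (n K : nat) (s : R).
Local Notation array := (array R ('I_n.+1 * 'I_K)%type).
Variable gamma : probability array R.
Hypotheses (s0 : s != 0) (gammaP : gaussian_array s gamma).
Variables (Sg : finType) (th : Sg -> 'I_K -> R) (e : 'I_n.+1 -> R).
Hypothesis e2 : forall i, e i ^+ 2 = 1.

Definition lik (t : Sg) (z : array) : R := tilt s (sample_part e (th t)) z.
Definition evidence (z : array) : R := \sum_t lik t z.
(** With [t] uniform, this is, up to the factor [1 / #|Sg|], the joint density of the parameter, the
    sample and a second draw [t'] from the posterior. It is symmetric in [t] and [t'] and sums to
    [lik t] over [t']. *)
Definition joint_post (t t' : Sg) (z : array) : R := lik t z * lik t' z / evidence z.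

Local Notation q := lik.
Local Notation Q := evidence.
Local Notation U := joint_post.

Let mq t : measurable_fun setT (q t). Proof. exact: measurable_tilt. Qed.
Let q_ge0 t z : 0 <= q t z. Proof. exact: tilt_ge0. Qed.
Let q_gt0 t z : 0 < q t z. Proof. exact: tilt_gt0. Qed.
Let Q_ge0 z : 0 <= Q z. Proof. exact: sumr_ge0. Qed.
Let le_q_Q t z : q t z <= Q z.
Proof. by rewrite /Q (bigD1 t)//= lerDl sumr_ge0. Qed.
Let Q_gt0 (t : Sg) z : 0 < Q z. Proof. exact: lt_le_trans (q_gt0 t z) (le_q_Q t z). Qed.

Let U_ge0 t t' z : 0 <= U t t' z.
Proof. by rewrite /U mulr_ge0 ?mulr_ge0 ?invr_ge0. Qed.

Let mU t t' : measurable_fun setT (U t t').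
Proof.
have -> : U t t' = fun z => q t z * q t' z * Q z `^ (-1).
  by apply/funext => z; rewrite powR_inv1.
apply: measurable_funM; first exact: measurable_funM.
by apply: (measurableT_comp (measurable_powR _)); exact: measurable_sumP.
Qed.

Let UC t t' z : U t t' z = U t' t z. Proof. by rewrite /U (mulrC (q t z)). Qed.

Let sum_U t z : \sum_t' U t t' z = q t z.
Proof.
rewrite /U -mulr_suml -mulr_sumr -/(Q z) mulfK// gt_eqF//; exact: Q_gt0 t z.
Qed.

Let q_new t z (v : 'I_K -> R) : q t (fun p => z p + new_part v p) = q t z.
Proof. by apply: tilt_ortho_shift; exact: dot_sample_new. Qed.

Let U_new t t' z (v : 'I_K -> R) : U t t' (fun p => z p + new_part v p) = U t t' z.
Proof. by rewrite /U !q_new; congr (_ / _); apply: eq_bigr => i _; rewrite q_new. Qed.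

Let int_q t : (\int[gamma]_z (q t z)%:E = 1)%E.
Proof. exact: integral_tilt. Qed.

Definition pair_weight t t' : R := fine (\int[gamma]_z (U t t' z)%:E).
Local Notation pi := pair_weight.

Lemma pair_weightE t t' : (\int[gamma]_z (U t t' z)%:E = (pi t t')%:E)%E.
Proof.
rewrite fineK// ge0_fin_numE; last by apply: integral_ge0 => z _; rewrite lee_fin.
apply: (@le_lt_trans _ _ 1%E); last exact: ltry.
rewrite -(int_q t); apply: ge0_le_integral => //.
- by move=> z _; rewrite lee_fin.
- exact/measurable_EFinP.
- exact/measurable_EFinP.
- move=> z _; rewrite lee_fin -(sum_U t z) (bigD1 t')//= lerDl.
  by apply: sumr_ge0.
Qed.

Lemma pair_weight_ge0 t t' : 0 <= pi t t'.
Proof. by rewrite -lee_fin -pair_weightE; apply: integral_ge0 => z _; rewrite lee_fin. Qed.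

Lemma sum_pair_weight t : \sum_t' pi t t' = 1.
Proof.
apply: EFin_inj; rewrite -sumEFin -(int_q t).
under eq_bigr do rewrite -pair_weightE.
by rewrite -ge0_integral_sumR//; apply: eq_integral => z _; rewrite sum_U.
Qed.

(** * Risk of an arbitrary rule compared with rules knowing a pair *)

Section risk_bound.
Variables (r2 : R) (A : set array).
Hypotheses (mA : measurable A) (r2P : forall t, dot s (th t) (th t) <= r2).
Hypothesis pos : forall t t',
  0 < dot s (fun k => th t k + th t' k) (fun k => th t k + th t' k).

Let a t t' : 'I_K -> R := fun k => th t k + th t' k.
Let B (b : bool) : set R := [set` Interval -oo%O (BSide b (0 : R))].
Let x t z := dot s (new_part (th t)) (z : array).
Let sgn (b : R) t : 'I_K -> R := fun k => b * th t k.

(** Signed distance from [th t] to the hyperplane orthogonal to [th t + th t']. *)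
Definition linear_margin t t' : R :=
  dot s (fun k => th t k + th t' k) (th t) /
  Num.sqrt (dot s (fun k => th t k + th t' k) (fun k => th t k + th t' k)).

(** Error density, over both labels, of the linear rule for the pair when the parameter is [t]; ties
    count as errors for the positive label only. *)
Let H t t' z := U t t' z * \1_(B false) (dot s (new_part (a t t')) z) *
    tilt s (new_part (th t)) z
  + U t t' z * \1_(B true) (dot s (new_part (fun k => -1 * a t t' k)) z) *
    tilt s (new_part (sgn (-1) t)) z.

Let H1_ge0 t t' z (b : bool) v w :
  0 <= U t t' z * \1_(B b) (dot s v z) * tilt s w z.
Proof. by apply: mulr_ge0; [exact: mulr_ge0|exact: tilt_ge0]. Qed.

Let mH1 t t' (b : bool) v w :
  measurable_fun setT (fun z => U t t' z * \1_(B b) (dot s v z) * tilt s w z).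
Proof.
apply: measurable_funM; last exact: measurable_tilt.
apply: measurable_funM => //; apply: measurableT_comp; last exact: measurable_dot.
by apply: measurable_indic; exact: measurable_itv.
Qed.

Let int_H t t' : (\int[gamma]_z (H t t' z)%:E =
  (2 * (pi t t' * normal_tail (linear_margin t t')))%:E)%E.
Proof.
under eq_integral do rewrite EFinD.
rewrite ge0_integralD//; last 4 first.
- by move=> z _; rewrite lee_fin H1_ge0.
- by apply/measurable_EFinP; exact: mH1.
- by move=> z _; rewrite lee_fin H1_ge0.
- by apply/measurable_EFinP; exact: mH1.
have U_new' z v := U_new t t' z v.
have pa : 0 < dot s (a t t') (a t t') by exact: pos.
have pa' : 0 < dot s (fun k => -1 * a t t' k) (fun k => -1 * a t t' k).
  by rewrite dotZl dotZr mulrA mulN1r opprK mul1r.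
rewrite !(integral_halfspace s0 gammaP (mU t t') (U_ge0 t t') U_new')//.
rewrite pair_weightE /sgn !dotZl !dotZr !mulN1r !opprK -EFinM -EFinD mulr2n mulrDl !mul1r.
by rewrite /linear_margin.
Qed.

(** Error density at [z] of the rule answering [true] on [A]: there the mass of the negative label
    is lost, elsewhere that of the positive one. *)
Let m t z := if z \in A then tilt s (new_part (sgn (-1) t)) z
             else tilt s (new_part (sgn 1 t)) z.

Let tilt_sgn b t z : b ^+ 2 = 1 ->
  tilt s (new_part (sgn b t)) z = expR (b * x t z - dot s (th t) (th t) / 2).
Proof.
move=> b2; rewrite /tilt new_partZ !dotZl dotZr dot_new /x; congr expR.
by rewrite mulrA -expr2 b2 mul1r.
Qed.

(** Replaces [|th t|^2] by the common bound [r2] in the normal densities, which makes the linear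
    rule exactly optimal; the factor is at most 1, so the inequality goes the right way. *)
Let k t := expR ((dot s (th t) (th t) - r2) / 2).

(** [G t t' + G t' t] is the smaller of [expR x + expR x'] and [expR (- x) + expR (- x')], so it
    bounds the loss from below whatever [A] answers at [z]. *)
Let pointwise z : \sum_t \sum_t' k t * H t t' z <= \sum_t q t z * m t z.
Proof.
pose G t t' := if x t z + x t' z <= 0 then expR (x t z) else expR (- x t z).
have HE t t' : k t * H t t' z = U t t' z * (expR (- r2 / 2) * G t t').
  have da : dot s (new_part (a t t')) z = x t z + x t' z.
    by rewrite new_partD dotDl.
  have da' : dot s (new_part (fun k => -1 * a t t' k)) z = - (x t z + x t' z).
    by rewrite new_partZ dotZl da mulN1r.
  have t1 : tilt s (new_part (th t)) z = expR (x t z - dot s (th t) (th t) / 2).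
    by rewrite /tilt dot_new.
  rewrite /H da da' tilt_sgn ?sqrrN ?expr1n// t1 !indicE /G /k.
  rewrite (_ : (_ \in B false) = (x t z + x t' z <= 0)); last first.
    by apply/idP/idP; rewrite inE /B /= in_itv.
  rewrite (_ : (_ \in B true) = ~~ (x t z + x t' z <= 0)); last first.
    by rewrite -ltNge; apply/idP/idP; rewrite inE /B /= in_itv /= oppr_lt0.
  case: ifP => _ /=; rewrite ?(mulr0, mul0r, mulr1, addr0, add0r) mulrCA;
    congr (_ * _); rewrite -!expRD; congr expR; by field.
have mG t t' : expR (- r2 / 2) * (G t t' + G t' t) <= m t z + m t' z.
  have mb t1 (b : R) : b ^+ 2 = 1 ->
      expR (- r2 / 2) * expR (b * x t1 z) <= tilt s (new_part (sgn b t1)) z.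
    move=> b2; rewrite tilt_sgn// -expRD ler_expR.
    by have := r2P t1; lra.
  have gb (b : R) : b ^+ 2 = 1 ->
      G t t' + G t' t <= expR (b * x t z) + expR (b * x t' z).
    move=> /eqP; rewrite sqrf_eq1 /G (addrC (x t' z)) => /orP[] /eqP ->;
      rewrite ?mul1r ?mulN1r; case: ifPn => //.
      rewrite -ltNge => h; rewrite addrC lerD// ler_expR; lra.
    by move=> h; rewrite addrC lerD// ler_expR; lra.
  have e0 : 0 <= expR (- r2 / 2) by exact: expR_ge0.
  have gmb (b : R) : b ^+ 2 = 1 -> expR (- r2 / 2) * (G t t' + G t' t) <=
      tilt s (new_part (sgn b t)) z + tilt s (new_part (sgn b t')) z.
    move=> b2; apply: le_trans (ler_wpM2l e0 (gb b b2)) _.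
    by rewrite mulrDr; apply: lerD; exact: mb.
  by rewrite /m; case: ifP => _; apply: gmb; rewrite ?sqrrN expr1n.
have -> : \sum_t q t z * m t z = \sum_t \sum_t' U t t' z * m t z.
  by apply: eq_bigr => t _; rewrite -mulr_suml sum_U.
under eq_bigr do under eq_bigr do rewrite HE.
(* [U] being symmetric, both sides may be averaged over the two orders of the pair; this is what
   hides which element is the true parameter. *)
have sym (f : Sg -> Sg -> R) : \sum_t \sum_t' U t t' z * f t t' =
    \sum_t \sum_t' U t t' z * f t' t.
  by rewrite exchange_big/=; apply: eq_bigr => t _; apply: eq_bigr => t' _; rewrite UC.
rewrite -(ler_pM2l (ltr0n R 2)) !mulr2n !mulrDl !mul1r.
rewrite {2}(sym (fun t t' => expR (- r2 / 2) * G t t')) {2}(sym (fun t t' => m t z)).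
rewrite -!big_split/=; apply: ler_sum => t _; rewrite -!big_split/=.
by apply: ler_sum => t' _; rewrite -!mulrDr ler_wpM2l.
Qed.

Definition drift (b : R) t : ('I_n.+1 * 'I_K)%type -> R :=
  fun p => sample_part e (th t) p + new_part (fun k => b * th t k) p.

(** The integral of [pointwise] against [gamma]: on the right, shifts by [drift] become tilts; on
    the left, half spaces become Gaussian tails. *)
Lemma sum_risk_ge :
  ((\sum_t \sum_t' 2 * (expR ((dot s (th t) (th t) - r2) / 2) *
      (pi t t' * normal_tail (linear_margin t t'))))%:E <=
   \sum_t (gamma [set z | ~ A (fun p => z p + drift 1 t p)%R] +
           gamma [set z | A (fun p => z p + drift (-1) t p)%R]))%E.
Proof.
have dE b t z : tilt s (drift b t) z = q t z * tilt s (new_part (sgn b t)) z.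
  by apply: tilt_orthoD; exact: dot_sample_new.
have mAC : measurable (~` A) by exact: measurableC.
have mm t : measurable_fun setT (fun z => q t z * m t z).
  have -> : (fun z => q t z * m t z) = fun z =>
      q t z * (\1_(~` A) z * tilt s (new_part (sgn 1 t)) z
             + \1_A z * tilt s (new_part (sgn (-1) t)) z).
    apply/funext => z; rewrite /m !indicE in_setC; case: ifP => _ /=;
      by rewrite ?(mul0r, mul1r, add0r, addr0).
  apply: measurable_funM => //; apply: measurable_funD; apply: measurable_funM;
    by [exact: measurable_tilt|exact: measurable_indic].
have m0 t z : 0 <= q t z * m t z by rewrite mulr_ge0// /m; case: ifP; rewrite tilt_ge0.
have -> : (\sum_t (gamma [set z | ~ A (fun p => z p + drift 1 t p)%R] +
           gamma [set z | A (fun p => z p + drift (-1) t p)%R]) =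
   \int[gamma]_z (\sum_t q t z * m t z)%:E)%E.
  rewrite ge0_integral_sumR//; apply: eq_bigr => t _.
  have h1 := measure_shift s0 gammaP (drift 1 t) mAC.
  have h2 := measure_shift s0 gammaP (drift (-1) t) mA.
  rewrite [X in (X + _)%E]h1 [X in (_ + X)%E]h2 -ge0_integralD//; last 4 first.
  - by move=> z _; rewrite lee_fin mulr_ge0// tilt_ge0.
  - apply/measurable_EFinP; apply: measurable_funM; last exact: measurable_tilt.
    exact: measurable_indic.
  - by move=> z _; rewrite lee_fin mulr_ge0// tilt_ge0.
  - apply/measurable_EFinP; apply: measurable_funM; last exact: measurable_tilt.
    exact: measurable_indic.
  apply: eq_integral => z _; rewrite -EFinD !dE /m !indicE in_setC.
  by case: ifP => _ /=; rewrite ?(mul0r, mul1r, add0r, addr0).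
have mH t t' : measurable_fun setT (fun z => k t * H t t' z).
  by apply: measurable_funM => //; apply: measurable_funD; exact: mH1.
have H0 t t' z : 0 <= k t * H t t' z.
  by rewrite mulr_ge0 ?expR_ge0// addr_ge0// H1_ge0.
have -> : ((\sum_t \sum_t' 2 * (expR ((dot s (th t) (th t) - r2) / 2) *
      (pi t t' * normal_tail (linear_margin t t'))))%:E =
    \int[gamma]_z (\sum_t \sum_t' k t * H t t' z)%:E)%E.
  rewrite ge0_integral_sumR; last 2 first.
  - by move=> t; exact: measurable_sumP.
  - by move=> t z; exact: sumr_ge0.
  rewrite -sumEFin; apply: eq_bigr => t _.
  rewrite ge0_integral_sumR// -sumEFin; apply: eq_bigr => t' _.
  under eq_integral do rewrite EFinM.
  rewrite ge0_integralZl//; last 3 first.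
  - by apply/measurable_EFinP; apply: measurable_funD; exact: mH1.
  - by move=> z _; rewrite lee_fin addr_ge0// H1_ge0.
  - by rewrite lee_fin expR_ge0.
  by rewrite int_H -EFinM; congr (_%:E); rewrite /k; ring.
apply: ge0_le_integral => //.
- by move=> z _; rewrite lee_fin; apply: sumr_ge0 => t _; exact: sumr_ge0.
- by apply/measurable_EFinP; apply: measurable_sumP => t; exact: measurable_sumP.
- by apply/measurable_EFinP; exact: measurable_sumP.
- by move=> z _; rewrite lee_fin; exact: pointwise.
Qed.

End risk_bound.

(** * Disagreement of two posterior draws in one coordinate *)

Section separation.
Variables (f : Sg -> Sg) (bit : Sg -> bool) (kappa : R).
Hypotheses (fK : involutive f) (bitf : forall t, bit (f t) = ~~ bit t).
Hypothesis near : forall t,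
  n%:R * dot s (fun k => th t k - th (f t) k) (fun k => th t k - th (f t) k) <= kappa.

Let tau := 1 + expR kappa.
Let tau0 : 0 < tau. Proof. by rewrite addr_gt0// expR_gt0. Qed.

(* [x y / (x + y)] is the minimum over [l] of [l^2 x + (1 - l)^2 y], hence is
   superadditive. *)
Let harmonic_le (x y l : R) : 0 < x -> 0 < y ->
  x * y / (x + y) <= l ^+ 2 * x + (1 - l) ^+ 2 * y.
Proof.
move=> x0 y0; rewrite ler_pdivrMr ?addr_gt0// -subr_ge0.
have -> : (l ^+ 2 * x + (1 - l) ^+ 2 * y) * (x + y) - x * y = (l * x - (1 - l) * y) ^+ 2.
  by ring.
exact: sqr_ge0.
Qed.

(** The tangent bound for [u -> 1 / u] at [tau], with [u = 1 + x / y], multiplied by [x]. Being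
    linear in [x] and [x^2 / y], whose integrals are known, it takes the place of a Jensen
    inequality. *)
Let harmonic_ge (x y : R) : 0 < x -> 0 < y ->
  2 * x / tau <= x * y / (x + y) + (x + x ^+ 2 / y) / tau ^+ 2.
Proof.
move=> x0 y0; have xy0 := addr_gt0 x0 y0.
rewrite -subr_ge0.
have -> : x * y / (x + y) + (x + x ^+ 2 / y) / tau ^+ 2 - 2 * x / tau =
    x / (y * (x + y)) * (y - (x + y) / tau) ^+ 2.
  by field; rewrite !gt_eqF.
by rewrite mulr_ge0 ?sqr_ge0// divr_ge0 ?ltW// mulr_gt0.
Qed.

(** The mass of disagreeing pairs is twice [X * Y / (X + Y)], where [X] and [Y] are the likelihoods
    of the two halves. Superadditivity splits it over the pairs [{t, f t}], and the tangent bound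
    makes each piece linear. *)
Let separation_pointwise z :
  \sum_t 2 * q t z / tau <= \sum_t \sum_(t' | bit t' != bit t) U t t' z +
    \sum_t (q t z + q t z ^+ 2 / q (f t) z) / tau ^+ 2.
Proof.
pose X := \sum_(t | bit t) q t z; pose Y := \sum_(t | ~~ bit t) q t z.
have QE : Q z = X + Y by rewrite /Q (bigID bit).
(* Posterior probability of the half opposite to [t]. It is the weight [l] of [harmonic_le], and [f]
   changes it into [1 - w t]. *)
pose w t := (if bit t then Y else X) / Q z.
have UE t : \sum_(t' | bit t' != bit t) U t t' z = q t z * w t.
  rewrite /U -mulr_suml -mulr_sumr -mulrA /w; congr (_ * (_ / _)).
  by case: (bit t); apply: eq_bigl => t'; case: (bit t').
have -> : \sum_t \sum_(t' | bit t' != bit t) U t t' z = \sum_t q t z * w t.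
  by apply: eq_bigr => t _; rewrite UE.
have [[t0]|nS] := pselect (inhabited Sg); last first.
  by rewrite !big1 ?addr0// => t _; case: nS.
have Q0 : Q z != 0 by rewrite gt_eqF//; exact: Q_gt0 t0 z.
have wf t : w (f t) = 1 - w t.
  by rewrite /w bitf QE; move: Q0; rewrite QE; case: (bit t) => /= ?; field.
have e1 : \sum_t q t z * w t = \sum_t (w t ^+ 2 * q t z + w (f t) ^+ 2 * q (f t) z).
  have -> : \sum_t (w t ^+ 2 * q t z + w (f t) ^+ 2 * q (f t) z) =
      (\sum_t w t ^+ 2 * q t z) *+ 2.
    by rewrite big_split/= [X in X + _ = _](reindex_inj (inv_inj fK))/= -mulr2n
      [in RHS](reindex_inj (inv_inj fK)).
  rewrite [LHS](bigID bit)/= [X in _ = X *+ 2](bigID bit)/=.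
  rewrite (eq_bigr (fun t => q t z * (Y / Q z))); last by move=> t bt; rewrite /w bt.
  rewrite [X in _ + X = _](eq_bigr (fun t => q t z * (X / Q z))); last first.
    by move=> t /negPf bt; rewrite /w bt.
  rewrite [in RHS](eq_bigr (fun t => q t z * (Y / Q z) ^+ 2)); last first.
    by move=> t bt; rewrite /w bt mulrC.
  rewrite [X in _ = (_ + X) *+ 2](eq_bigr (fun t => q t z * (X / Q z) ^+ 2)); last first.
    by move=> t /negPf bt; rewrite /w bt mulrC.
  rewrite -!mulr_suml -/X -/Y mulr2n; move: Q0; rewrite QE => Q0.
  by field.
rewrite e1 -big_split/=; apply: ler_sum => t _.
apply: le_trans (harmonic_ge (q_gt0 t z) (q_gt0 (f t) z)) _.
by rewrite lerD2r wf; exact: harmonic_le.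
Qed.

(** After integration each [q] has mass 1 and each [q^2 / q'] mass at most [expR kappa]. The tangent
    point [tau = 1 + expR kappa] makes the correction at most [1 / tau], which leaves [1 / tau] out
    of [2 / tau]. *)
Lemma separation_weight_ge :
  #|Sg|%:R / (1 + expR kappa) <= \sum_t \sum_(t' | bit t' != bit t) pi t t'.
Proof.
pose E t := expR (n%:R *
  dot s (fun k => th t k - th (f t) k) (fun k => th t k - th (f t) k)).
pose V t z := (q t z + q t z ^+ 2 / q (f t) z) / tau ^+ 2.
have VE t z : V t z = (q t z + E t *
    tilt s (fun p => 2 * sample_part e (th t) p + -1 * sample_part e (th (f t)) p) z) / tau ^+ 2.
  rewrite /V /q /lik tilt_sq_div; congr ((_ + expR _ * _) / _).
  have -> : (fun p => sample_part e (th t) p - sample_part e (th (f t)) p) =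
      sample_part e (fun k => th t k - th (f t) k).
    by apply/funext => p; rewrite /sample_part; case: ifP => _; rewrite ?subr0 ?mulrBr.
  exact: dot_sample.
have V0 t z : 0 <= V t z.
  by rewrite /V divr_ge0 ?addr_ge0 ?divr_ge0 ?exprn_ge0// ltW.
have mV t : measurable_fun setT (V t).
  have -> := funext (VE t) : V t = _.
  apply: measurable_funM => //; apply: measurable_funD => //.
  by apply: measurable_funM => //; exact: measurable_tilt.
have iV t : (\int[gamma]_z (V t z)%:E = ((1 + E t) / tau ^+ 2)%:E)%E.
  under eq_integral do rewrite VE EFinM EFinD EFinM.
  rewrite ge0_integralZr//; last 3 first.
  - apply: emeasurable_funD; first exact/measurable_EFinP.
    by apply: emeasurable_funM => //; apply/measurable_EFinP; exact: measurable_tilt.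
  - by move=> z _; rewrite adde_ge0 ?mule_ge0 ?lee_fin ?expR_ge0// tilt_ge0.
  - by rewrite lee_fin invr_ge0 exprn_ge0// ltW.
  rewrite ge0_integralD//; last 4 first.
  - by move=> z _; rewrite lee_fin.
  - exact/measurable_EFinP.
  - by move=> z _; rewrite mule_ge0 ?lee_fin ?expR_ge0// tilt_ge0.
  - by apply: emeasurable_funM => //; apply/measurable_EFinP; exact: measurable_tilt.
  rewrite ge0_integralZl//; last 3 first.
  - by apply/measurable_EFinP; exact: measurable_tilt.
  - by move=> z _; rewrite lee_fin tilt_ge0.
  - by rewrite lee_fin expR_ge0.
  by rewrite int_q integral_tilt// mule1 -EFinD -EFinM.
have main : \sum_(t : Sg) 2 / tau <= \sum_t \sum_(t' | bit t' != bit t) pi t t' +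
    \sum_t (1 + E t) / tau ^+ 2.
  rewrite -lee_fin EFinD -!sumEFin.
  have -> : (\sum_(t : Sg) (2 / tau)%:E = \int[gamma]_z (\sum_t 2 * q t z / tau)%:E)%E.
    rewrite ge0_integral_sumR; last 2 first.
    - by move=> t; apply: measurable_funM => //; exact: measurable_funM.
    - by move=> t z; rewrite divr_ge0 ?mulr_ge0// ltW.
    apply: eq_bigr => t _; under eq_integral do rewrite mulrAC EFinM.
    rewrite ge0_integralZl//; last 3 first.
    - exact/measurable_EFinP.
    - by move=> z _; rewrite lee_fin.
    - by rewrite lee_fin divr_ge0// ltW.
    by rewrite int_q mule1.
  under [X in (_ <= X + _)%E]eq_bigr.
    move=> t _; rewrite -sumEFin; under eq_bigr do rewrite -pair_weightE.
    rewrite -ge0_integral_sumR//; over.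
  under [X in (_ <= _ + X)%E]eq_bigr do rewrite -iV.
  rewrite -!ge0_integral_sumR//; last 2 first.
  - by move=> t; exact: measurable_sumP.
  - by move=> t z; exact: sumr_ge0.
  rewrite -ge0_integralD//; last 4 first.
  - by move=> z _; rewrite lee_fin; apply: sumr_ge0 => t _; exact: sumr_ge0.
  - by apply/measurable_EFinP; apply: measurable_sumP => t; exact: measurable_sumP.
  - by move=> z _; rewrite lee_fin; exact: sumr_ge0.
  - by apply/measurable_EFinP; exact: measurable_sumP.
  apply: ge0_le_integral => //.
  - move=> z _; rewrite lee_fin; apply: sumr_ge0 => t _.
    by rewrite divr_ge0 ?mulr_ge0// ltW.
  - apply/measurable_EFinP; apply: measurable_sumP => t.
    by apply: measurable_funM => //; exact: measurable_funM.
  - apply: emeasurable_funD; apply/measurable_EFinP; last exact: measurable_sumP.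
    by apply: measurable_sumP => t; exact: measurable_sumP.
  - by move=> z _; rewrite -EFinD lee_fin; exact: separation_pointwise.
have EV : \sum_t (1 + E t) / tau ^+ 2 <= \sum_(t : Sg) tau^-1.
  apply: ler_sum => t _; rewrite ler_pdivrMr ?exprn_gt0// expr2 mulKf ?gt_eqF//.
  by rewrite lerD2l ler_expR.
have c1 : \sum_(t : Sg) 2 / tau = 2 * (#|Sg|%:R / tau).
  by rewrite sumr_const -mulr_natl; ring.
have c2 : \sum_(t : Sg) tau^-1 = #|Sg|%:R / tau by rewrite sumr_const -mulr_natl; ring.
have := le_trans main (lerD (lexx _) EV); rewrite c1 c2 mulr2n mulrDl mul1r.
by rewrite lerD2r.
Qed.

End separation.

End posterior.

(** * The hypercube *)

Section hypercube.
Context (R : realType) (N : nat).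

Definition cube := {ffun 'I_N -> bool}.

Definition flip (j : 'I_N) (t : cube) : cube := [ffun i => (i == j) (+) t i].

Lemma flipK j : involutive (flip j).
Proof. by move=> t; apply/ffunP => i; rewrite !ffunE addbA addbb. Qed.

Definition hamming (t t' : cube) : R := \sum_j (t j != t' j)%:R.

Lemma hamming_le t t' : hamming t t' <= N%:R.
Proof.
apply: (@le_trans _ _ (\sum_(j < N) 1)); last by rewrite sumr_const card_ord.
by apply: ler_sum => j _; case: eqP.
Qed.

Lemma hamming_flip j t : hamming t (flip j t) = 1.
Proof.
rewrite /hamming (bigD1 j)//= big1 ?addr0.
  by rewrite ffunE eqxx; case: (t j).
by move=> i /negPf ij; rewrite ffunE ij; case: (t i).
Qed.

End hypercube.

Lemma le_of_sqr (R : realDomainType) (x y : R) : 0 <= y -> x ^+ 2 <= y ^+ 2 -> x <= y.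
Proof. by move=> y0 h; rewrite leNgt; apply/negP => yx; nra. Qed.

(** * Excess error over the hypercube, for squared norms known up to [eta] *)

Section cube_bound.
Context (R : realType) (n K N : nat) (s : R).
Local Notation array := (array R ('I_n.+1 * 'I_K)%type).
Variable gamma : probability array R.
Hypotheses (s0 : s != 0) (gammaP : gaussian_array s gamma).
Variables (th : cube N -> 'I_K -> R) (e : 'I_n.+1 -> R).
Hypothesis e2 : forall i, e i ^+ 2 = 1.
Variables (Delta rho eta delta2 kappa : R).
Local Notation dot := (dot s).
Local Notation hamming := (hamming R).
Hypotheses (Delta0 : 0 < Delta) (eta0 : 0 <= eta) (etaD : eta <= Delta ^+ 2 / 8).
Hypotheses (rho0 : 0 < rho) (rhoE : rho ^+ 2 = Delta ^+ 2 / 4 + delta2 * N%:R).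
Hypotheses (delta20 : 0 <= delta2) (kappaE : n%:R * (4 * delta2) <= kappa).
Hypothesis nrm_le : forall t, dot (th t) (th t) <= rho ^+ 2.
Hypothesis nrm_ge : forall t, rho ^+ 2 - eta <= dot (th t) (th t).
Hypothesis dif_le : forall t t', dot (fun k => th t k - th t' k) (fun k => th t k - th t' k)
  <= 4 * delta2 * hamming t t'.
Hypothesis dif_ge : forall t t', 4 * delta2 * hamming t t' - eta <=
  dot (fun k => th t k - th t' k) (fun k => th t k - th t' k).

Let difE t t' : dot (fun k => th t k - th t' k) (fun k => th t k - th t' k) =
  dot (th t) (th t) - 2 * dot (th t) (th t') + dot (th t') (th t').
Proof.
have -> : (fun k => th t k - th t' k) = (fun k => th t k + -1 * th t' k).
  by apply/funext => k; rewrite mulN1r.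
by rewrite !dotDl !dotDr !dotZl !dotZr (dotC _ (th t') (th t)); ring.
Qed.

Let sumE t t' : dot (fun k => th t k + th t' k) (fun k => th t k + th t' k) =
  dot (th t) (th t) + 2 * dot (th t) (th t') + dot (th t') (th t').
Proof. by rewrite !dotDl !dotDr (dotC _ (th t') (th t)); ring. Qed.

(** By the parallelogram identity the squared norm is at least [4 * (rho^2 - eta) - 4 * delta2 * N =
    Delta^2 - 4 * eta], and [etaD] makes the loss at most one half. *)
Let sum_ge t t' :
  Delta ^+ 2 / 2 <= dot (fun k => th t k + th t' k) (fun k => th t k + th t' k).
Proof.
have := dif_le t t'; rewrite difE sumE => h.
have := nrm_ge t; have := nrm_ge t'.
have : delta2 * hamming t t' <= delta2 * N%:R.
  by rewrite ler_wpM2l// hamming_le.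
by move: h etaD rhoE; lra.
Qed.

Let sum_pos t t' :
  0 < dot (fun k => th t k + th t' k) (fun k => th t k + th t' k).
Proof. by apply: lt_le_trans (sum_ge t t'); rewrite divr_gt0// exprn_gt0. Qed.

Local Notation pdf := (normal_pdf 0 1 rho).

Let pdf_ge0 : 0 <= pdf. Proof. exact: normal_pdf_ge0. Qed.

Let pdf_le1 : pdf <= 1. Proof. exact: normal_pdf1_le1. Qed.

Let Delta_rho : Delta <= 2 * rho.
Proof.
apply: le_of_sqr; first by rewrite mulr_ge0// ltW.
rewrite exprMn rhoE.
have : 0 <= delta2 * N%:R by rewrite mulr_ge0.
by lra.
Qed.

Let nrm_ge0 t : 0 <= dot (th t) (th t).
Proof.
have h1 : 0 <= delta2 * N%:R by rewrite mulr_ge0.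
have h2 : 0 <= Delta ^+ 2 by rewrite sqr_ge0.
by have := nrm_ge t; move: h1 h2 etaD rhoE; lra.
Qed.

Let tail_nrm t : normal_tail (Num.sqrt (dot (th t) (th t))) <= normal_tail rho + eta / rho.
Proof.
set x := Num.sqrt _.
have x0 : 0 <= x by exact: sqrtr_ge0.
have x2 : x ^+ 2 = dot (th t) (th t) by rewrite sqr_sqrtr.
have xr : x <= rho.
  by apply: le_of_sqr; [exact: ltW|rewrite x2].
have := normal_tail_lip xr.
have : rho - x <= eta / rho.
  rewrite ler_pdivlMr//; have := nrm_ge t; rewrite -x2; nra.
by lra.
Qed.

(** For equal norms the margin is half of [A = |th t + th t'|], and by the parallelogram identity
    [(A / 2)^2] falls below [rho^2] by [delta2] times the Hamming distance. Unequal grid norms move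
    the margin by at most [eta / Delta]. *)
Let margin_ge t t' :
  normal_tail rho + pdf * (delta2 * hamming t t' - eta / 4) / (2 * rho) - eta / Delta <=
  normal_tail (linear_margin s th t t').
Proof.
rewrite /linear_margin; set b := dot _ (th t).
set A := Num.sqrt _.
have A2 : A ^+ 2 = dot (fun k => th t k + th t' k) (fun k => th t k + th t' k).
  by rewrite sqr_sqrtr// ltW.
have A0 : 0 < A by rewrite sqrtr_gt0.
have bE : b = A ^+ 2 / 2 + (dot (th t) (th t) - dot (th t') (th t')) / 2.
  by rewrite A2 sumE /b dotDl (dotC _ (th t') (th t)); field.
have b_le : b / A <= A / 2 + eta / Delta.
  have -> : b / A = A / 2 + (dot (th t) (th t) - dot (th t') (th t')) / (2 * A).
    by rewrite bE; field; rewrite gt_eqF.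
  rewrite lerD2l; apply: (@le_trans _ _ (eta / (2 * A))).
    rewrite ler_pM2r ?invr_gt0 ?mulr_gt0//.
    by have := nrm_le t; have := nrm_ge t'; lra.
  apply: ler_wpM2l => //; rewrite lef_pV2 ?posrE ?mulr_gt0//.
  apply: le_of_sqr; first by rewrite mulr_ge0// ltW.
  rewrite exprMn A2.
  have := sum_ge t t'; have : 0 <= Delta ^+ 2 by rewrite sqr_ge0.
  lra.
have alpha_le : (A / 2) ^+ 2 <= rho ^+ 2 - (delta2 * hamming t t' - eta / 4).
  rewrite exprMn A2 exprVn sumE.
  have := dif_ge t t'; rewrite difE; have := nrm_le t; have := nrm_le t'; lra.
have alpha_le' : (A / 2) ^+ 2 <= rho ^+ 2.
  have d0 : 0 <= dot (fun k => th t k - th t' k) (fun k => th t k - th t' k).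
    exact: dot_ge0.
  rewrite exprMn A2 exprVn sumE; move: d0; rewrite difE.
  have := nrm_le t; have := nrm_le t'; lra.
have a0 : 0 <= A / 2 by rewrite divr_ge0// ltW.
have ar : A / 2 <= rho by apply: le_of_sqr => //; exact: ltW.
have g1 := normal_tail_gap a0 ar.
(* With [y = A / 2], use [rho^2 - y^2 = (rho - y) * (rho + y)] and [rho + y <= 2 * rho]. *)
have g2 : (delta2 * hamming t t' - eta / 4) / (2 * rho) <= rho - A / 2.
  rewrite ler_pdivrMr ?mulr_gt0//.
  move: alpha_le alpha_le' ar a0; set y := A / 2; set c := _ - eta / 4.
  by move=> *; nra.
have g3 : normal_tail (A / 2) - eta / Delta <= normal_tail (b / A).
  have eD : 0 <= eta / Delta by rewrite divr_ge0// ltW.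
  have [h|h] := leP (A / 2) (b / A).
    by have := normal_tail_lip h; move: b_le; lra.
  by have := normal_tail_nincr (ltW h); lra.
have g4 : pdf * ((delta2 * hamming t t' - eta / 4) / (2 * rho)) <= pdf * (rho - A / 2).
  exact: ler_wpM2l.
by move: g1 g3 g4; rewrite mulrA; lra.
Qed.

(** Gathers the losses on the tail at the norm, on the margin and on the normalising factor, after
    [1 / rho <= 2 / Delta]. *)
Let err := eta * (4 / Delta + 1).

Let term_ge t t' :
  normal_tail (Num.sqrt (dot (th t) (th t))) + pdf * delta2 / (2 * rho) * hamming t t' - err <=
  expR ((dot (th t) (th t) - rho ^+ 2) / 2) * normal_tail (linear_margin s th t t').
Proof.
have := margin_ge t t'; have := tail_nrm t.
set p := normal_tail (linear_margin s th t t').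
have p0 : 0 <= p by exact: normal_tail_ge0.
have p1 : p <= 1 by exact: normal_tail_le1.
have ex : 1 - eta / 2 <= expR ((dot (th t) (th t) - rho ^+ 2) / 2).
  apply: le_trans (expR_ge1Dx _); have := nrm_ge t; lra.
have h1 : p - eta / 2 <= expR ((dot (th t) (th t) - rho ^+ 2) / 2) * p.
  apply: le_trans (ler_wpM2r p0 ex); move: eta0 p1 p0; nra.
have ir : rho^-1 <= 2 / Delta.
  by rewrite ler_pdivlMr// mulrC ler_pdivrMr.
have h2 : eta / rho <= eta * (2 / Delta) by exact: ler_wpM2l.
have h3 : pdf * (delta2 * hamming t t' - eta / 4) / (2 * rho) >=
    pdf * delta2 / (2 * rho) * hamming t t' - eta / rho / 8.
  have -> : pdf * (delta2 * hamming t t' - eta / 4) / (2 * rho) =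
    pdf * delta2 / (2 * rho) * hamming t t' - pdf * (eta / rho / 8).
    by field; rewrite gt_eqF.
  by rewrite lerD2l lerN2 ler_piMl// mulr_ge0// divr_ge0// ltW.
have errE : err = 2 * (eta * (2 / Delta)) + eta by rewrite /err; field; rewrite gt_eqF.
have eD : eta / Delta = eta * (2 / Delta) / 2 by field; rewrite gt_eqF.
have h0 : 0 <= eta * (2 / Delta) by rewrite mulr_ge0// divr_ge0// ltW.
rewrite errE eD; move: h1 h2 h3 h0 eta0.
set a1 := eta / rho; set a2 := eta * (2 / Delta); lra.
Qed.

(** Rows of [pair_weight] sum to 1, which isolates the error of the rules that know [t]. In the
    remaining term the Hamming distance is a sum over coordinates, each treated by
    [separation_weight_ge] with the flip of that coordinate. *)
Lemma cube_risk_ge (A : set array) : measurable A ->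
  ((2 * \sum_t normal_tail (Num.sqrt (dot (th t) (th t))) +
    #|cube N|%:R * (pdf * delta2 * N%:R / (rho * (1 + expR kappa)) -
                    2 * (eta * (4 / Delta + 1))))%:E <=
   \sum_t (gamma [set z | ~ A (fun p => z p + drift th e 1 t p)%R] +
           gamma [set z | A (fun p => z p + drift th e (-1) t p)%R]))%E.
Proof.
move=> mA.
apply: le_trans (sum_risk_ge s0 gammaP e mA nrm_le sum_pos); rewrite lee_fin.
pose pi := pair_weight s gamma th e.
have pi0 t t' : 0 <= pi t t' by exact: pair_weight_ge0.
have spi t : \sum_t' pi t t' = 1 by exact: sum_pair_weight.
pose c := pdf * delta2 / (2 * rho).
have c0 : 0 <= c by rewrite divr_ge0 ?mulr_ge0// ltW.
have step : \sum_t \sum_t' 2 * (pi t t' * (normal_tail (Num.sqrt (dot (th t) (th t)))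
      + c * hamming t t' - err)) <=
    \sum_t \sum_t' 2 * (expR ((dot (th t) (th t) - rho ^+ 2) / 2) *
      (pi t t' * normal_tail (linear_margin s th t t'))).
  apply: ler_sum => t _; apply: ler_sum => t' _; rewrite ler_pM2l//.
  by rewrite mulrCA ler_wpM2l//; exact: term_ge.
apply: le_trans step.
have -> : \sum_t \sum_t' 2 * (pi t t' * (normal_tail (Num.sqrt (dot (th t) (th t)))
      + c * hamming t t' - err)) =
   2 * \sum_t normal_tail (Num.sqrt (dot (th t) (th t))) +
   (2 * c * (\sum_t \sum_t' pi t t' * hamming t t') - 2 * err * #|cube N|%:R).
  rewrite (eq_bigr (fun t => 2 * normal_tail (Num.sqrt (dot (th t) (th t))) +
    (2 * c * (\sum_t' pi t t' * hamming t t') - 2 * err))); last first.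
    move=> t _; rewrite -[X in X + _]mulr1 -[2 * err]mulr1 -(spi t) !mulr_sumr.
    by rewrite -sumrB -big_split/=; apply: eq_bigr => t' _; ring.
  rewrite big_split/= sumrB -!mulr_sumr sumr_const; congr (_ + (_ - _)).
  by rewrite -mulr_natr /err; ring.
rewrite lerD2l.
have sep : #|cube N|%:R * N%:R / (1 + expR kappa) <= \sum_t \sum_t' pi t t' * hamming t t'.
  have -> : \sum_t \sum_t' pi t t' * hamming t t' =
      \sum_j \sum_(t : cube N) \sum_(t' : cube N | t' j != t j) pi t t'.
    rewrite [RHS]exchange_big/=; apply: eq_bigr => t _.
    under [RHS]eq_bigr do rewrite big_mkcond/=.
    rewrite [RHS]exchange_big/=; apply: eq_bigr => t' _.
    rewrite /hamming mulr_sumr; apply: eq_bigr => j _.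
    by rewrite eq_sym; case: eqP; rewrite ?mulr0 ?mulr1.
  have -> : #|cube N|%:R * N%:R / (1 + expR kappa) =
      \sum_(j < N) #|cube N|%:R / (1 + expR kappa).
    by rewrite sumr_const card_ord -mulr_natr; ring.
  apply: ler_sum => j _.
  apply: (separation_weight_ge s0 gammaP e2 (@flipK N j)) => [t|t].
    by rewrite ffunE eqxx; case: (t j).
  apply: le_trans kappaE; apply: ler_wpM2l => //.
  by have := dif_le t (flip j t); rewrite hamming_flip mulr1.
have t0 : 0 < 1 + expR kappa by rewrite addr_gt0// expR_gt0.
have c20 : 0 <= 2 * c by rewrite mulr_ge0.
apply: le_trans (lerB (ler_wpM2l c20 sep) (lexx _)).
rewrite le_eqVlt; apply/orP; left; apply/eqP.
by rewrite /err /c; field; rewrite !gt_eqF.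
Qed.

End cube_bound.

(** * Square integrable functions *)

Section square_integrable.
Context (R : realType).
Local Notation mu := (@lebesgue_measure R).
Local Notation I01 := (`[(0:R), (1:R)]%classic : set R).
Implicit Types (f g h : R -> R).

Let mI01 : measurable (I01 : set (measurableTypeR R)). Proof. exact: measurable_itv. Qed.

Let muI01 : (mu I01 = 1)%E.
Proof. by rewrite lebesgue_measure_itv/= lte_fin ltr01 oppr0 adde0. Qed.

Lemma L2_measurable f : L2 f -> measurable_fun I01 f. Proof. by case. Qed.

Lemma L2_mul_integrable f g : L2 f -> L2 g ->
  mu.-integrable I01 (EFin \o (fun x => f x * g x)).
Proof.
move=> [mf f2] [mg g2].
have msq h : measurable_fun I01 h -> measurable_fun I01 (fun x => (h x ^+ 2)%:E).
  by move=> mh; apply/measurable_EFinP; exact: measurable_funX.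
apply/integrableP; split; first by apply/measurable_EFinP; exact: measurable_funM.
have /le_lt_trans : (\int[mu]_(x in I01) `|(EFin \o (fun x => f x * g x)%R) x| <=
    \int[mu]_(x in I01) ((f x ^+ 2)%:E + (g x ^+ 2)%:E))%E.
  apply: ge0_le_integral => //.
  - by apply: measurableT_comp => //; apply/measurable_EFinP; exact: measurable_funM.
  - by apply: emeasurable_funD; exact: msq.
  - move=> x _; rewrite /= -EFinD lee_fin ler_norml; apply/andP; split.
      by have := sqr_ge0 (f x + g x); have := sqr_ge0 (f x); have := sqr_ge0 (g x); nra.
    by have := sqr_ge0 (f x - g x); have := sqr_ge0 (f x); have := sqr_ge0 (g x); nra.
apply; rewrite ge0_integralD//; first exact: lte_add_pinfty.
- by move=> x _; rewrite lee_fin sqr_ge0.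
- exact: msq.
- by move=> x _; rewrite lee_fin sqr_ge0.
- exact: msq.
Qed.

Lemma L2_cst (c : R) : L2 (cst c).
Proof.
split; first exact: measurable_cst.
rewrite (eq_integral (cst (c ^+ 2)%:E))//.
by rewrite integral_cst//= muI01 mule1 ltry.
Qed.

Lemma L2_integrable f : L2 f -> mu.-integrable I01 (EFin \o f).
Proof.
move=> f2; have := L2_mul_integrable f2 (L2_cst 1); apply: eq_integrable => // x _.
by rewrite /= mulr1.
Qed.

Lemma L2D f g : L2 f -> L2 g -> L2 (fun x => f x + g x).
Proof.
move=> hf hg; have [mf f2] := hf; have [mg g2] := hg.
split; first exact: measurable_funD.
have ff := L2_mul_integrable hf hf; have gg := L2_mul_integrable hg hg.
have fg := L2_mul_integrable hf hg.
have : mu.-integrable I01 (EFin \o (fun x => (f x + g x) ^+ 2)).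
  have := integrableD mI01 (integrableD mI01 ff gg) (integrableD mI01 fg fg).
  apply: eq_integrable => // x _ /=; rewrite -!EFinD; congr (_%:E); ring.
move=> /integrableP[_]; apply: le_lt_trans; rewrite le_eqVlt; apply/orP; left.
by apply/eqP; apply: eq_integral => x _; rewrite /= ger0_norm ?sqr_ge0.
Qed.

Lemma L2Z (c : R) f : L2 f -> L2 (fun x => c * f x).
Proof.
move=> hf; have [mf f2] := hf; split; first exact: measurable_funM.
under eq_integral do rewrite exprMn EFinM.
rewrite ge0_integralZl//; last 3 first.
- by apply/measurable_EFinP; exact: measurable_funX.
- by move=> x _; rewrite lee_fin sqr_ge0.
- by rewrite lee_fin sqr_ge0.
by rewrite lte_mul_pinfty// lee_fin sqr_ge0.
Qed.

Lemma L2_sum (J : Type) (r : seq J) (f : J -> R -> R) : (forall j, L2 (f j)) ->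
  L2 (fun x => \sum_(j <- r) f j x).
Proof.
move=> hf; elim: r => [|j r IH].
  have -> : (fun x => \sum_(j <- [::]) f j x) = cst 0.
    by apply/funext => x; rewrite big_nil.
  exact: L2_cst.
have -> : (fun x => \sum_(i <- j :: r) f i x) = (fun x => f j x + \sum_(i <- r) f i x).
  by apply/funext => x; rewrite big_cons.
exact: L2D.
Qed.

Lemma ipC f g : ip f g = ip g f.
Proof. by apply: eq_Rintegral => x _; rewrite mulrC. Qed.

Lemma ipDl f g h : L2 f -> L2 g -> L2 h -> ip (fun x => f x + g x) h = ip f h + ip g h.
Proof.
move=> hf hg hh; rewrite /ip -RintegralD//; try exact: L2_mul_integrable.
by apply: eq_Rintegral => x _; rewrite mulrDl.
Qed.

Lemma ipZl c f h : L2 f -> L2 h -> ip (fun x => c * f x) h = c * ip f h.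
Proof.
move=> hf hh; rewrite /ip -RintegralZl//; last exact: L2_mul_integrable.
by apply: eq_Rintegral => x _; rewrite mulrA.
Qed.

Lemma ip_suml (J : Type) (r : seq J) (f : J -> R -> R) h :
  (forall j, L2 (f j)) -> L2 h ->
  ip (fun x => \sum_(j <- r) f j x) h = \sum_(j <- r) ip (f j) h.
Proof.
move=> hf hh; elim: r => [|j r IH].
  rewrite big_nil /ip; transitivity (\int[mu]_(x in I01) (0 : R))%R.
    by apply: eq_Rintegral => x _; rewrite big_nil mul0r.
  by rewrite Rintegral_cst// mul0r.
have -> : (fun x => \sum_(i <- j :: r) f i x) = (fun x => f j x + \sum_(i <- r) f i x).
  by apply/funext => x; rewrite big_cons.
by rewrite ipDl ?big_cons ?IH//; exact: L2_sum.
Qed.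

Lemma ipE f : L2 f -> (\int[mu]_(x in I01) (f x ^+ 2)%:E = (ip f f)%:E)%E.
Proof.
move=> hf; rewrite /ip /Rintegral fineK; last first.
  by apply: integrable_fin_num => //; exact: (L2_mul_integrable hf hf).
by apply: eq_integral => x _; rewrite expr2.
Qed.

End square_integrable.

(** * Finite combinations of the basis *)

Section basis_combination.
Context (R : realType) (phi : nat -> R -> R).
Hypothesis phiP : ONB phi.

Definition comb m (c : 'I_m -> R) : R -> R := fun x => \sum_(j < m) c j * phi j.+1 x.

Let phiL2 j : (0 < j)%N -> L2 (phi j). Proof. exact: phiP.1. Qed.

Lemma L2_comb m (c : 'I_m -> R) : L2 (comb c).
Proof. by apply: L2_sum => j; apply: L2Z; exact: phiL2. Qed.

Lemma ip_comb_basis m (c : 'I_m -> R) i :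
  ip (comb c) (phi i.+1) = \sum_(j < m) c j * (j == i :> nat)%:R.
Proof.
rewrite /comb ip_suml; last 2 first.
- by move=> j; apply: L2Z; exact: phiL2.
- exact: phiL2.
apply: eq_bigr => j _; rewrite ipZl; last 2 first.
- exact: phiL2.
- exact: phiL2.
by rewrite phiP.2.1.
Qed.

Lemma ip_comb m (c c' : 'I_m -> R) : ip (comb c) (comb c') = \sum_j c j * c' j.
Proof.
rewrite ipC /comb ip_suml; last 2 first.
- by move=> j; apply: L2Z; exact: phiL2.
- exact: L2_comb.
apply: eq_bigr => j _; rewrite ipZl; last 2 first.
- exact: phiL2.
- exact: L2_comb.
rewrite ipC -/(comb c) ip_comb_basis (bigD1 j)//= eqxx mulr1 big1 ?addr0 1?mulrC//.
by move=> i /negPf ij; rewrite (_ : (i == j :> nat) = false) ?mulr0.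
Qed.

Lemma combB m (c c' : 'I_m -> R) :
  (fun x => comb c x - comb c' x) = comb (fun j => c j - c' j).
Proof.
by apply/funext => x; rewrite /comb -sumrB; apply: eq_bigr => j _; rewrite mulrBl.
Qed.

Lemma combN m (c : 'I_m -> R) : (fun x => - comb c x) = comb (fun j => - c j).
Proof.
by apply/funext => x; rewrite /comb -sumrN; apply: eq_bigr => j _; rewrite mulNr.
Qed.

(** By orthonormality the Sobolev series has no term beyond index [m], so each of its partial sums
    is at most the finite sum. *)
Lemma Hs_comb m (c : 'I_m -> R) (s Rad : R) :
  \sum_(j < m) c j ^+ 2 * j.+1%:R `^ (2 * s) <= Rad ^+ 2 -> Hs phi s Rad (comb c).
Proof.
move=> h; split; first exact: L2_comb.
pose u j : R := ip (comb c) (phi j) ^+ 2 * j%:R `^ (2 * s).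
have u0 j : 0 <= u j by rewrite mulr_ge0 ?sqr_ge0 ?powR_ge0.
have uE (j : nat) : u j.+1 = if insub j is Some i then c i ^+ 2 * j.+1%:R `^ (2 * s) else 0.
  rewrite /u ip_comb_basis; case: insubP => [i _ ij|jm].
    rewrite (bigD1 i)//= ij eqxx mulr1 big1 ?addr0// => k /negPf ki.
    by rewrite -ij (_ : (k == i :> nat) = false) ?mulr0.
  rewrite big1 ?expr0n ?mul0r// => k _.
  by rewrite (_ : (k == j :> nat) = false) ?mulr0//; apply/eqP => kj; move: jm; rewrite -kj ltn_ord.
apply: lime_le; first by apply: is_cvg_nneseries => *; rewrite lee_fin u0.
apply: nearW => k; rewrite sumEFin lee_fin; apply: le_trans h.
(* Extending the partial sum to length [k.-1 + m] avoids comparing [k] with [m]. *)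
rewrite big_add1 (@le_trans _ _ (\sum_(0 <= j < k.-1 + m) u j.+1))//.
  by rewrite [leRHS](big_cat_nat (n := k.-1))//= ?leq_addr// lerDl sumr_ge0.
rewrite (big_cat_nat (n := m))//= ?leq_addl// [X in _ + X]big_nat [X in _ + X]big1 ?addr0.
  rewrite big_mkord le_eqVlt; apply/orP; left; apply/eqP; apply: eq_bigr => i _.
  by rewrite uE valK.
by move=> j /andP[mj _]; rewrite uE insubF// ltnNge mj.
Qed.

End basis_combination.

(** * Dyadic increments *)

Section dyadic_grid.
Context (R : realType).
Local Notation mu := (@lebesgue_measure R).
Local Notation I01 := (`[(0:R), (1:R)]%classic : set R).
Implicit Types (f g h : R -> R) (m : nat).

Definition grid m (k : nat) : R := k%:R / 2 ^+ m.

Definition primitive f (t : R) : R := Rintegral mu (`[0, t]%classic : set R) f.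

Definition cell m (k : nat) : set R := `]grid m k, grid m k.+1]%classic.

Definition increments m f (k : 'I_(2 ^ m)) : R :=
  primitive f (grid m k.+1) - primitive f (grid m k).

Lemma pow2_gt0 m : 0 < 2 ^+ m :> R. Proof. by rewrite exprn_gt0. Qed.

Lemma grid_ge0 m k : 0 <= grid m k. Proof. by rewrite divr_ge0// ltW// pow2_gt0. Qed.

Lemma grid_le1 m k : (k <= 2 ^ m)%N -> grid m k <= 1.
Proof. by move=> km; rewrite ler_pdivrMr ?pow2_gt0// mul1r -natrX ler_nat. Qed.

Lemma grid0 m : grid m 0 = 0. Proof. exact: mul0r. Qed.

Lemma grid_pow2 m : grid m (2 ^ m) = 1.
Proof. by rewrite /grid natrX divff// gt_eqF// pow2_gt0. Qed.

Lemma gridS m k : grid m k.+1 - grid m k = (2 ^+ m)^-1.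
Proof. by rewrite /grid -mulrBl -natr1 addrC addKr mul1r. Qed.

Lemma grid_ltS m k : grid m k < grid m k.+1.
Proof. by rewrite -subr_gt0 gridS invr_gt0 pow2_gt0. Qed.

Lemma grid_double m k : grid m.+1 k.*2 = grid m k.
Proof. by rewrite /grid -muln2 natrM exprSr; field; rewrite gt_eqF// pow2_gt0. Qed.

Lemma integrable_prefix f t : t <= 1 -> mu.-integrable I01 (EFin \o f) ->
  mu.-integrable (`[0, t]%classic : set R) (EFin \o f).
Proof.
move=> t1; have mI (a b : R) : measurable (`[a, b]%classic : set (measurableTypeR R)).
  exact: measurable_itv.
by apply: (integrableS (mI _ _) (mI _ _)); apply: subset_itvl; rewrite bnd_simp.
Qed.

Lemma primitiveB f a b : mu.-integrable I01 (EFin \o f) -> 0 <= a -> a <= b -> b <= 1 ->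
  primitive f b - primitive f a = Rintegral mu (`]a, b]%classic : set R) f.
Proof.
move=> fi a0 ab b1; rewrite /primitive Rintegral_itvB//.
exact: integrable_prefix.
Qed.

Lemma primitive0 f : primitive f 0 = 0.
Proof.
rewrite /primitive /Rintegral set_itv1.
by rewrite (@integral_Sset1 _ _ _ 0).
Qed.

Lemma incrementsE m f (k : 'I_(2 ^ m)) : L2 f ->
  increments f k = Rintegral mu (cell m k) f.
Proof.
move=> f2; apply: primitiveB; first exact: L2_integrable.
- exact: grid_ge0.
- by rewrite ltW// grid_ltS.
- exact: grid_le1.
Qed.

Lemma primitive_sub f g t : L2 f -> L2 g -> t <= 1 ->
  primitive (fun x => f x - g x) t = primitive f t - primitive g t.
Proof.
move=> hf hg t1; rewrite /primitive RintegralB//.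
- by apply: integrable_prefix => //; exact: L2_integrable.
- by apply: integrable_prefix => //; exact: L2_integrable.
Qed.

Lemma primitiveN f t : L2 f -> t <= 1 ->
  primitive (fun x => - f x) t = - primitive f t.
Proof.
move=> hf t1; rewrite /primitive (_ : (fun x => - f x) = (fun x => -1 * f x)); last first.
  by apply/funext => x; rewrite mulN1r.
rewrite RintegralZl ?mulN1r//.
by apply: integrable_prefix => //; exact: L2_integrable.
Qed.

Lemma incrementsB m f g (k : 'I_(2 ^ m)) : L2 f -> L2 g ->
  increments (fun x => f x - g x) k = increments f k - increments g k.
Proof.
move=> hf hg; rewrite /increments !primitive_sub//; last 2 first.
- by apply: grid_le1; rewrite ltnW.
- exact: grid_le1.
by ring.
Qed.

(** The squared L2 norm of the step function of cell averages; it equals [dot] of the increments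
    when [s^2] is the mesh. *)
Definition grid_norm2 m f : R := 2 ^+ m * \sum_k increments (m := m) f k ^+ 2.

Let cell_sub m (k : 'I_(2 ^ m)) : cell m k `<=` I01.
Proof.
move=> x; rewrite /cell /= !in_itv/= => /andP[x1 x2]; apply/andP; split.
  by rewrite (le_trans (grid_ge0 m k))// ltW.
by rewrite (le_trans x2)// grid_le1.
Qed.

Let mcell m k : measurable (cell m k : set (measurableTypeR R)).
Proof. exact: measurable_itv. Qed.

Let mI01 : measurable (I01 : set (measurableTypeR R)).
Proof. exact: measurable_itv. Qed.

Let mu_cell m k : mu (cell m k) = ((2 ^+ m)^-1)%:E.
Proof. by rewrite lebesgue_measure_itv/= lte_fin grid_ltS -EFinB gridS. Qed.

(** Cauchy-Schwarz on each cell, as nonnegativity of the integral of [(f - c)^2] with [c] the cell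
    average. *)
Lemma grid_norm2_le m f : L2 f -> grid_norm2 m f <= ip f f.
Proof.
move=> hf; pose F := fun x => f x * f x.
have Fi : mu.-integrable I01 (EFin \o F) by exact: L2_mul_integrable.
have -> : ip f f = \sum_(k < 2 ^ m) (primitive F (grid m k.+1) - primitive F (grid m k)).
  rewrite -(big_mkord xpredT (fun k => primitive F (grid m k.+1) - primitive F (grid m k))).
  by rewrite telescope_sumr// grid_pow2 grid0 primitive0 subr0.
rewrite /grid_norm2 mulr_sumr; apply: ler_sum => k _.
rewrite primitiveB//; [|exact: grid_ge0|by rewrite ltW// grid_ltS|exact: grid_le1].
rewrite -/(cell m k).
set c := 2 ^+ m * increments f k.
have fci : mu.-integrable (cell m k) (EFin \o f).
  by apply: integrableS (L2_integrable hf) => //; exact: cell_sub.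
have Fci : mu.-integrable (cell m k) (EFin \o F).
  by apply: integrableS Fi => //; exact: cell_sub.
have cci : mu.-integrable (cell m k) (EFin \o cst (c ^+ 2)).
  have c2 : mu.-integrable I01 (EFin \o cst (c ^+ 2)) by exact/L2_integrable/L2_cst.
  by apply: integrableS c2 => //; exact: cell_sub.
have zci : mu.-integrable (cell m k) (EFin \o (fun x => 2 * c * f x)).
  by have := integrableZl (mcell m k) (2 * c) fci; apply: eq_integrable => // x _ /=; rewrite EFinM.
have : 0 <= \int[mu]_(x in cell m k) (F x - 2 * c * f x + c ^+ 2).
  apply: Rintegral_ge0 => x _; have -> : F x - 2 * c * f x + c ^+ 2 = (f x - c) ^+ 2.
    by rewrite /F; ring.
  exact: sqr_ge0.
rewrite RintegralD//; last first.
  have := integrableB (mcell m k) Fci zci.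
  by apply: eq_integrable => // x _ /=; rewrite EFinB.
rewrite RintegralB// RintegralZl// Rintegral_cst// [fine _](congr1 fine (mu_cell m k)) -(incrementsE k hf)/=.
have h : 2 ^+ m != 0 :> R by rewrite gt_eqF// pow2_gt0.
have -> : c ^+ 2 * (2 ^+ m)^-1 = 2 ^+ m * increments f k ^+ 2 by rewrite /c; field.
have -> : 2 * c * increments f k = 2 * (2 ^+ m * increments f k ^+ 2) by rewrite /c; ring.
by lra.
Qed.

(** The dyadic cell of level [m] around [x]; [Num.ceil] matches cells that are open on the left. *)
Let E (x : R) (m : nat) : set R :=
  `]((Num.ceil (x * 2 ^+ m) - 1)%:~R / 2 ^+ m), (Num.ceil (x * 2 ^+ m))%:~R / 2 ^+ m]%classic.

(** A cell of length [2^-m] lies in the ball of radius [2 * 2^-m], whose measure is four times as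
    large. *)
Let E_nice x : nicely_shrinking x (E x).
Proof.
split; first by move=> m; exact: measurable_itv.
have p0 m : 0 < 2 * (2 ^+ m)^-1 :> R by rewrite mulr_gt0// invr_gt0 pow2_gt0.
exists (4, fun m => PosNum (p0 m)); split => //=.
- rewrite -[X in _ --> X](mulr0 2); apply: cvgM; first exact: cvg_cst.
  under eq_fun do rewrite -exprVn.
  by apply: cvg_expr; rewrite ger0_norm// invf_lt1// ltr1n.
- move=> m y; rewrite /E /= in_itv/= => /andP[y1 y2].
  have /andP[c1 c2] := ceil_itv (x * 2 ^+ m).
  rewrite /ball/= ltr_norml.
  have i0 : 0 < (2 ^+ m)^-1 :> R by rewrite invr_gt0 pow2_gt0.
  have xE : x = x * 2 ^+ m / 2 ^+ m by rewrite mulfK// gt_eqF// pow2_gt0.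
  move: y1 y2; set c : R := (Num.ceil _)%:~R in c2 *.
  have c1' : c - 1 < x * 2 ^+ m by move: c1; rewrite intrD.
  rewrite intrD -/c => y1 y2.
  have x1 : (c - 1) / 2 ^+ m < x by rewrite ltr_pdivrMr ?pow2_gt0.
  have x2 : x <= c / 2 ^+ m by rewrite ler_pdivlMr ?pow2_gt0.
  move: x1 y1; rewrite mulrBl mul1r => x1 y1.
  by apply/andP; split; lra.
- move=> m; rewrite lebesgue_measure_ball; last exact: ltW (p0 m).
  rewrite lebesgue_measure_itv/= lte_fin ltr_pM2r ?invr_gt0 ?pow2_gt0//.
  rewrite ltr_int gtrBl// -EFinB -EFinM lee_fin -mulrBl -intrB opprB addrCA subrr addr0.
  by rewrite mul1r mulr2n; lra.
Qed.

Let E_cell m (k : nat) x : cell m k x -> E x m = cell m k.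
Proof.
rewrite /cell /E /= in_itv/= /grid => /andP[x1 x2].
have -> : Num.ceil (x * 2 ^+ m) = k.+1%:Z.
  apply: ceil_def; rewrite -ltr_pdivrMr ?pow2_gt0// -ler_pdivlMr ?pow2_gt0//.
  by rewrite intS addrAC subrr add0r x1.
by rewrite intS addrAC subrr add0r.
Qed.

Let ex_cell m x : 0 < x -> x <= 1 -> exists k : 'I_(2 ^ m), cell m k x.
Proof.
move=> x0 x1; have /andP[c1 c2] := ceil_itv (x * 2 ^+ m).
have xm0 : 0 < x * 2 ^+ m by rewrite mulr_gt0 ?pow2_gt0.
have c0 : 0 < Num.ceil (x * 2 ^+ m) by rewrite -(ltr_int R) (lt_le_trans xm0).
have cm : Num.ceil (x * 2 ^+ m) <= (2 ^ m)%:Z.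
  by rewrite ceil_le_int -pmulrn natrX ler_piMl// ltW// pow2_gt0.
case: (Num.ceil _) c0 cm c1 c2 => // -[//|k] _ km c1 c2.
exists (Ordinal (km : (k < 2 ^ m)%N)); rewrite /cell /= in_itv/= /grid.
rewrite ltr_pdivrMr ?pow2_gt0// ler_pdivlMr ?pow2_gt0//.
by rewrite c2 andbT; move: c1; rewrite intS addrAC subrr add0r.
Qed.

Let cell_inj m (k k' : 'I_(2 ^ m)) x : cell m k x -> cell m k' x -> k = k'.
Proof.
have aux (i j : nat) : cell m i x -> cell m j x -> (i <= j)%N.
  rewrite /cell /= !in_itv/= /grid => /andP[i1 _] /andP[_ j2].
  by move: (lt_le_trans i1 j2); rewrite ltr_pM2r ?invr_gt0 ?pow2_gt0// ltr_nat ltnS.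
by move=> h h'; apply/val_inj/eqP; rewrite eqn_leq !aux.
Qed.

Let steps m f (x : R) : R :=
  \sum_k (2 ^+ m * increments (m := m) f k) ^+ 2 * \1_(cell m k) x.

Let steps_ge0 m f x : 0 <= steps m f x.
Proof. by apply: sumr_ge0 => k _; rewrite mulr_ge0 ?sqr_ge0. Qed.

Let msteps m f : measurable_fun setT (steps m f).
Proof.
apply: measurable_sum => k; apply: measurable_funM => //.
by apply: measurable_indic; exact: measurable_itv.
Qed.

Let steps_cell m f (k : 'I_(2 ^ m)) x : cell m k x ->
  steps m f x = (2 ^+ m * increments f k) ^+ 2.
Proof.
move=> kx; rewrite /steps (bigD1 k)//= big1 ?addr0.
  by rewrite indicE mem_set// mulr1.
move=> i /negPf ik; rewrite indicE (_ : (x \in _) = false) ?mulr0//.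
by apply/negP => /set_mem ix; move: ik; rewrite (cell_inj ix kx) eqxx.
Qed.

Let int_steps m f : (\int[mu]_(x in `]0%R, 1%R]) (steps m f x)%:E = (grid_norm2 m f)%:E)%E.
Proof.
rewrite /steps; under eq_integral do rewrite -sumEFin.
rewrite ge0_integral_sum//; last 2 first.
- move=> k; apply/measurable_EFinP; apply: measurable_funM; first exact: measurable_cst.
  exact: (measurable_indic (mcell m k)).
- by move=> k x _; rewrite lee_fin mulr_ge0 ?sqr_ge0.
rewrite /grid_norm2 mulr_sumr -sumEFin; apply: eq_bigr => k _.
under eq_integral do rewrite EFinM.
rewrite ge0_integralZl//; last 2 first.
- by apply/measurable_EFinP; exact: (measurable_indic (mcell m k)).
- by rewrite lee_fin sqr_ge0.
rewrite integral_indic//.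
rewrite setIidl; last first.
  move=> x; rewrite /cell /= !in_itv/= => /andP[x1 x2]; apply/andP; split.
    exact: le_lt_trans (grid_ge0 m k) x1.
  by rewrite (le_trans x2)// grid_le1.
rewrite [X in (_ * X)%E](mu_cell m k) -EFinM; congr (_%:E).
by field; rewrite gt_eqF// pow2_gt0.
Qed.

Lemma grid_norm2_ge f (eta : R) : L2 f -> 0 < eta ->
  \forall m \near \oo, ip f f - eta <= grid_norm2 m f.
Proof.
move=> hf eta0.
have fi := L2_integrable hf.
(* Extended by zero, [f] is locally integrable on the whole line. *)
pose F := (f \_ I01 : R -> R).
have Floc : locally_integrable setT F by exact: integrable_locally_restrict.
have [N [mN N0 NP]] := lebesgue_differentiation Floc.
(* The cells of one level partition []0, 1]], which misses only the point 0. *)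
pose D : set R := `]0, 1]%classic.
have mD : measurable (D : set (measurableTypeR R)) by exact: measurable_itv.
have D01 : D `<=` I01.
  by move=> x; rewrite /D /= !in_itv/= => /andP[x0 ->]; rewrite ltW.
have mf2 : measurable_fun I01 (fun x => (f x ^+ 2)%:E).
  by apply/measurable_EFinP; apply: measurable_funX; exact: L2_measurable.
have lim_steps x : (D `\` N) x -> (steps m f x)%:E @[m --> \oo] --> (f x ^+ 2)%:E.
  move=> [Dx Nx].
  have Lx : lebesgue_pt F x by apply: contrapT => nL; apply: Nx; exact: NP.
  have := nice_lebesgue_differentiation E_nice Floc Lx.
  have -> : F x = f x by rewrite /F patchE mem_set//; exact: D01.
  move=> cv.
  pose b m := 2 ^+ m * \int[mu]_(y in E x m) F y.
  have kE m : exists2 k : 'I_(2 ^ m), cell m k x & \int[mu]_(y in E x m) F y = increments f k.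
    have : D x by [].
    rewrite /D /= in_itv/= => /andP[x0 x1].
    have [k kx] := ex_cell m x0 x1; exists k => //.
    rewrite (E_cell kx) incrementsE//; apply: eq_Rintegral => y /set_mem /cell_sub yI.
    by rewrite /F patchE mem_set.
  have aE m : ((mu (E x m))^-1 * \int[mu]_(y in E x m) (F y)%:E)%E = (b m)%:E.
    have [k kx _] := kE m; rewrite /b (E_cell kx) mu_cell.
    have Fi : mu.-integrable (cell m k) (EFin \o F).
      have := integrableS mI01 (mcell m k) (@cell_sub m k) fi.
      apply: eq_integrable => // y /set_mem /cell_sub yI.
      by rewrite /= /F patchE mem_set.
    rewrite -(fineK (integrable_fin_num (mcell m k) Fi)).
    by rewrite inver gt_eqF ?invr_gt0 ?pow2_gt0// invrK -EFinM.
  have bE m : steps m f x = b m * b m.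
    by have [k kx e] := kE m; rewrite (steps_cell _ kx) /b e expr2.
  have cvb : b m @[m --> \oo] --> f x.
    move/fine_cvg: cv; apply: cvg_trans; apply: near_eq_cvg; apply: nearW => m.
    by rewrite /= aE.
  apply: cvg_EFin; first exact: nearW.
  have -> : fine \o (fun m => (steps m f x)%:E) = (fun m => b m * b m).
    by apply/funext => m /=; rewrite bE.
  by rewrite expr2; exact: cvgM.
have fat : (\int[mu]_(x in D) (f x ^+ 2)%:E <= limn_einf (fun m => (grid_norm2 m f)%:E))%E.
  rewrite (ge0_negligible_integral mN)//; last 2 first.
  - by apply: measurable_funS mf2.
  - by move=> x _; rewrite lee_fin sqr_ge0.
  have mDN : measurable (D `\` N) by exact: measurableD.
  have mst m : measurable_fun (D `\` N) (fun x => (steps m f x)%:E).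
    by apply/measurable_EFinP; exact: measurable_funTS.
  have st0 m x : (D `\` N) x -> (0 <= (steps m f x)%:E)%E by rewrite lee_fin.
  apply: le_trans (le_trans (fatou mu mDN mst st0) _).
    rewrite le_eqVlt; apply/orP; left; apply/eqP; apply: eq_integral => x /set_mem xD.
    have cv := lim_steps x xD.
    by rewrite is_cvg_limn_einfE; [rewrite (cvg_lim _ cv)|apply/cvg_ex; eexists; exact: cv].
  rewrite !limn_einf_lim; apply: lee_lim; [exact: is_cvg_einfs|exact: is_cvg_einfs|].
  apply: nearW => m; apply: le_ereal_inf_tmp => _ [p mp <-].
  apply: (@le_trans _ _ (\int[mu]_(x in D `\` N) (steps p f x)%:E)%E).
    by apply: ereal_inf_lbound; exists p.
  rewrite -int_steps; apply: ge0_subset_integral => //.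
  - by apply/measurable_EFinP; apply: measurable_funTS; exact: (msteps p f).
  - by move=> x _; rewrite lee_fin.
have lt : ((ip f f - eta)%:E < limn (einfs (fun m => (grid_norm2 m f)%:E)))%E.
  rewrite -limn_einf_lim; apply: lt_le_trans fat.
  rewrite /D integral_itv_obnd_cbnd; last by apply: measurable_funS mf2.
  by rewrite ipE// lte_fin gtrBl.
have := lte_lim (@nondecreasing_einfs _ _) (@is_cvg_einfs _ _) lt.
apply: filterS => m h; rewrite -lee_fin; apply: le_trans h _.
by apply: ereal_inf_lbound; exists m; rewrite /=.
Qed.

End dyadic_grid.

(** * Approximation by dyadic cylinders *)

Definition symdiff (T : Type) (A B : set T) : set T := (A `\` B) `|` (B `\` A).

Section dyadic_sequence.
Context (R : realType).
Local Notation I01 := (`[(0:R), (1:R)]%classic : set R).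

Definition dyadic_index (m : nat) (t : R) : nat := Num.truncn (t * 2 ^+ m).

Lemma dyadic_index_le m t : 0 <= t <= 1 -> (dyadic_index m t <= 2 ^ m)%N.
Proof.
move=> /andP[t0 t1]; rewrite -(ler_nat R) natrX.
have tm0 : 0 <= t * 2 ^+ m by rewrite mulr_ge0// ltW// pow2_gt0.
have /andP[h _] := truncn_itv tm0.
by rewrite (le_trans h)// ler_piMl// ltW// pow2_gt0.
Qed.

Lemma grid_dyadic_index_cvg t : 0 <= t <= 1 ->
  grid R m (dyadic_index m t) @[m --> \oo] --> t.
Proof.
move=> /andP[t0 t1].
have bnd m : t - 2^-1 ^+ m <= grid R m (dyadic_index m t) <= t.
  have tm0 : 0 <= t * 2 ^+ m by rewrite mulr_ge0// ltW// pow2_gt0.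
  have /andP[h1 h2] := truncn_itv tm0.
  rewrite /grid /dyadic_index ler_pdivrMr ?pow2_gt0// h1 andbT.
  rewrite ler_pdivlMr ?pow2_gt0// mulrBl exprVn mulVf ?gt_eqF ?pow2_gt0//.
  by move: h2; rewrite -natr1; lra.
apply: (@squeeze_cvgr _ _ _ _ (fun m => t - 2^-1 ^+ m) (cst t)).
- by apply: nearW => m; exact: bnd.
- rewrite -[X in _ --> X]subr0; apply: cvgB; first exact: cvg_cst.
  by apply: cvg_expr; rewrite ger0_norm// invf_lt1// ltr1n.
- exact: cvg_cst.
Qed.

(** Makes evaluation of a continuous path at any time a countable combination of grid evaluations.
    The margin [1 / (q + 1)] keeps the inequality strict in the limit. *)
Lemma path_lt_dyadicP (x : R -> R) (t a : R) :
  {within I01, continuous x} -> 0 <= t <= 1 ->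
  x t < a <-> exists q N, forall m, (N <= m)%N ->
     x (grid R m (dyadic_index m t)) <= a - q.+1%:R^-1.
Proof.
move=> cx t01.
have cv : x (grid R m (dyadic_index m t)) @[m --> \oo] --> x t.
  move/subspace_continuousP: cx => /(_ t); rewrite /= in_itv/= => /(_ t01) h.
  apply: cvg_trans h => A /= [e e0 he].
  have : \forall m \near \oo, `|t - grid R m (dyadic_index m t)| < e.
    by have /cvgrPdist_lt := grid_dyadic_index_cvg t01; apply.
  apply: filterS => m hm; apply: he => //=.
  by rewrite in_itv/= grid_ge0 grid_le1// dyadic_index_le.
split=> [xa|[q [N h]]].
  have [q hq] : exists q : nat, q.+1%:R^-1 < (a - x t) / 2.
    have d0 : 0 < (a - x t) / 2 by rewrite divr_gt0// subr_gt0.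
    exists (Num.truncn ((a - x t) / 2)^-1).
    rewrite invf_plt ?posrE//; exact: truncnS_gt.
  have d0 : 0 < (a - x t) / 2 by rewrite divr_gt0// subr_gt0.
  have [N _ hN] := (cvgrPdist_lt _ _).1 cv _ d0.
  exists q, N => m Nm; have := hN m Nm; rewrite /= ltr_norml => /andP[h1 h2].
  by move: h1 hq; set r := q.+1%:R^-1; lra.
apply: (@le_lt_trans _ _ (a - q.+1%:R^-1)); last by rewrite gtrBl invr_gt0.
rewrite leNgt; apply/negP => lt.
have d0 : 0 < x t - (a - q.+1%:R^-1) by rewrite subr_gt0.
have [M _ hM] := (cvgrPdist_lt _ _).1 cv _ d0.
have := hM (maxn N M) (leq_maxr _ _); have := h (maxn N M) (leq_maxl _ _).
by rewrite /= ltr_norml => h1 /andP[_ h2]; move: h1 h2; set r := q.+1%:R^-1; lra.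
Qed.

End dyadic_sequence.

Lemma measurable_preimage_smallest d (Omega : measurableType d) (T : Type)
    (G : set (set T)) (D : Omega -> T) :
  (forall A, G A -> measurable (D @^-1` A)) ->
  forall A, smallest (sigma_algebra setT) G A -> measurable (D @^-1` A).
Proof.
move=> mD; apply: (smallest_sub (X := [set A | measurable (D @^-1` A)])) => //.
split => /=.
- by rewrite preimage_set0.
- by move=> B mB; rewrite setTD preimage_setC; exact: measurableC.
- by move=> F mF; rewrite preimage_bigcup; apply: bigcup_measurable.
Qed.

Section cylinders.
Context (R : realType) (n : nat).
Local Notation Data := (@Data R n).

Definition cyl_gen (m : nat) : set (set Data) := fun A =>
  (exists (i : 'I_n) (k : nat) B, (k <= 2 ^ m)%N /\ measurable B /\
     A = [set x : Data | B ((x.1 i).1 (grid R m k))]) \/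
  (exists i : 'I_n, A = [set x : Data | (x.1 i).2]) \/
  (exists (k : nat) B, (k <= 2 ^ m)%N /\ measurable B /\
     A = [set x : Data | B (x.2 (grid R m k))]).

Definition cylinder (m : nat) : set (set Data) := <<s cyl_gen m >>.

Lemma cylinder_data_gen m : cylinder m `<=` smallest (sigma_algebra setT) (@data_gen R n).
Proof.
apply: smallest_sub; first exact: smallest_sigma_algebra.
move=> A h; apply: sub_gen_smallest.
case: h => [[i [k [B [km [mB ->]]]]]|[[i ->]|[k [B [km [mB ->]]]]]].
- by left; exists i, (grid R m k), B; rewrite grid_ge0 grid_le1.
- by right; left; exists i.
- by right; right; exists (grid R m k), B; rewrite grid_ge0 grid_le1.
Qed.

Lemma cylinder_le m m' : (m <= m')%N -> cylinder m `<=` cylinder m'.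
Proof.
move=> /subnK <-; elim: (m' - m)%N => // d IH.
apply: subset_trans IH _; rewrite addSn; apply: smallest_sub.
  exact: smallest_sigma_algebra.
move=> A h; apply: sub_gen_smallest.
have le2 k j : (k <= 2 ^ j)%N -> (k.*2 <= 2 ^ j.+1)%N.
  by rewrite expnS mul2n leq_double.
case: h => [[i [k [B [km [mB ->]]]]]|[[i ->]|[k [B [km [mB ->]]]]]].
- by left; exists i, k.*2, B; rewrite grid_double; split; [exact: le2|].
- by right; left; exists i.
- by right; right; exists k.*2, B; rewrite grid_double; split; [exact: le2|].
Qed.

Section approximation.
Context d (Omega : measurableType d) (P : probability Omega R).
Variables (Sg : finType) (D : Sg -> Omega -> Data).
Hypothesis mD : forall A, @data_gen R n A -> forall t, measurable (D t @^-1` A).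
Hypothesis cont1 : forall t w i, {within `[(0:R), 1]%classic, continuous ((D t w).1 i).1}.
Hypothesis cont2 : forall t w, {within `[(0:R), 1]%classic, continuous (D t w).2}.

(** One cylinder serves all the finitely many laws. Only preimages under [D t] occur, so continuity
    of the paths can be used although [Data] contains arbitrary functions. *)
Definition approximable (A : set Data) :=
  (forall t, measurable (D t @^-1` A)) /\
  forall eta : R, 0 < eta -> exists m C, cylinder m C /\
    forall t, (P (symdiff (D t @^-1` A) (D t @^-1` C)) <= eta%:E)%E.

Let msig A : smallest (sigma_algebra setT) (@data_gen R n) A ->
  forall t, measurable (D t @^-1` A).
Proof. by move=> sA t; apply: measurable_preimage_smallest sA => B gB; exact: mD. Qed.

Let mcyl m C : cylinder m C -> forall t, measurable (D t @^-1` C).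
Proof. by move=> /cylinder_data_gen; exact: msig. Qed.

Let msymdiff (A B : set Omega) : measurable A -> measurable B -> measurable (symdiff A B).
Proof. by move=> mA mB; apply: measurableU; exact: measurableD. Qed.

Let approx_cyl m C : cylinder m C -> approximable C.
Proof.
move=> cC; split; first exact: mcyl cC.
move=> eta eta0; exists m, C; split => // t.
by rewrite /symdiff setDv setU0 measure0 lee_fin ltW.
Qed.

Let approx_eq A A' : (forall t, D t @^-1` A = D t @^-1` A') ->
  approximable A' -> approximable A.
Proof.
move=> e [mA h]; split=> [t|eta /h[m [C [cC hC]]]]; first by rewrite e.
by exists m, C; split=> // t; rewrite e.
Qed.

Let approx0 : approximable set0.
Proof. by apply: (@approx_cyl 0); case: (smallest_sigma_algebra setT (cyl_gen 0)). Qed.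

Let approxC A : approximable A -> approximable (~` A).
Proof.
move=> [mA h]; split=> [t|eta /h[m [C [cC hC]]]].
  by rewrite preimage_setC; apply: measurableC; exact: mA.
exists m, (~` C); split.
  by rewrite -setTD; case: (smallest_sigma_algebra setT (cyl_gen m)) => _ + _; apply.
move=> t; apply: le_trans (hC t); rewrite le_eqVlt; apply/orP; left; apply/eqP.
congr (P _); apply/seteqP; split=> w; rewrite /symdiff /=;
  by have [?|?] := pselect (A (D t w)); have [?|?] := pselect (C (D t w)); tauto.
Qed.

Let approxU A B : approximable A -> approximable B -> approximable (A `|` B).
Proof.
move=> [mA hA] [mB hB]; split=> [t|eta eta0].
  by rewrite preimage_setU; apply: measurableU; [exact: mA|exact: mB].
have e2 : 0 < eta / 2 by rewrite divr_gt0.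
have [m1 [C1 [c1 h1]]] := hA _ e2; have [m2 [C2 [c2 h2]]] := hB _ e2.
exists (maxn m1 m2), (C1 `|` C2).
have c1' := cylinder_le (leq_maxl m1 m2) c1.
have c2' := cylinder_le (leq_maxr m1 m2) c2.
split; first exact: (@measurableU _ (g_sigma_algebraType (cyl_gen (maxn m1 m2)))).
move=> t; apply: (@le_trans _ _ (P (symdiff (D t @^-1` A) (D t @^-1` C1) `|`
    symdiff (D t @^-1` B) (D t @^-1` C2)))).
  apply: le_measure; rewrite ?inE.
  - apply: msymdiff; rewrite preimage_setU; apply: measurableU => //.
      exact: mcyl c1 t.
    exact: mcyl c2 t.
  - apply: measurableU; apply: msymdiff => //; [exact: mcyl c1 t|exact: mcyl c2 t].
  - by move=> w; rewrite /symdiff /=; have [?|?] := pselect (A (D t w));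
      have [?|?] := pselect (C1 (D t w)); tauto.
apply: le_trans (measureU2 _ _ _) _.
- by apply: msymdiff => //; exact: mcyl c1 t.
- by apply: msymdiff => //; exact: mcyl c2 t.
by rewrite (splitr eta) EFinD; apply: leeD; [exact: h1|exact: h2].
Qed.

(** Finite unions exhaust the countable one up to small probability, by continuity from above, and
    finiteness of [Sg] gives a rank common to all [t]. *)
Let approx_bigcup (F : (set Data)^nat) :
  (forall i, approximable (F i)) -> approximable (\bigcup_i F i).
Proof.
move=> hF.
have mF i t : measurable (D t @^-1` F i) by case: (hF i).
have mUF t : measurable (D t @^-1` (\bigcup_i F i)).
  by rewrite preimage_bigcup; exact: bigcup_measurable.
split=> // eta eta0.
have e2 : 0 < eta / 2 by rewrite divr_gt0.
pose G N := \big[setU/set0]_(i < N) F i.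
have aG N : approximable (G N).
  elim: N => [|N IH]; first by rewrite /G big_ord0.
  by rewrite /G big_ord_recr/=; exact: approxU.
have mG N t : measurable (D t @^-1` G N) by case: (aG N).
have GF N : G N `<=` \bigcup_i F i.
  by rewrite /G -bigcup_mkord => x [i _ Fx]; exists i.
have lim t : \forall N \near \oo,
    (P (D t @^-1` (\bigcup_i F i) `\` D t @^-1` G N) <= (eta / 2)%:E)%E.
  pose H N := D t @^-1` (\bigcup_i F i) `\` D t @^-1` G N.
  have mH N : measurable (H N) by exact: measurableD.
  have H0 : \bigcap_N H N = set0.
    apply/seteqP; split=> // w hw; have [[i _ Fi] _] := hw 0%N Logic.I.
    have [_] := hw i.+1 Logic.I; apply; rewrite /G /= -bigcup_mkord.
    by exists i => //=.
  have : P \o H @ \oo --> P (\bigcap_N H N).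
    apply: nonincreasing_cvg_mu => //.
    - by rewrite (le_lt_trans (probability_le1 _ _))// ltry.
    - by rewrite H0.
    - move=> N N' NN'; apply/subsetPset => w [h1 h2]; split => //; apply: contra_not h2.
      rewrite /G /= -!bigcup_mkord => -[i /= iN Fi]; exists i => //=.
      exact: leq_trans iN NN'.
  rewrite H0 measure0 => cv.
  have fP N : P (H N) \is a fin_num by exact: fin_num_measure.
  have cv' : fine (P (H N)) @[N --> \oo] --> (0 : R) by exact: (fine_cvg cv).
  move/cvgrPdist_lt: cv' => /(_ _ e2); apply: filterS => N; rewrite sub0r normrN /= => hN.
  by rewrite -(fineK (fP N)) lee_fin; apply: le_trans (ler_norm _) (ltW hN).
have [N _ hN] := filter_forall _ lim.
have [_ /(_ _ e2)[m [C [cC hC]]]] := aG N.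
exists m, C; split => // t.
apply: (@le_trans _ _ (P ((D t @^-1` (\bigcup_i F i) `\` D t @^-1` G N) `|`
    symdiff (D t @^-1` G N) (D t @^-1` C)))).
  apply: le_measure; rewrite ?inE.
  - by apply: msymdiff => //; exact: mcyl cC t.
  - apply: measurableU; first exact: measurableD.
    by apply: msymdiff => //; exact: mcyl cC t.
  - move=> w; rewrite /symdiff /=.
    have : G N (D t w) -> (\bigcup_i F i) (D t w) by exact: GF.
    by have [?|?] := pselect (G N (D t w)); tauto.
apply: le_trans (measureU2 _ _ _) _.
- exact: measurableD.
- by apply: msymdiff => //; exact: mcyl cC t.
by rewrite (splitr eta) EFinD; apply: leeD; [exact: (hN N (leqnn N) t)|exact: hC].
Qed.

Let approx_sigma : sigma_algebra setT approximable.
Proof. by split=> // A; rewrite setTD; exact: approxC. Qed.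

Let approx_bigcap (F : (set Data)^nat) :
  (forall i, approximable (F i)) -> approximable (\bigcap_i F i).
Proof.
move=> hF; rewrite -[X in approximable X]setCK setC_bigcap.
by apply: approxC; apply: approx_bigcup => i; exact: approxC.
Qed.

(** Open half-lines generate the Borel sets, and for them [path_lt_dyadicP] gives the approximable
    set [L], which has the same preimages under every [D t]. *)
Let approx_eval (ev : Data -> R -> R) :
  (forall t w, {within `[(0:R), 1]%classic, continuous (ev (D t w))}) ->
  (forall m k B, (k <= 2 ^ m)%N -> measurable B ->
     approximable [set x | B (ev x (grid R m k))]) ->
  forall t B, 0 <= t <= 1 -> measurable B -> approximable [set x | B (ev x t)].
Proof.
move=> cev hgrid t B t01.
have -> : (measurable : set (set R)) = <<s @RGenInftyO.G R >>.
  exact: RGenInftyO.measurableE.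
apply: (smallest_sub (X := [set B | approximable [set x | B (ev x t)]])) => /=.
  split => /=.
  - exact: approx0.
  - move=> A hA; have := approxC hA.
    by apply: approx_eq => t'; apply/seteqP; split=> w /=; tauto.
  - move=> A hA; have := approx_bigcup hA.
    by apply: approx_eq => t'; apply/seteqP; split=> w.
move=> _ [a ->] /=.
pose L := \bigcup_q \bigcup_N \bigcap_j
  [set x : Data | (`]-oo, (a - q.+1%:R^-1)]%classic : set R)
     (ev x (grid R (N + j) (dyadic_index (N + j) t)))].
apply: (@approx_eq _ L); last first.
  apply: approx_bigcup => q; apply: approx_bigcup => N; apply: approx_bigcap => j.
  by apply: hgrid; [exact: dyadic_index_le|exact: measurable_itv].
move=> t'; apply/seteqP; split=> w /=; rewrite in_itv/=.
  move=> /(path_lt_dyadicP _ (cev t' w) t01)[q [N h]]; exists q => //; exists N => // j _.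
  by rewrite /= in_itv/=; apply: h; exact: leq_addr.
move=> [q _ [N _ h]]; apply/(path_lt_dyadicP _ (cev t' w) t01); exists q, N => m Nm.
by have := h (m - N)%N Logic.I; rewrite /= in_itv/= subnKC.
Qed.

Lemma cylinder_approximation A : smallest (sigma_algebra setT) (@data_gen R n) A ->
  approximable A.
Proof.
apply: smallest_sub => //.
move=> _ [[i [t [B [t01 [mB ->]]]]]|[[i ->]|[t [B [t01 [mB ->]]]]]].
- apply: (@approx_eval (fun x => (x.1 i).1)) => //.
  move=> m k C km mC; apply: (@approx_cyl m); apply: sub_gen_smallest.
  by left; exists i, k, C.
- by apply: (@approx_cyl 0); apply: sub_gen_smallest; right; left; exists i.
- apply: (@approx_eval (fun x => x.2)) => //.
  move=> m k C km mC; apply: (@approx_cyl m); apply: sub_gen_smallest.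
  by right; right; exists k, C.
Qed.

End approximation.

End cylinders.

(** * Law of the increments in the model *)

Section model_law.
Context (R : realType) (n : nat) d (Omega : measurableType d) (P : probability Omega R).
Variables (W : 'I_n.+1 -> Omega -> R -> R) (Y : 'I_n.+1 -> Omega -> bool).
Hypothesis PWY : model P W Y.
Variable m : nat.
Local Notation K := (2 ^ m)%N.
Local Notation array := (array R ('I_n.+1 * 'I_K)%type).

Let BM i : std_BM P (W i). Proof. exact: PWY.1. Qed.
Let mW i t : measurable_fun setT (fun w => W i w t). Proof. exact: (BM i).1. Qed.

Lemma model_measurable_label i : measurable [set w | Y i w].
Proof. exact: (PWY.2.1 i).1. Qed.

Lemma model_measurable_label_eq i b : measurable [set w | Y i w = b].
Proof.
case: b; first exact: model_measurable_label.
have -> : [set w | Y i w = false] = ~` [set w | Y i w].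
  by apply/seteqP; split=> w /=; case: (Y i w).
by apply: measurableC; exact: model_measurable_label.
Qed.

Definition mesh_sd : R := Num.sqrt (2 ^+ m)^-1.

Lemma mesh_sd2 : mesh_sd ^+ 2 = (2 ^+ m)^-1.
Proof. by rewrite sqr_sqrtr// invr_ge0 ltW// pow2_gt0. Qed.

Lemma mesh_sd_neq0 : mesh_sd != 0.
Proof. by rewrite gt_eqF// sqrtr_gt0 invr_gt0 pow2_gt0. Qed.

Definition noise (w : Omega) : array :=
  fun p => W p.1 w (grid R m p.2.+1) - W p.1 w (grid R m p.2).

Lemma measurable_noise : measurable_fun setT noise.
Proof. by apply: measurable_fun_array => p; exact: measurable_funB. Qed.

HB.instance Definition _ := isMeasurableFun.Build _ _ _ _ noise measurable_noise.

Definition noise_law : probability array R := distribution P noise.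

Definition label_event (i : 'I_n.+1) : set (set Omega) :=
  gen_sigma [set (fun w => (Y i w)%:R : R)].

Lemma label_eventT i : label_event i setT.
Proof.
rewrite -setC0 -setTD; case: (smallest_sigma_algebra setT
  [set A | exists (X : Omega -> R) B, [set (fun w => (Y i w)%:R : R)] X /\ measurable B /\ A = X @^-1` B])
  => h0 hC _.
exact: hC.
Qed.

Lemma label_event_eq i b : label_event i [set w | Y i w = b].
Proof.
apply: sub_gen_smallest; exists (fun w => (Y i w)%:R : R), [set b%:R]; split => //; split.
  exact: measurable_set1.
apply/seteqP; split=> w /=; first by move=> ->.
by case: (Y i w) b => -[] //= /eqP; rewrite ?oner_eq0// eq_sym oner_eq0.
Qed.

Lemma prob_label i b : P [set w | Y i w = b] = (2^-1)%:E.
Proof.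
have h : P [set w | Y i w] = (2^-1)%:E by rewrite (PWY.2.1 i).2 div1r.
case: b; first by rewrite -h.
have -> : [set w | Y i w = false] = ~` [set w | Y i w].
  by apply/seteqP; split=> w /=; case: (Y i w).
rewrite probability_setC ?h; last exact: model_measurable_label.
by rewrite -EFinB; congr (_%:E); field.
Qed.

(** Joint independence of all paths and labels, combined with the Gaussian law of the increments
    inside each path. *)
Lemma noise_box_labels (B : 'I_n.+1 * 'I_K -> set R) (C : 'I_n.+1 -> set Omega) :
  (forall p, measurable (B p)) -> (forall i, label_event i (C i)) ->
  P ([set w | forall p, B p (noise w p)] `&` [set w | forall i, C i w]) =
  ((\prod_p normal_prob 0 mesh_sd (B p)) * \prod_i P (C i))%E.
Proof.
move=> mB hC.
pose box i : set Omega := [set w | forall k : 'I_K, B (i, k) (noise w (i, k))].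
pose A (k : 'I_n.+1 + 'I_n.+1) : set Omega :=
  match k with inl i => box i | inr i => C i end.
(* Brownian motion is specified with sets indexed by all naturals; beyond [K] the default [setT]
   imposes nothing. *)
pose Bn i (j : nat) : set R := if insub j is Some k then B (i, k : 'I_K) else setT.
have mBn i j : measurable (Bn i j) by rewrite /Bn; case: insubP.
have boxE i : box i = \big[setI/setT]_(j < K)
    [set w | Bn i j (W i w (grid R m j.+1) - W i w (grid R m j))].
  rewrite -(bigcap_mkord _ (fun j =>
    [set w | Bn i j (W i w (grid R m j.+1) - W i w (grid R m j))])).
  apply/seteqP; split=> w h.
    by move=> j /= jK; rewrite /Bn insubT; exact: (h (Ordinal jK)).
  by move=> k; have := h k (ltn_ord k); rewrite /= /Bn valK.
have Pbox i : P (box i) = (\prod_(k < K) normal_prob 0 mesh_sd (B (i, k)))%E.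
  have h0 : 0 <= grid R m 0 by rewrite grid0.
  have h1 : grid R m K <= 1 by rewrite grid_pow2.
  have := (BM i).2.2 K (grid R m) (Bn i) h0 (fun j _ => grid_ltS R m j) h1 (mBn i).
  rewrite -boxE => ->.
  by apply: eq_bigr => k _; rewrite gridS /Bn valK.
have sbox i : gen_sigma [set (fun w => W i w t) | t in `[(0:R), 1]%classic] (box i).
  set G := [set A | _].
  (* A copy of [Omega] carrying the sigma-algebra of one path, so that the usual measurability
     lemmas apply relative to it. *)
  pose T := g_sigma_algebraType [set A : set Omega | exists (X : Omega -> R) B0,
     [set (fun w => W i w t) | t in `[(0:R), 1]%classic] X /\ measurable B0 /\ A = X @^-1` B0].
  have mWT t : 0 <= t <= 1 -> measurable_fun setT (fun w : T => W i w t).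
    move=> t01 _ B0 mB0; rewrite setTI; apply: sub_sigma_algebra.
    by exists (fun w => W i w t), B0; split => //; exists t => //=; rewrite in_itv.
  have -> : box i = \bigcap_(k in [set: 'I_K])
      ((fun w : T => W i w (grid R m k.+1) - W i w (grid R m k)) @^-1` B (i, k)).
    by apply/seteqP; split=> w h k; [move=> _; exact: (h k)|exact: (h k Logic.I)].
  change (measurable (\bigcap_(k in [set: 'I_K])
      ((fun w : T => W i w (grid R m k.+1) - W i w (grid R m k)) @^-1` B (i, k)))).
  apply: fin_bigcap_measurable => // k _.
  rewrite -[X in measurable X]setTI; apply: measurable_funB => //; apply: mWT.
    by rewrite grid_ge0 grid_le1.
  by rewrite grid_ge0 grid_le1// ltnW.
have := PWY.2.2 (enum {: 'I_n.+1 + 'I_n.+1}) (enum_uniq _) A.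
have -> : \big[setI/setT]_(i <- enum {: 'I_n.+1 + 'I_n.+1}) A i =
    [set w | forall p, B p (noise w p)] `&` [set w | forall i, C i w].
  rewrite -bigcap_seq; apply/seteqP; split=> w.
    move=> h; split=> [[i k]|i].
      by have /(_ k) := h (inl i) (mem_enum _ _).
    exact: (h (inr i) (mem_enum _ _)).
  by move=> [h1 h2] [i|i] _ //= k; exact: h1.
move=> ->; last by move=> [i|i] _; [exact: sbox|exact: hC].
rewrite big_enum/= big_sumType/=; congr (_ * _)%E.
rewrite (eq_bigr _ (fun i _ => Pbox i)) pair_bigA/=.
by apply: eq_bigr => -[].
Qed.

Lemma gaussian_noise : gaussian_array mesh_sd noise_law.
Proof.
move=> B mB; rewrite /noise_law /= /distribution /pushforward /=.
have := noise_box_labels mB (fun i => @label_eventT i).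
rewrite [X in _ `&` X](_ : _ = setT); last by apply/seteqP; split.
rewrite setIT => ->; rewrite [X in (_ * X)%E]big1 ?mule1//.
by move=> i _; rewrite probability_setT.
Qed.

(** For fixed label events both sides are finite measures in [S], which agree on boxes by
    [noise_box_labels]. *)
Lemma noise_labels (S : set array) (C : 'I_n.+1 -> set Omega) :
  measurable S -> (forall i, label_event i (C i)) ->
  P ([set w | S (noise w)] `&` [set w | forall i, C i w]) =
  (noise_law S * \prod_i P (C i))%E.
Proof.
move=> mS hC.
have mC i : measurable (C i).
  have : label_event i `<=` measurable.
    apply: smallest_sub; first exact: sigma_algebra_measurable.
    move=> _ [X [B [-> [mB ->]]]]; rewrite -[X in measurable X]setTI.
    suff mY : measurable_fun setT (fun w => (Y i w)%:R : R) by exact: mY.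
    have -> : (fun w => (Y i w)%:R : R) = \1_[set w | Y i w].
      apply/funext => w; rewrite indicE; congr ((_ : bool)%:R).
      by apply/idP/idP; rewrite inE.
    by apply: measurable_indic; exact: model_measurable_label.
  by apply.
have mH : measurable [set w | forall i, C i w].
  have -> : [set w | forall i, C i w] = \bigcap_(i in [set: 'I_n.+1]) C i.
    by apply/seteqP; split=> w h i; [move=> _; exact: h|exact: (h i Logic.I)].
  exact: fin_bigcap_measurable.
pose c := fine (\prod_i P (C i))%E.
have cE : (c%:E = \prod_i P (C i))%E.
  by rewrite fineK//; apply: prode_fin_num => i _; exact: fin_num_measure.
have c0 : 0 <= c by rewrite fine_ge0// prode_ge0.
have mI (T : set array) : measurable T -> measurable ([set w | T (noise w)] `&` [set w | forall i, C i w]).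
  move=> mT; apply: measurableI => //.
  by have := measurable_noise measurableT mT; rewrite setTI.
have u1 : (pushforward (mrestr P mH) noise setT < +oo)%E.
  apply: (@le_lt_trans _ _ 1%E); last exact: ltry.
  by apply: (@probability_le1 _ _ _ P); exact: (mI setT measurableT).
have u2 (B : 'I_n.+1 * 'I_K -> set R) : (forall p, measurable (B p)) ->
    pushforward (mrestr P mH) noise [set z | forall p, B p (z p)] =
    mscale (NngNum c0) noise_law [set z | forall p, B p (z p)].
  move=> mB; apply: etrans (noise_box_labels mB hC) _.
  rewrite /mscale /= -cE muleC; congr (_ * _)%E.
  exact: esym (gaussian_noise mB).
have := array_measure_unique u1 u2 mS.
by move=> /(_ measurable_noise) h; apply: etrans h _; rewrite -cE muleC.
Qed.

End model_law.

(** * Errors of classifiers in the symmetric model [g = - f] *)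

Section model_risk.
Context (R : realType) (n : nat) d (Omega : measurableType d) (P : probability Omega R).
Variables (W : 'I_n.+1 -> Omega -> R -> R) (Y : 'I_n.+1 -> Omega -> bool).
Hypothesis PWY : model P W Y.
Local Notation Data := (@Data R n).

Definition label_sign (b : bool) : R := if b then 1 else -1.

Lemma label_sign2 b : label_sign b ^+ 2 = 1.
Proof. by case: b; rewrite /= ?sqrrN expr1n. Qed.

Definition sym_data (f : R -> R) : Omega -> Data := data_of W Y f (fun x => - f x).

Let W0 i w : W i w 0 = 0. Proof. by case: ((PWY.1 i).2.1 w). Qed.

Lemma path_of_sym f y w t : L2 f -> t <= 1 ->
  path_of f (fun x => - f x) y w t = label_sign y * primitive f t + w t.
Proof.
move=> hf t1; rewrite /path_of /label_sign; case: y; first by rewrite mul1r.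
by rewrite mulN1r -primitiveN.
Qed.

Lemma sym_data_measurable f A : L2 f -> data_gen A -> measurable (sym_data f @^-1` A).
Proof.
move=> hf.
have mpath i t B : 0 <= t <= 1 -> measurable B ->
    measurable [set w | B (path_of f (fun x => - f x) (Y i w) (W i w) t)].
  move=> /andP[t0 t1] mB.
  have mS : measurable_fun setT (fun w => label_sign (Y i w)).
    have -> : (fun w => label_sign (Y i w)) = (fun w => 2 * \1_[set w | Y i w] w - 1).
      apply/funext => w; rewrite indicE /label_sign.
      have -> : (w \in [set w | Y i w]) = Y i w by apply/idP/idP; rewrite inE.
      by case: (Y i w) => /=; rewrite ?mulr1 ?mulr0; lra.
    apply: measurable_funB => //; apply: measurable_funM => //.
    by apply: measurable_indic; exact: model_measurable_label PWY i.
  have mf : measurable_fun setT (fun w => label_sign (Y i w) * primitive f t + W i w t).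
    by apply: measurable_funD; [exact: measurable_funM|exact: (PWY.1 i).1].
  rewrite (_ : [set w | _] = (fun w => label_sign (Y i w) * primitive f t + W i w t) @^-1` B).
    by rewrite -[X in measurable X]setTI; exact: mf.
  by apply/seteqP; split=> w /=; rewrite path_of_sym.
case=> [[i [t [B [t01 [mB ->]]]]]|[[i ->]|[t [B [t01 [mB ->]]]]]].
- exact: mpath.
- exact: model_measurable_label PWY _.
- exact: mpath.
Qed.

Lemma path_of_sym_continuous f y i w : L2 f ->
  {within `[(0:R), 1]%classic, continuous (path_of f (fun x => - f x) y (W i w))}.
Proof.
move=> hf.
have cW := ((PWY.1 i).2.1 w).2.
have hg : L2 (if y then f else fun x => - f x).
  case: y => //; have := L2Z (-1) hf.
  by congr L2; apply/funext => x; rewrite mulN1r.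
have cP := parameterized_integral_continuous ler01 (L2_integrable hg).
by move=> x; apply: cvgD; [exact: cP|exact: cW].
Qed.

Section level.
Variable m : nat.
Local Notation K := (2 ^ m)%N.
Local Notation I := ('I_n.+1 * 'I_K)%type.
Local Notation array := (array R I).
Local Notation Z := (@noise R n d Omega W m).
Local Notation gamma := (noise_law PWY m).
Local Notation s := (mesh_sd R m).

Definition observed f (w : Omega) : array :=
  fun p => Z w p + label_sign (Y p.1 w) * increments f p.2.

Lemma path_of_grid f i w k (km : (k <= K)%N) : L2 f ->
  path_of f (fun x => - f x) (Y i w) (W i w) (grid R m k) =
  \sum_(j < k) observed f w (i, widen_ord km j).
Proof.
move=> hf; rewrite path_of_sym//; last exact: grid_le1.
pose F j := label_sign (Y i w) * primitive f (grid R m j) + W i w (grid R m j).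
transitivity (\sum_(j < k) (F j.+1 - F j)).
  rewrite -(big_mkord xpredT (fun j => F j.+1 - F j)) telescope_sumr//.
  by rewrite /F grid0 primitive0 W0 mulr0 addr0 subr0.
by apply: eq_bigr => j _; rewrite /F /observed /noise /increments/=; ring.
Qed.

(* [A] is not allowed to look at the label of the new observation. *)
Lemma cylinder_features (C : set Data) (y : 'I_n.+1 -> bool) : cylinder m C ->
  exists2 A : set array, measurable A &
    forall f w, L2 f -> (forall i, i != ord_max -> Y i w = y i) ->
      C (sym_data f w) <-> A (observed f w).
Proof.
pose G := [set C : set Data | exists2 A : set array, measurable A &
    forall f w, L2 f -> (forall i, i != ord_max -> Y i w = y i) ->
      C (sym_data f w) <-> A (observed f w)].
have mval i k (km : (k <= K)%N) B : measurable B ->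
    measurable ([set z : array | B (\sum_(j < k) z (i, widen_ord km j))]).
  move=> mB; have mf : measurable_fun setT
      (fun z : array => \sum_(j < k) z (i, widen_ord km j) : R).
    by apply: measurable_sum => j; exact: measurable_coord.
  by rewrite -[X in measurable X]setTI; exact: mf.
apply: (smallest_sub (X := G)).
  split.
  - by exists set0.
  - move=> A [A' mA' h]; exists (~` A'); first exact: measurableC.
    by move=> f w hf hw; rewrite setTD; split; apply: contra_not => /(h f w hf hw).
  - move=> F hF; pose A i := projT1 (cid2 (hF i)).
    have mA i : measurable (A i) by rewrite /A; case: cid2.
    have AP i f w : L2 f -> (forall i, i != ord_max -> Y i w = y i) ->
        F i (sym_data f w) <-> A i (observed f w).
      by rewrite /A; case: cid2 => /= ? ? h hf; exact: h.
    exists (\bigcup_i A i); first exact: bigcup_measurable.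
    by move=> f w hf hw; split=> -[i _ /(AP i f w hf hw) Fi]; exists i.
have widen_neq (i : 'I_n) : widen_ord (leqnSn n) i != ord_max.
  by apply/eqP => /(congr1 val) /= e; have := ltn_ord i; rewrite e ltnn.
move=> _ [[i [k [B [km [mB ->]]]]]|[[i ->]|[k [B [km [mB ->]]]]]].
- exists [set z | B (\sum_(j < k) z (widen_ord (leqnSn n) i, widen_ord km j))].
    exact: mval.
  by move=> f w hf _; rewrite /= (path_of_grid _ _ km).
- exists (if y (widen_ord (leqnSn n) i) then setT else set0); first by case: ifP.
  by move=> f w hf hw; rewrite /= hw//; case: ifP.
- exists [set z | B (\sum_(j < k) z (ord_max, widen_ord km j))]; first exact: mval.
  by move=> f w hf _; rewrite /= (path_of_grid _ _ km).
Qed.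

Definition label_cell (y : cube n.+1) : set Omega := [set w | forall i, Y i w = y i].

Lemma prob_label_cells (E : set Omega) : measurable E ->
  P E = (\sum_y P (E `&` label_cell y))%E.
Proof.
move=> mE.
have mH y : measurable (label_cell y).
  have -> : label_cell y = \bigcap_(i in [set: 'I_n.+1]) [set w | Y i w = y i].
    by apply/seteqP; split=> w h i; [move=> _; exact: h|exact: (h i Logic.I)].
  by apply: fin_bigcap_measurable => // i _; exact: model_measurable_label_eq PWY i _.
transitivity (\int[P]_w (\sum_y \1_(E `&` label_cell y) w : R)%:E)%E; last first.
  rewrite ge0_integral_sumR//; last first.
    by move=> y; apply: measurable_indic; exact: measurableI.
  by apply: eq_bigr => y _; rewrite integral_indic ?setIT//; exact: measurableI.
rewrite -[in LHS](setIT E) -integral_indic//; apply: eq_integral => w _; congr (_%:E).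
rewrite (bigD1 [ffun i => Y i w])//= big1 ?addr0.
  rewrite !indicE in_setI [X in _ && X]mem_set ?andbT//.
  by move=> i; rewrite ffunE.
move=> y yw; rewrite indicE (_ : (w \in _) = false)//; apply/negP => /set_mem[_ h].
by move/negP: yw; apply; apply/eqP/ffunP => i; rewrite ffunE h.
Qed.

Lemma prob_noise_label_cell (S : set array) y : measurable S ->
  (P ([set w | S (Z w)] `&` label_cell y) = (2^-1 ^+ n.+1)%:E * gamma S)%E.
Proof.
move=> mS; have := noise_labels PWY mS (fun i => @label_event_eq R n d Omega Y i (y i)).
rewrite /label_cell => ->; rewrite muleC; congr (_ * _)%E.
rewrite (eq_bigr (fun=> (2^-1)%:E)); last by move=> i _; exact: prob_label PWY i _.
by rewrite prodEFin prodr_const card_ord.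
Qed.

Section cube_family.
Variables (N : nat) (F : cube N -> R -> R).
Hypothesis FL2 : forall t, L2 (F t).
Variable C : set Data.
Hypothesis cC : cylinder m C.

Let th t : 'I_K -> R := increments (F t).
Let e (y : cube n.+1) (i : 'I_n.+1) : R := label_sign (y i).

(** The new label is overwritten by [true], so that the region [A y] cannot depend on it. *)
Let setmax (y : cube n.+1) : 'I_n.+1 -> bool := fun i => (i == ord_max) || y i.
Let A y : set array := projT1 (cid2 (cylinder_features (setmax y) cC)).
Let mA y : measurable (A y). Proof. by rewrite /A; case: cid2. Qed.
Let AP (y : cube n.+1) f w : L2 f -> (forall i, i != ord_max -> Y i w = y i) ->
  C (sym_data f w) <-> A y (observed f w).
Proof.
rewrite /A; case: cid2 => /= A' _ h hf hy; apply: h => // i im.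
by rewrite hy// /setmax (negPf im).
Qed.

Let T t y (b : bool) : set array :=
  if b then [set z | ~ A y (fun p => z p + drift th (e y) 1 t p)]
  else [set z | A y (fun p => z p + drift th (e y) (-1) t p)].

(** Neither [A y] nor the drift reads [y ord_max], so both values of the new label are tested on the
    same region. *)
Let T_flip t y b : T t (flip ord_max y) b = T t y b.
Proof.
have sm : setmax (flip ord_max y) = setmax y.
  by apply/funext => i; rewrite /setmax ffunE; case: eqP.
have dr c : drift th (e (flip ord_max y)) c t = drift th (e y) c t.
  apply/funext => p; rewrite /drift /sample_part /e ffunE; congr (_ + _).
  by case: eqP.
by rewrite /T /A sm !dr.
Qed.

Let mT t y b : measurable (T t y b).
Proof.
have mSh c : measurable [set z : array | A y (fun p => z p + drift th (e y) c t p)].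
  have := measurable_shift (drift th (e y) c t) measurableT (mA y).
  by rewrite setTI.
by rewrite /T; case: b => //; apply: measurableC; exact: mSh.
Qed.

Definition cyl_error t : set Omega :=
  [set w | `[< C (sym_data (F t) w) >] != Y ord_max w].

Hypothesis mE : forall t, measurable (cyl_error t).

Let error_cell t y :
  cyl_error t `&` label_cell y = [set w | T t y (y ord_max) (Z w)] `&` label_cell y.
Proof.
have obs w : label_cell y w -> observed (F t) w =
    (fun p => Z w p + drift th (e y) (label_sign (y ord_max)) t p).
  move=> hy; apply/funext => p; rewrite /observed /drift /sample_part /new_part /e hy.
  by congr (_ + _); case: eqP => [->|_]; rewrite ?add0r ?addr0.
have key w : label_cell y w -> C (sym_data (F t) w) <->
    A y (fun p => Z w p + drift th (e y) (label_sign (y ord_max)) t p).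
  by move=> hy; rewrite -obs//; apply: AP => // i _; exact: hy.
apply/seteqP; split=> w [h hy]; split => //; move: h; have := key w hy;
  rewrite /cyl_error /T /= hy; case: (y ord_max) => /= kw.
- by move=> /negP h /kw hC; apply: h; apply/eqP/asboolP.
- by move=> h; apply/kw; move: h; case: asboolP.
- by move=> h; apply/negP => /eqP /asboolP /kw.
- by move=> /kw h; apply/negP => /eqP; case: asboolP.
Qed.

(** The probability is taken twice, once with the new label flipped in the sum over [y]: each [y]
    then contributes the errors under both labels. *)
Lemma cyl_error_prob t : (P (cyl_error t) + P (cyl_error t) =
  \sum_y (2^-1 ^+ n.+1)%:E * (gamma [set z | ~ A y (fun p => z p + drift th (e y) 1 t p)%R] +
     gamma [set z | A y (fun p => z p + drift th (e y) (-1) t p)%R]))%E.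
Proof.
have PE : (P (cyl_error t) = \sum_y (2^-1 ^+ n.+1)%:E * gamma (T t y (y ord_max)))%E.
  rewrite prob_label_cells//; apply: eq_bigr => y _.
  by rewrite error_cell prob_noise_label_cell.
have PE' : (P (cyl_error t) = \sum_y (2^-1 ^+ n.+1)%:E * gamma (T t y (~~ y ord_max)))%E.
  rewrite PE (reindex_inj (inv_inj (@flipK n.+1 ord_max)))/=.
  by apply: eq_bigr => y _; rewrite T_flip ffunE eqxx.
rewrite {1}PE PE' -big_split/=; apply: eq_bigr => y _.
rewrite -muleDr ?ge0_adde_def ?inE//; congr (_ * _)%E; rewrite /T.
by case: (y ord_max) => //=; rewrite addeC.
Qed.

(** [cube_risk_ge] holds for every vector of signs [e y], and the [2^(n+1)] label vectors have equal
    weight, so the bound survives the average. *)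
Lemma sum_cyl_error_ge (Delta rho eta delta2 kappa : R) :
  0 < Delta -> 0 <= eta -> eta <= Delta ^+ 2 / 8 -> 0 < rho ->
  rho ^+ 2 = Delta ^+ 2 / 4 + delta2 * N%:R -> 0 <= delta2 ->
  n%:R * (4 * delta2) <= kappa ->
  (forall t, dot s (th t) (th t) <= rho ^+ 2) ->
  (forall t, rho ^+ 2 - eta <= dot s (th t) (th t)) ->
  (forall t t', dot s (fun k => th t k - th t' k) (fun k => th t k - th t' k)
     <= 4 * delta2 * hamming R t t') ->
  (forall t t', 4 * delta2 * hamming R t t' - eta <=
     dot s (fun k => th t k - th t' k) (fun k => th t k - th t' k)) ->
  ((2 * \sum_t normal_tail (Num.sqrt (dot s (th t) (th t))) +
    #|cube N|%:R * (normal_pdf 0 1 rho * delta2 * N%:R / (rho * (1 + expR kappa)) -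
                    2 * (eta * (4 / Delta + 1))))%:E <=
   \sum_t (P (cyl_error t) + P (cyl_error t)))%E.
Proof.
move=> D0 eta0 etaD rho0 rhoE d0 kap nle nge dle dge.
rewrite [X in (_ <= X)%E](eq_bigr _ (fun t _ => cyl_error_prob t)).
rewrite exchange_big/=.
set X := (2 * _ + _)%R.
have c0 : (0 <= (2^-1 ^+ n.+1 : R)%:E)%E by rewrite lee_fin exprn_ge0.
have -> : (X%:E = \sum_(y : cube n.+1) (2^-1 ^+ n.+1)%:E * X%:E)%E.
  rewrite sumEFin sumr_const; congr (_%:E).
  rewrite card_ffun card_bool card_ord -[RHS]mulr_natr natrX exprVn.
  by rewrite mulrAC mulVf ?mul1r// expf_neq0.
apply: lee_sum => y _.
have e2 i : e y i ^+ 2 = 1 by exact: label_sign2.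
have := cube_risk_ge (mesh_sd_neq0 R m) (@gaussian_noise _ _ _ _ _ _ _ PWY m) e2 D0 eta0 etaD rho0 rhoE
  d0 kap nle nge dle dge (mA y).
move=> h; rewrite -ge0_sume_distrr; last by move=> t _; rewrite adde_ge0.
exact: lee_wpmul2l.
Qed.

End cube_family.

(** * A linear rule bounding the Bayes risk from above *)

Section linear_classifier.
Variable f : R -> R.
Hypothesis fL2 : L2 f.
Local Notation th := (increments (m := m) f).
Hypothesis th0 : 0 < dot s th th.

(** The likelihood-ratio rule between [f] and [- f] on the grid; it reads only the new
    trajectory. *)
Definition linear_classifier (x : Data) : bool :=
  0 < dot s th (fun k => x.2 (grid R m k.+1) - x.2 (grid R m k)).

Lemma linear_classifierP : is_classifier linear_classifier.
Proof.
pose T := g_sigma_algebraType (@data_gen R n).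
have mv t : 0 <= t <= 1 -> measurable_fun setT (fun x : T => (x : Data).2 t : R).
  move=> t01 _ B mB; rewrite setTI; apply: sub_sigma_algebra.
  by right; right; exists t, B.
have ml : measurable_fun setT (fun x : T =>
    dot s th (fun k => (x : Data).2 (grid R m k.+1) - (x : Data).2 (grid R m k))).
  apply: measurable_funM => //; apply: measurable_sum => k.
  apply: measurable_funM => //; apply: measurable_funB; apply: mv.
    by rewrite grid_ge0 grid_le1.
  by rewrite grid_ge0 grid_le1// ltnW.
have mpos : measurable ((fun x : T => dot s th (fun k => (x : Data).2 (grid R m k.+1)
    - (x : Data).2 (grid R m k))) @^-1` `]0, +oo[%classic).
  by rewrite -[X in measurable X]setTI; apply: ml => //; exact: measurable_itv.
case.
  have -> : linear_classifier @^-1` [set true] = ((fun x : T => dot s th (fun k =>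
      (x : Data).2 (grid R m k.+1) - (x : Data).2 (grid R m k))) @^-1` `]0, +oo[%classic).
    by apply/seteqP; split=> x /=; rewrite in_itv/= andbT.
  exact: mpos.
have -> : linear_classifier @^-1` [set false] = ~` ((fun x : T => dot s th (fun k =>
    (x : Data).2 (grid R m k.+1) - (x : Data).2 (grid R m k))) @^-1` `]0, +oo[%classic).
  apply/seteqP; split=> x /=; rewrite in_itv/= andbT /linear_classifier.
    by move=> ->.
  by move/negP/negPf.
exact: (@measurableC _ T).
Qed.

Let gammaP := @gaussian_noise _ _ _ _ _ _ _ PWY m.

Let half (v : 'I_K -> R) (b : bool) : 0 < dot s v v ->
  (gamma [set z : array | [set` Interval -oo%O (BSide b (0%R : R))]
      (dot s (new_part v) (fun p => z p + new_part v p)%R)] =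
   (normal_tail (Num.sqrt (dot s v v)))%:E)%E.
Proof.
move=> v0.
pose B : set array := [set z : array | [set` Interval -oo%O (BSide b (0 : R))]
  (dot s (new_part v) z)].
have mB : measurable B.
  rewrite -[X in measurable X]setTI.
  by apply: (@measurable_dot R _ s (new_part v)) => //; exact: measurable_itv.
have := measure_shift (mesh_sd_neq0 R m) gammaP (new_part v) mB.
move=> h; apply: etrans h _.
have := integral_halfspace (mesh_sd_neq0 R m) gammaP (measurable_cst (1 : R))
  (fun=> ler01) (fun _ _ => erefl) v b v0.
have -> : (\int[gamma]_z (cst (1 : R) z)%:E = 1)%E.
  by rewrite (eq_integral (cst 1%E))// integral_cst// [X in (_ * X)%E](probability_setT gamma) mule1.
rewrite mul1e => h.
have -> : Num.sqrt (dot s v v) = dot s v v / Num.sqrt (dot s v v).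
  by rewrite -{2}(sqr_sqrtr (ltW v0)) expr2 mulfK// gt_eqF// sqrtr_gt0//.
by rewrite -h; apply: eq_integral => z _; rewrite mul1r; congr ((_ * _)%:E).
Qed.

(** An error puts the noise in a half space opposite to the drift, closed for the label [true] and
    open for [false] since ties are answered [false]. Each label has probability one half. *)
Lemma linear_classifier_risk :
  (risk P W Y f (fun x => - f x)%R linear_classifier <=
   (normal_tail (Num.sqrt (dot s th th)))%:E)%E.
Proof.
pose nth k := -1 * th k.
have nth0 : dot s nth nth = dot s th th by rewrite dotZl dotZr mulrA mulN1r opprK mul1r.
pose v (b : bool) := if b then th else nth.
have v0 b : 0 < dot s (v b) (v b) by case: b; rewrite /v ?nth0.
have vE b : dot s (v b) (v b) = dot s th th by case: b.
pose S b : set array := [set z : array | [set` Interval -oo%O (BSide (~~ b) (0 : R))]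
      (dot s (new_part (v b)) (fun p => z p + new_part (v b) p))].
have mS b : measurable (S b).
  have mf : measurable_fun setT (fun z : array =>
      dot s (new_part (v b)) (fun p => z p + new_part (v b) p)).
    apply: (measurableT_comp (measurable_dot s (new_part (v b)))).
    exact: measurable_shift.
  by rewrite -[X in measurable X]setTI; apply: mf => //; exact: measurable_itv.
pose C b i : set Omega := if i == ord_max then [set w | Y i w = b] else setT.
have hC b i : @label_event R n d Omega Y i (C b i).
  rewrite /C; case: ifP => _; [exact: label_event_eq|exact: label_eventT].
have PS b : (P ([set w | S b (Z w)] `&` [set w | forall i, C b i w]) =
    (normal_tail (Num.sqrt (dot s th th)) / 2)%:E)%E.
  rewrite (noise_labels PWY (mS b) (hC b)).
  have -> : (gamma (S b) = (normal_tail (Num.sqrt (dot s th th)))%:E)%E.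
    by rewrite -(vE b); exact: half.
  rewrite (bigD1 ord_max)//= [X in (_ * (_ * X))%E]big1 ?mule1.
    by rewrite {1}/C eqxx (prob_label PWY).
  by move=> i /negPf im; rewrite /C im probability_setT.
have mE b : measurable ([set w | S b (Z w)] `&` [set w | forall i, C b i w]).
  apply: measurableI.
    by have := measurable_noise PWY measurableT (mS b); rewrite setTI.
  have -> : [set w | forall i, C b i w] = [set w | Y ord_max w = b].
    apply/seteqP; split=> w h /=; first by have := h ord_max; rewrite /C eqxx.
    by move=> i; rewrite /C; case: eqP => [->|].
  exact: model_measurable_label_eq PWY _ _.
have mD b : measurable (sym_data f @^-1` (linear_classifier @^-1` [set b])).
  apply: measurable_preimage_smallest (linear_classifierP b) => B gB.
  exact: sym_data_measurable.
have sub : [set w | linear_classifier (data_of W Y f (fun x => - f x) w) != Y ord_max w] `<=`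
    ([set w | S true (Z w)] `&` [set w | forall i, C true i w]) `|`
    ([set w | S false (Z w)] `&` [set w | forall i, C false i w]).
  move=> w /=.
  have -> : linear_classifier (data_of W Y f (fun x => - f x) w) =
      (0 < dot s (new_part th) (Z w) + label_sign (Y ord_max w) * dot s th th).
    rewrite /linear_classifier/= dot_newl -dotZr -dotDr; congr (0 < dot s _ _).
    apply/funext => k; rewrite !path_of_sym//; [|by apply: grid_le1; rewrite ltnW|exact: grid_le1].
    by rewrite /noise /increments/=; ring.
  case Yw : (Y ord_max w) => /=.
    rewrite mul1r eqb_id -leNgt => h; left; split.
      by rewrite /S /v /= in_itv/= dotDr dot_new.
    by move=> i; rewrite /C; case: eqP => [->|].
  rewrite eqbF_neg negbK mulN1r => h; right; split.
    rewrite /S /v /= in_itv/= dotDr dot_new nth0 new_partZ dotZl mulN1r.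
    by move: h; lra.
  by move=> i; rewrite /C; case: eqP => [->|].
apply: (@le_trans _ _ (P (([set w | S true (Z w)] `&` [set w | forall i, C true i w]) `|`
    ([set w | S false (Z w)] `&` [set w | forall i, C false i w])))).
  apply: le_measure => //; rewrite inE; last exact: measurableU.
  have -> : [set w | linear_classifier (data_of W Y f (fun x => - f x) w) != Y ord_max w] =
     (sym_data f @^-1` (linear_classifier @^-1` [set true]) `&` ~` [set w | Y ord_max w]) `|`
     (sym_data f @^-1` (linear_classifier @^-1` [set false]) `&` [set w | Y ord_max w]).
    apply/seteqP; split=> w; rewrite /sym_data /=; case: (linear_classifier _);
      case: (Y ord_max w) => //=; first [by left; split|by right; split|by case=> -[_] // /(_ isT)|by case=> -[]].
  apply: measurableU; apply: measurableI => //; last exact: model_measurable_label PWY _.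
  by apply: measurableC; exact: model_measurable_label PWY _.
apply: le_trans (measureU2 _ (mE true) (mE false)) _.
rewrite [X in (X + _)%E]PS [X in (_ + X)%E]PS -EFinD lee_fin; lra.
Qed.

End linear_classifier.

End level.

End model_risk.

(** * The hypercube in the Sobolev ball *)

Section cube_functions.
Context (R : realType) (phi : nat -> R -> R).
Hypothesis phiP : ONB phi.
Variables (N : nat) (Delta delta : R).

Definition cube_coef (t : cube N) (j : 'I_N.+1) : R :=
  oapp (fun i => label_sign R (t i) * delta) (Delta / 2) (unlift ord0 j).

Definition cube_fun (t : cube N) : R -> R := comb phi (cube_coef t).

Let coef0 t : cube_coef t ord0 = Delta / 2.
Proof. by rewrite /cube_coef unlift_none. Qed.

Let coefS t i : cube_coef t (lift ord0 i) = label_sign R (t i) * delta.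
Proof. by rewrite /cube_coef liftK. Qed.

Lemma L2_cube_fun t : L2 (cube_fun t). Proof. exact: L2_comb. Qed.

(** Stated for general weights: [w = 1] gives the L2 norm, and [w j = (j + 1)^(2s)] the Sobolev
    sum. *)
Lemma sum_cube_coef t (w : nat -> R) :
  \sum_(j < N.+1) cube_coef t j ^+ 2 * w j =
  Delta ^+ 2 / 4 * w 0%N + delta ^+ 2 * \sum_(i < N) w i.+1.
Proof.
rewrite big_ord_recl coef0 mulr_sumr; congr (_ + _); first by field.
apply: eq_bigr => i _; rewrite coefS exprMn label_sign2 mul1r.
by rewrite -[in LHS]/(bump 0 i).
Qed.

Lemma ip_cube_fun t :
  ip (cube_fun t) (cube_fun t) = Delta ^+ 2 / 4 + delta ^+ 2 * N%:R.
Proof.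
rewrite ip_comb// -[LHS](eq_bigr _ (fun j _ => mulr1 _)).
rewrite (eq_bigr (fun j => cube_coef t j ^+ 2 * (fun=> 1) (j : nat))); last first.
  by move=> j _; rewrite expr2.
by rewrite (sum_cube_coef t (fun=> 1)) mulr1 sumr_const card_ord.
Qed.

Lemma ip_cube_funB t t' :
  ip (fun x => cube_fun t x - cube_fun t' x) (fun x => cube_fun t x - cube_fun t' x) =
  4 * delta ^+ 2 * hamming R t t'.
Proof.
rewrite combB ip_comb// big_ord_recl !coef0 subrr mul0r add0r /hamming mulr_sumr.
apply: eq_bigr => i _; rewrite !coefS /label_sign.
by case: (t i); case: (t' i) => /=; ring.
Qed.

Lemma L2norm_cube_fun t : 0 <= Delta ->
  Delta <= L2norm (cube_fun t \- (fun x => - cube_fun t x)).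
Proof.
move=> D0.
have -> : cube_fun t \- (fun x => - cube_fun t x) = comb phi (fun j => 2 * cube_coef t j).
  apply/funext => x; rewrite /cube_fun /comb /= opprK -big_split/=; apply: eq_bigr => j _.
  by ring.
rewrite /L2norm ip_comb// (eq_bigr (fun j => 4 * (cube_coef t j * cube_coef t j))); last first.
  by move=> j _; ring.
rewrite -mulr_sumr -(ip_comb phiP) -/(cube_fun t) ip_cube_fun.
rewrite -[leLHS](ger0_norm D0) -sqrtr_sqr ler_wsqrtr// mulrDr.
have : 0 <= delta ^+ 2 * N%:R by rewrite mulr_ge0 ?sqr_ge0.
by lra.
Qed.

(** The first Sobolev weight is 1, and the others are bounded by the largest, at index [N + 1]. *)
Lemma Hs_cube_fun t (s Rad : R) : 0 <= s ->
  Delta ^+ 2 / 4 + delta ^+ 2 * (N%:R * N.+1%:R `^ (2 * s)) <= Rad ^+ 2 ->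
  Hs phi s Rad (cube_fun t) /\ Hs phi s Rad (fun x => - cube_fun t x).
Proof.
move=> s0 h.
have h2 : \sum_(j < N.+1) cube_coef t j ^+ 2 * j.+1%:R `^ (2 * s) <= Rad ^+ 2.
  apply: le_trans h; rewrite (sum_cube_coef t (fun j => j.+1%:R `^ (2 * s))).
  rewrite powR1 mulr1 lerD2l ler_wpM2l ?sqr_ge0//.
  apply: (@le_trans _ _ (\sum_(i < N) N.+1%:R `^ (2 * s))); last first.
    by rewrite sumr_const card_ord -[leLHS]mulr_natl.
  apply: ler_sum => i _; apply: ge0_ler_powR; rewrite ?nnegrE ?mulr_ge0//.
  by rewrite ler_nat ltnS.
split; first exact: Hs_comb.
rewrite combN; apply: Hs_comb => //; apply: le_trans h2.
by apply: ler_sum => j _; rewrite sqrrN.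
Qed.

End cube_functions.

(** * Existence of an unfavourable parameter *)

Section excess_risk.
Context (R : realType) (phi : nat -> R -> R).
Hypothesis phiP : ONB phi.
Context (n : nat) d (Omega : measurableType d) (P : probability Omega R).
Variables (W : 'I_n.+1 -> Omega -> R -> R) (Y : 'I_n.+1 -> Omega -> bool).
Hypothesis PWY : model P W Y.
Variable Phihat : @Data R n -> bool.
Hypothesis hPhi : is_classifier Phihat.
Variables (N : nat) (Delta delta rho : R).
Hypotheses (Delta0 : 0 < Delta) (rho0 : 0 < rho).
Hypothesis rhoE : rho ^+ 2 = Delta ^+ 2 / 4 + delta ^+ 2 * N%:R.
Hypothesis ndelta : n%:R * delta ^+ 2 <= 1.

Local Notation F := (@cube_fun R phi N Delta delta).
Local Notation bayes t := (ereal_inf [set risk P W Y (F t) (fun x => - F t x)%R Psi |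
   Psi in @is_classifier R n]).
(** The tail gap [pdf * delta^2 * N / rho] times the disagreement [1 / (1 + expR 4)], a flip having
    squared length [4 * delta^2 <= 4 / n]. *)
Let gap := normal_pdf 0 1 rho * delta ^+ 2 * N%:R / (rho * (1 + expR 4)).

Let FL2 t : L2 (F t). Proof. exact: L2_cube_fun. Qed.

(** If the risk exceeded the tail of the linear rule by less than [gap / 4] for every parameter,
    summing over the cube would contradict [sum_cyl_error_ge]; the Bayes risk is at most that
    tail. *)
Lemma exists_excess_risk : 0 < gap -> exists t : cube N,
  ((gap / 4)%:E <= risk P W Y (F t) (fun x => - F t x)%R Phihat - bayes t)%E.
Proof.
move=> gap0.
(* The first bound keeps [f_t + f_t'] away from zero on the grid. The second pays for
   discretisation, [4 / Delta + 1], and for replacing the classifier by a cylinder, one more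
   [eta]. *)
pose eta := Num.min (Delta ^+ 2 / 8) (gap / 4 / (4 / Delta + 2)).
have D2 : 0 < 4 / Delta + 2 by rewrite addr_gt0// divr_gt0.
have eta0 : 0 < eta.
  rewrite lt_min; apply/andP; split; last by apply: divr_gt0 => //; exact: divr_gt0.
  by rewrite divr_gt0// exprn_gt0.
have etaD : eta <= Delta ^+ 2 / 8 by rewrite ge_min lexx.
have etag : eta * (4 / Delta + 2) <= gap / 4.
  by rewrite -ler_pdivlMr// ge_min lexx orbT.
pose D t := sym_data W Y (F t).
have mD A : data_gen A -> forall t, measurable (D t @^-1` A).
  by move=> gA t; apply: (sym_data_measurable PWY) => //; exact: FL2.
have c1 t w i : {within `[(0:R), 1]%classic, continuous ((D t w).1 i).1}.
  by apply: (path_of_sym_continuous PWY); exact: FL2.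
have c2 t w : {within `[(0:R), 1]%classic, continuous (D t w).2}.
  by apply: (path_of_sym_continuous PWY); exact: FL2.
have [mA /(_ _ eta0)[m0 [C [cC0 hC]]]] :=
  cylinder_approximation P mD c1 c2 (hPhi true).
have near1 : \forall m \near \oo, forall t, ip (F t) (F t) - eta <= grid_norm2 m (F t).
  by apply: filter_forall => t; apply: grid_norm2_ge => //; exact: FL2.
have FB (u : cube N * cube N) : L2 (fun x => F u.1 x - F u.2 x).
  by rewrite combB; exact: L2_comb.
have near2 : \forall m \near \oo, forall u : cube N * cube N,
    ip (fun x => F u.1 x - F u.2 x) (fun x => F u.1 x - F u.2 x) - eta
      <= grid_norm2 m (fun x => F u.1 x - F u.2 x).
  by apply: filter_forall => u; apply: grid_norm2_ge => //; exact: FB.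
(* A level fine enough for the norms, the differences and the cylinder, uniformly over the finite
   cube. *)
have [m [[nm1 nm2] m0m]] : exists m, ((forall t, ip (F t) (F t) - eta <= grid_norm2 m (F t)) /\
    (forall u : cube N * cube N, ip (fun x => F u.1 x - F u.2 x) (fun x => F u.1 x - F u.2 x) - eta
       <= grid_norm2 m (fun x => F u.1 x - F u.2 x))) /\ (m0 <= m)%N.
  have near3 : \forall m \near \oo, (m0 <= m)%N by exists m0.
  have [M _ hM] := filterI (filterI near1 near2) near3.
  by exists M; have [[]] := hM M (leqnn M).
have cC := cylinder_le m0m cC0.
pose th t : 'I_(2 ^ m) -> R := increments (F t).
have dotE f : dot (mesh_sd R m) (increments (m := m) f) (increments f) = grid_norm2 m f.
  by rewrite /dot mesh_sd2 invrK /grid_norm2 [LHS]mulrC; congr (_ * _).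
have thB t t' : (fun k => th t k - th t' k) = increments (m := m) (fun x => F t x - F t' x).
  by apply/funext => k; rewrite /th incrementsB.
have ipF t : ip (F t) (F t) = rho ^+ 2 by rewrite ip_cube_fun// rhoE.
have nle t : dot (mesh_sd R m) (th t) (th t) <= rho ^+ 2.
  by rewrite dotE -(ipF t); exact: grid_norm2_le.
have nge t : rho ^+ 2 - eta <= dot (mesh_sd R m) (th t) (th t).
  by rewrite dotE -(ipF t); exact: nm1.
have dle t t' : dot (mesh_sd R m) (fun k => th t k - th t' k) (fun k => th t k - th t' k)
    <= 4 * delta ^+ 2 * hamming R t t'.
  by rewrite thB dotE -(ip_cube_funB phiP Delta); apply: grid_norm2_le; exact: (FB (t, t')).
have dge t t' : 4 * delta ^+ 2 * hamming R t t' - eta <=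
    dot (mesh_sd R m) (fun k => th t k - th t' k) (fun k => th t k - th t' k).
  by rewrite thB dotE -(ip_cube_funB phiP Delta); exact: (nm2 (t, t')).
have mC t : measurable (D t @^-1` C).
  by apply: measurable_preimage_smallest (cylinder_data_gen cC) => B gB; exact: mD.
have mYm := model_measurable_label PWY ord_max.
have merr (Q : Data n -> bool) t : measurable (D t @^-1` (Q @^-1` [set true])) ->
    measurable [set w | Q (D t w) != Y ord_max w].
  move=> mQ.
  have -> : [set w | Q (D t w) != Y ord_max w] =
      symdiff (D t @^-1` (Q @^-1` [set true])) [set w | Y ord_max w].
    apply/seteqP; split=> w; rewrite /symdiff /=; case: (Q _); case: (Y ord_max w) => //=.
    - by move=> _; left; split.
    - by move=> _; right; split.
    - by case=> -[].
    - by case=> -[].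
  by apply: measurableU; exact: measurableD.
have mE t : measurable (cyl_error W Y F C t).
  apply: (merr (fun x => `[< C x >])).
  rewrite (_ : _ @^-1` _ = D t @^-1` C)//; apply/seteqP; split=> w /=; by move/asboolP.
have mR t : measurable [set w | Phihat (D t w) != Y ord_max w] by exact: merr.
have s4 : n%:R * (4 * delta ^+ 2) <= 4 by move: ndelta; lra.
have main := sum_cyl_error_ge PWY FL2 cC mE Delta0 (ltW eta0) etaD rho0 rhoE (sqr_ge0 delta)
  s4 nle nge dle dge.
pose a t := fine (risk P W Y (F t) (fun x => - F t x) Phihat).
have aE t : (risk P W Y (F t) (fun x => - F t x)%R Phihat = (a t)%:E)%E.
  by rewrite fineK//; apply: fin_num_measure; exact: mR.
pose p t := fine (P (cyl_error W Y F C t)).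
have pE t : (P (cyl_error W Y F C t) = (p t)%:E)%E by rewrite fineK//; exact: fin_num_measure.
(* An error of the cylinder rule is an error of [Phihat] or a point where the two rules differ. *)
have pa t : p t <= a t + eta.
  rewrite -lee_fin EFinD -pE -aE.
  have mSD : measurable (symdiff (D t @^-1` (Phihat @^-1` [set true])) (D t @^-1` C)).
    by apply: measurableU; apply: measurableD.
  apply: le_trans (leeD (lexx _) (hC t)).
  apply: le_trans (measureU2 _ (mR t) mSD).
  apply: le_measure; rewrite ?inE//; first exact: measurableU.
  move=> w; rewrite /cyl_error /symdiff => h.
  have [e|e] := eqVneq (Phihat (D t w)) `[< C (D t w) >].
    by left; change (Phihat (D t w) != Y ord_max w); rewrite e.
  right; move: e; case: asboolP => hw; case E : (Phihat (D t w)) => // _.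
    by right; split => //=; rewrite E.
  by left; split.
have nth0 t : 0 < dot (mesh_sd R m) (th t) (th t).
  have := nge t; move: etaD rhoE; have : 0 < Delta ^+ 2 by rewrite exprn_gt0.
  have : 0 <= delta ^+ 2 * N%:R by rewrite mulr_ge0 ?sqr_ge0.
  lra.
pose T t := normal_tail (Num.sqrt (dot (mesh_sd R m) (th t) (th t))).
have bT t : (bayes t <= (T t)%:E)%E.
  apply: le_trans (linear_classifier_risk PWY (FL2 t) (nth0 t)).
  by apply: ereal_inf_lbound; exists (linear_classifier m (F t)) => //;
     exact: linear_classifierP.
have b0 t : (0 <= bayes t)%E.
  by apply: le_ereal_inf_tmp => _ [Psi _ <-]; exact: measure_ge0.
have M0 : (0 < #|cube N|)%N by apply/card_gt0P; exists [ffun=> true].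
have main' : 2 * \sum_t T t + #|cube N|%:R * (gap - 2 * (eta * (4 / Delta + 1))) <=
    2 * \sum_t (a t + eta).
  apply: (@le_trans _ _ (2 * \sum_t p t)); last first.
    by rewrite ler_pM2l//; apply: ler_sum.
  rewrite -lee_fin; apply: le_trans main _.
  rewrite (eq_bigr (fun t => (p t + p t)%:E)); last by move=> t _; rewrite EFinD pE.
  by rewrite sumEFin lee_fin big_split/= mulr2n mulrDl mul1r.
have [t ht] : exists t, gap / 4 <= a t - T t.
  apply: contrapT => /forallNP nex.
  have lt t : a t < T t + gap / 4 by have /negP := nex t; rewrite -ltNge; lra.
  have sl : \sum_t a t < \sum_t (T t + gap / 4).
    by apply: ltr_sum => //; apply/hasP; exists [ffun=> true]; rewrite ?mem_index_enum.
  have sE (c : R) : \sum_(t : cube N) c = #|cube N|%:R * c by rewrite sumr_const -[LHS]mulr_natl.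
  have h1 : #|cube N|%:R * (eta * (4 / Delta + 2)) <= #|cube N|%:R * (gap / 4).
    by rewrite ler_wpM2l.
  move: main' sl; rewrite !big_split/= !sE.
  have -> : #|cube N|%:R * (gap - 2 * (eta * (4 / Delta + 1))) =
    4 * (#|cube N|%:R * (gap / 4)) - 2 * (#|cube N|%:R * (eta * (4 / Delta + 2)))
    + 2 * (#|cube N|%:R * eta) by field; rewrite gt_eqF.
  move: h1; set u1 := _ * (eta * _); set u2 := _ * (gap / 4); set u3 := _ * eta.
  by set S1 := \sum_t T t; set S2 := \sum_t a t; lra.
exists t; apply: (@le_trans _ _ (a t - T t)%:E); first by rewrite lee_fin.
by rewrite aE EFinB leeB.
Qed.

End excess_risk.

(** * Rates *)

Section rates.
Context (R : realType) (s Rad : R) (n : nat).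
Hypotheses (s0 : 0 < s) (Rad0 : 0 < Rad).
Hypothesis hn : Num.max (Rad `^ s^-1)
  ((32 * ln 2 + 2) `^ (2 * s + 1) / (3 * Rad ^+ 2 / 4)) <= n%:R.

Let q := (2 * s + 1)^-1.

Definition minimax_rate : R := Rad `^ (2 * s + 1)^-1 * n%:R `^ (- (s / (2 * s + 1))).
Local Notation r := minimax_rate.

Let t0 : 0 < 2 * s + 1. Proof. by move: s0; lra. Qed.
Let q0 : 0 < q. Proof. by rewrite invr_gt0. Qed.
Let q1 : q <= 1. Proof. by rewrite invf_le1//; move: s0; lra. Qed.
Let sq : 1 - 2 * (s * q) = q. Proof. by rewrite /q; field; rewrite gt_eqF. Qed.

Lemma sample_size_gt0 : 0 < n%:R :> R.
Proof. by move: hn; rewrite ge_max => /andP[h _]; apply: lt_le_trans h; exact: powR_gt0. Qed.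

Let n0 := sample_size_gt0.

Lemma minimax_rate_gt0 : 0 < r.
Proof. by rewrite mulr_gt0// powR_gt0. Qed.

Lemma minimax_rate2 : r ^+ 2 = Rad `^ (2 / (2 * s + 1)) * n%:R `^ (- (2 * s / (2 * s + 1))).
Proof.
rewrite exprMn -!powR_mulrn ?powR_ge0// -!powRrM.
by congr (_ `^ _ * _ `^ _); field; rewrite gt_eqF.
Qed.

(** The condition [Rad^(1/s) <= n], raised to the power [s / (2s + 1)]. *)
Lemma minimax_rate_le1 : r <= 1.
Proof.
move: hn; rewrite ge_max => /andP[h _].
have h1 : Rad `^ q <= n%:R `^ (s * q).
  have -> : Rad `^ q = (Rad `^ s^-1) `^ (s * q).
    by rewrite -powRrM; congr (_ `^ _); field; rewrite gt_eqF.
  by apply: ge0_ler_powR; rewrite ?nnegrE ?powR_ge0// mulr_ge0 ?ltW.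
rewrite /minimax_rate -/q powRN ler_pdivrMr ?powR_gt0// mul1r.
by apply: le_trans h1 _; rewrite /q.
Qed.

(** The solution of [x^(2s+1) / n = 3 * Rad^2 / 4]: the number of coordinates of amplitude
    [n^(-1/2)] that fit in the ball when a quarter of [Rad^2] is reserved for the first
    coordinate. *)
Definition effective_dim : R := (3 * Rad ^+ 2 / 4 * n%:R) `^ (2 * s + 1)^-1.
Local Notation x := effective_dim.

Let Rad2 : 0 < Rad ^+ 2. Proof. by rewrite exprn_gt0. Qed.
Let y0 : 0 < 3 * Rad ^+ 2 / 4 * n%:R.
Proof. by rewrite mulr_gt0// divr_gt0// mulr_gt0. Qed.

Lemma ln2_ge : 2^-1 <= ln 2 :> R.
Proof.
rewrite -[leLHS]expRK ler_ln ?posrE ?expR_gt0// -[leRHS]invrK -[leLHS]invrK.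
rewrite lef_pV2 ?posrE ?invr_gt0 ?expR_gt0// -expRN.
by apply: le_trans (expR_ge1Dx _); lra.
Qed.

(** The second lower bound on [n] says that the dimension is at least [32 * ln 2 + 2], and
    [ln 2 >= 1 / 2]. *)
Lemma effective_dim_ge4 : 4 <= x.
Proof.
move: hn; rewrite ge_max => /andP[_ h].
have L0 : 0 <= 32 * ln 2 + 2 :> R by have := ln2_ge; lra.
have h1 : (32 * ln 2 + 2) `^ (2 * s + 1) <= 3 * Rad ^+ 2 / 4 * n%:R.
  have p34 : 0 < 3 * Rad ^+ 2 / 4 by rewrite divr_gt0// mulr_gt0.
  by rewrite [leRHS]mulrC -ler_pdivrMr.
have : 32 * ln 2 + 2 <= x.
  have -> : 32 * ln 2 + 2 = ((32 * ln 2 + 2) `^ (2 * s + 1)) `^ (2 * s + 1)^-1 :> R.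
    by rewrite -powRrM mulfV ?gt_eqF// powRr1.
  by apply: ge0_ler_powR; rewrite ?nnegrE ?powR_ge0// ltW.
by have := ln2_ge; lra.
Qed.

(** Since [1 - 2s / (2s + 1) = 1 / (2s + 1)], the dimension is [n * r^2] up to a factor in
    [[3/4, 1]]. *)
Lemma effective_dimE : x = (3 / 4) `^ q * (n%:R * r ^+ 2).
Proof.
rewrite /effective_dim -/q.
have -> : 3 * Rad ^+ 2 / 4 * n%:R = 3 / 4 * (Rad ^+ 2 * n%:R) by ring.
have h1 : 0 <= (3 / 4 : R) by lra.
have h2 : 0 <= Rad ^+ 2 * n%:R by rewrite mulr_ge0 ?sqr_ge0.
rewrite (powRM _ h1 h2); congr (_ * _).
rewrite powRM ?sqr_ge0// -powR_mulrn ?(ltW Rad0)// -powRrM minimax_rate2.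
rewrite mulrCA; congr (_ `^ _ * _).
rewrite -{2}(powRr1 (ltW n0)) -powRD; last by apply/implyP => _; rewrite gt_eqF.
by congr (_ `^ _); rewrite -[LHS]sq /q; field; rewrite gt_eqF.
Qed.

Let c34 : 3 / 4 <= (3 / 4 : R) `^ q <= 1.
Proof.
have h : 0 < (3 / 4 : R) <= 1 by apply/andP; split; lra.
apply/andP; split.
  have := ger_powR h q1; rewrite powRr1//; lra.
have := ger_powR h (ltW q0); rewrite powRr0//.
Qed.

(** One is subtracted because the signed coordinates have indices 2 to [N + 1], and the largest must
    not exceed the effective dimension. *)
Definition cube_dim : nat := (Num.truncn x).-1.
Local Notation N := cube_dim.

Lemma cube_dim_le : N.+1%:R <= x.
Proof.
have x0 : 0 <= x by exact: powR_ge0.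
have /andP[h1 h2] := truncn_itv x0.
rewrite /N prednK//.
by rewrite truncn_gt0 (le_trans _ effective_dim_ge4)//; lra.
Qed.

Lemma cube_dim_ge : x / 2 <= N%:R.
Proof.
have x0 : 0 <= x by exact: powR_ge0.
have /andP[h1 h2] := truncn_itv x0.
have D0 : (0 < Num.truncn x)%N.
  by rewrite truncn_gt0 (le_trans _ effective_dim_ge4)//; lra.
move: h2; rewrite -natr1 -(prednK D0) -/N -natr1.
by have := effective_dim_ge4; lra.
Qed.

(** [3 / 8] is the lower bound [3 / 4] of [(3 / 4)^q], halved by the rounding of the dimension. *)
Lemma cube_dim_rate : 3 / 8 * r ^+ 2 <= N%:R / n%:R <= r ^+ 2.
Proof.
have /andP[c1 c2] := c34.
have nr : 0 < n%:R * r ^+ 2 by rewrite mulr_gt0// exprn_gt0// minimax_rate_gt0.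
apply/andP; split.
  rewrite ler_pdivlMr//; apply: le_trans cube_dim_ge; rewrite effective_dimE.
  have : 3 / 4 * (n%:R * r ^+ 2) <= (3 / 4) `^ q * (n%:R * r ^+ 2).
    by rewrite ler_wpM2r// ltW.
  by lra.
rewrite ler_pdivrMr//; apply: (@le_trans _ _ x).
  by apply: le_trans cube_dim_le; rewrite ler_nat.
rewrite effective_dimE [leRHS]mulrC ler_piMl// ltW//.
Qed.

Lemma cube_dim_smooth :
  N%:R * N.+1%:R `^ (2 * s) / n%:R <= 3 * Rad ^+ 2 / 4.
Proof.
rewrite ler_pdivrMr//; apply: (@le_trans _ _ (x * x `^ (2 * s))).
  apply: ler_pM; [exact: ler0n|exact: powR_ge0| |].
    by apply: le_trans cube_dim_le; rewrite ler_nat.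
  apply: ge0_ler_powR; rewrite ?nnegrE ?powR_ge0// ?cube_dim_le//.
  by rewrite mulr_ge0// ltW.
have x0 : 0 < x by exact: powR_gt0.
rewrite -{1}(powRr1 (ltW x0)) -powRD; last by apply/implyP => _; rewrite gt_eqF.
by rewrite addrC /effective_dim -powRrM mulVf ?gt_eqF// powRr1// ltW.
Qed.

End rates.

(** * The lower bound in the two regimes *)

Unset Implicit Arguments. Set Strict Implicit. Set Printing Implicit Defensive.

Theorem theorem2 (R : realType) :
  exists c : R, 0 < c /\
  forall (s Rad : R) (phi : nat -> R -> R) (n : nat) (Delta : R)
    (d : measure_display) (Omega : measurableType d) (P : probability Omega R)
    (W : 'I_n.+1 -> Omega -> R -> R) (Y : 'I_n.+1 -> Omega -> bool)
    (Phihat : Data n -> bool),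
    0 < s -> 0 < Rad -> ONB phi ->
    Num.max (Rad `^ s^-1)
            ((32 * ln 2 + 2) `^ (2 * s + 1) / (3 * Rad ^+ 2 / 4)) <= n%:R ->
    0 < Delta -> Delta <= Rad / 2 ->
    model P W Y -> is_classifier Phihat ->
    ((if Delta < Rad `^ (2 * s + 1)^-1 * n%:R `^ (- (s / (2 * s + 1)))
      then c * expR (- 2 * Rad `^ (2 / (2 * s + 1))) * Rad `^ (2 * s + 1)^-1
             * n%:R `^ (- (s / (2 * s + 1)))
      else c * expR (- 2 * Delta ^+ 2) / Delta * Rad `^ (2 / (2 * s + 1))
             * n%:R `^ (- (2 * s / (2 * s + 1))))%:E
     <= ereal_sup [set r | exists f g : R -> R,
           Hs phi s Rad f /\ Hs phi s Rad g /\ (Delta <= L2norm (f \- g))%R /\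
           r = (risk P W Y f g Phihat
                - ereal_inf [set risk P W Y f g Psi | Psi in @is_classifier R n])%E])%E.
Proof.
pose tau : R := 1 + expR 4.
have tau0 : 0 < tau by rewrite addr_gt0// expR_gt0.
pose pk : R := normal_peak 1.
have pk0 : 0 < pk by exact: normal_peak_gt0 (oner_neq0 _).
(* [64 = 8 * 4 * 2] comes from [3 / 8] in [cube_dim_rate], from [gap / 4] and from [rho <= 2 * u]
   below; [expR (-1)] bounds the Gaussian factor when [Delta < r]. *)
pose c : R := pk * expR (-1) * 3 / (64 * tau).
have c0 : 0 < c by rewrite divr_gt0 ?mulr_gt0 ?expR_gt0.
exists c; split => // s Rad phi n Delta d Omega P W Y Phihat s0 Rad0 phiP hn D0 DR PWY hPhi.
rewrite -/(minimax_rate s Rad n).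
set r := minimax_rate s Rad n.
have r0 : 0 < r by exact: minimax_rate_gt0.
have r1 : r <= 1 by exact: minimax_rate_le1.
have n0 : 0 < n%:R :> R by exact: sample_size_gt0 Rad0 hn.
pose N := cube_dim s Rad n.
have /andP[N1 N2] : 3 / 8 * r ^+ 2 <= N%:R / n%:R <= r ^+ 2 by exact: cube_dim_rate.
pose delta := Num.sqrt (n%:R^-1) : R.
have delta2 : delta ^+ 2 = n%:R^-1 by rewrite sqr_sqrtr// invr_ge0 ltW.
pose rho := Num.sqrt (Delta ^+ 2 / 4 + delta ^+ 2 * N%:R).
have dN : delta ^+ 2 * N%:R = N%:R / n%:R by rewrite delta2 mulrC.
have r20 : 0 < r ^+ 2 by rewrite exprn_gt0.
have D20 : 0 < Delta ^+ 2 by rewrite exprn_gt0.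
have rho2 : rho ^+ 2 = Delta ^+ 2 / 4 + delta ^+ 2 * N%:R.
  by rewrite sqr_sqrtr// dN; move: N1 r20 D20; lra.
have rho0 : 0 < rho by rewrite sqrtr_gt0 dN; move: N1 r20 D20; lra.
have ndelta : n%:R * delta ^+ 2 <= 1 by rewrite delta2 mulfV// gt_eqF.
pose gap := normal_pdf 0 1 rho * delta ^+ 2 * N%:R / (rho * (1 + expR 4)).
have pdfE : normal_pdf 0 1 rho = pk * expR (- (rho ^+ 2 / 2)).
  rewrite normal_pdfE ?oner_neq0// /normal_fun subr0 expr1n.
  by congr (_ * expR _); rewrite mulNr mulr2n.
(* [u] will be the larger of [r] and [Delta], so that [rho^2 <= Delta^2 / 4 + r^2 <= 5 / 4 * u^2];
   [b] is the exponential kept in the final bound. *)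
have key (u b : R) : 0 < u -> rho ^+ 2 <= (5 / 4) * u ^+ 2 -> 0 <= b ->
    b <= expR (- (rho ^+ 2 / 2)) -> pk * b * 3 / (64 * tau) * (r ^+ 2 / u) <= gap / 4.
  move=> u0 ru b0 bh.
  have ru2 : rho <= 2 * u.
    apply: le_of_sqr; first by rewrite mulr_ge0// ltW.
    by rewrite exprMn; have := sqr_ge0 u; move: ru; lra.
  have -> : gap / 4 = pk * expR (- (rho ^+ 2 / 2)) * (N%:R / n%:R) / (4 * tau) / rho.
    by rewrite /gap pdfE delta2 -/tau; field; rewrite !gt_eqF.
  have -> : pk * b * 3 / (64 * tau) * (r ^+ 2 / u) =
      pk * b * (3 / 8 * r ^+ 2) / (4 * tau) / (2 * u).
    by field; rewrite !gt_eqF.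
  apply: ler_pM.
  - apply: divr_ge0; last by rewrite mulr_ge0// ltW.
    by apply: mulr_ge0; [rewrite mulr_ge0// ltW|rewrite mulr_ge0// ltW].
  - by rewrite invr_ge0 mulr_ge0// ltW.
  - rewrite ler_pM2r ?invr_gt0 ?mulr_gt0//; apply: ler_pM => //.
    + by rewrite mulr_ge0// ltW.
    + by rewrite mulr_ge0// ltW.
    + by rewrite ler_pM2l.
  - by rewrite lef_pV2 ?posrE ?mulr_gt0.
have gap0 : 0 < gap.
  apply: divr_gt0; last exact: mulr_gt0.
  rewrite -mulrA dN; apply: mulr_gt0; last by move: N1 r20; lra.
  by rewrite pdfE mulr_gt0 ?expR_gt0.
have [t ht] := exists_excess_risk phiP PWY hPhi D0 rho0 rho2 ndelta gap0.
have smooth : Delta ^+ 2 / 4 + delta ^+ 2 * (N%:R * N.+1%:R `^ (2 * s)) <= Rad ^+ 2.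
  have h1 : delta ^+ 2 * (N%:R * N.+1%:R `^ (2 * s)) <= 3 * Rad ^+ 2 / 4.
    by rewrite delta2 mulrC; exact: cube_dim_smooth.
  have h2 : Delta ^+ 2 <= Rad ^+ 2 / 4.
    have -> : Rad ^+ 2 / 4 = (Rad / 2) ^+ 2 by field.
    by rewrite ler_sqr// nnegrE ?divr_ge0// ltW.
  by have := sqr_ge0 Rad; move: h1 h2; lra.
have [H1 H2] := Hs_cube_fun phiP t (ltW s0) smooth.
apply: (@le_trans _ _ (gap / 4)%:E); last first.
  apply: le_trans ht _; apply: ereal_sup_ubound.
  exists (cube_fun phi Delta delta t), (fun x => - cube_fun phi Delta delta t x).
  split; first exact: H1.
  split; first exact: H2.
  by split; first exact: (L2norm_cube_fun phiP delta t (ltW D0)).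
rewrite lee_fin; case: ltP => Dr.
  rewrite -[leLHS]mulrA -/(minimax_rate s Rad n) -/r.
  (* The exponential in [Rad] is at most 1, and [r <= 1] bounds [rho^2 / 2] by [5 / 8], whence the
     factor [expR (-1)]. *)
  apply: (@le_trans _ _ (c * r)).
    rewrite ler_pM2r// ler_piMr// ?(ltW c0)// -expR0 ler_expR.
    by rewrite mulNr oppr_le0 mulr_ge0// powR_ge0.
  have -> : c * r = pk * expR (-1) * 3 / (64 * tau) * (r ^+ 2 / r).
    by rewrite /c; field; rewrite !gt_eqF.
  have Dr2 : Delta ^+ 2 <= r ^+ 2 by rewrite ler_sqr ?nnegrE; exact: ltW.
  have rr : rho ^+ 2 <= 5 / 4 * r ^+ 2 by rewrite rho2 dN; move: N2 Dr2; lra.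
  have r21 : r ^+ 2 <= 1 by rewrite expr_le1// ltW.
  apply: key => //.
  by rewrite ler_expR; move: rr r21; lra.
have -> : c * expR (- 2 * Delta ^+ 2) / Delta * Rad `^ (2 / (2 * s + 1)) *
    n%:R `^ (- (2 * s / (2 * s + 1))) = c * (expR (- 2 * Delta ^+ 2) * (r ^+ 2 / Delta)).
  by rewrite /r minimax_rate2//; ring.
(* The factor [expR (-1)] of [c] is given up; the exponent is then handled by [rho^2 / 2 <= 5 / 8 *
   Delta^2 <= 2 * Delta^2]. *)
apply: (@le_trans _ _ (pk * expR (- 2 * Delta ^+ 2) * 3 / (64 * tau) * (r ^+ 2 / Delta))).
  have -> : pk * expR (- 2 * Delta ^+ 2) * 3 / (64 * tau) * (r ^+ 2 / Delta) =
      pk * 3 / (64 * tau) * (expR (- 2 * Delta ^+ 2) * (r ^+ 2 / Delta)).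
    by field; rewrite !gt_eqF.
  apply: ler_wpM2r; first by rewrite mulr_ge0 ?expR_ge0// divr_ge0 ?ltW.
  have -> : c = expR (-1) * (pk * 3 / (64 * tau)) by rewrite /c; ring.
  rewrite ler_piMl//; first by rewrite divr_ge0 ?mulr_ge0// ltW.
have Dr2 : r ^+ 2 <= Delta ^+ 2 by rewrite ler_sqr// nnegrE ltW.
have rr : rho ^+ 2 <= 5 / 4 * Delta ^+ 2 by rewrite rho2 dN; move: N2 Dr2; lra.
apply: key => //.
by rewrite ler_expR; move: rr D20; lra.
Qed.
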